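(* Let $\Bbbk$ be an algebraically closed field, let $d\geq3$, and let $P_1,\ldots,P_{d+4}$ be points in $\mathbb{P}^d=\mathbb{P}^d_{\Bbbk}$ not all lying on a common hyperplane. Then the following are equivalent: \begin{enumerate} \item[(i)] $(P_1,\ldots,P_{d+4})\in V_{d,d+4}$ (equivalently, $P_1,\ldots,P_{d+4}$ lie on a quasi-Veronese curve); \item[(ii)] for every $6$-element subset $I=\{i_1<\ldots<i_6\}\subseteq\{1,\dots,d+4\}$, with complement $I^c=\{j_1<\ldots<j_{d-2}\}$, the following equality in the Grassmann--Cayley algebra holds: \begin{gather*} (P_{i_1}P_{i_2}\wedge P_{i_4}P_{i_5}P_{j_1}\ldots P_{j_{d-2}})\vee(P_{i_2}P_{i_3}\wedge P_{i_5}P_{i_6}P_{j_1}\ldots P_{j_{d-2}})\\ \vee(P_{i_3}P_{i_4}\wedge P_{i_6}P_{i_1}P_{j_1}\ldots P_{j_{d-2}})\vee P_{j_1}\ldots P_{j_{d-2}}=0. \end{gather*} \end{enumerate}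
   Context: The base field $\Bbbk$ is algebraically closed of arbitrary characteristic. Veronese compactification: a rational normal curve in $\mathbb{P}^d$ is a smooth rational curve of degree $d$ in $\mathbb{P}^d$. $V_{d,d+4}\subseteq(\mathbb{P}^d)^{d+4}$ is the Zariski closure of the set of $(d+4)$-tuples of distinct points in $\mathbb{P}^d$ that lie on a rational normal curve. Quasi-Veronese curve: a complete, connected (possibly reducible) curve of degree $d$ in $\mathbb{P}^d$ not contained in a hyperplane. (Each irreducible component of such a curve is a rational normal curve in its linear span, and each singularity is étale locally a union of coordinate axes; in particular these curves are reduced.) Grassmann--Cayley algebra: let $V=\Bbbk^{d+1}$, and set $D=d+1$. The Grassmann--Cayley algebra of $V$ is the exterior algebra $\Lambda(V)$ with two operations. The join $\vee$ is the usual exterior product, also written by juxtaposition: $v_1\vee\cdots\vee v_k=v_1\ldots v_k$ (an extensor of step $k$). For $v_1,\dots,v_D\in V$, $[v_1\ldots v_D]\in\Bbbk$ is the determinant of the matrix of coordinates of $v_1,\dots,v_D$; it is identified with $v_1\ldots v_D$. For $j+k\ge D$, the meet $\wedge$ of two extensors is $$(a_1\ldots a_j)\wedge(b_1\ldots b_k)=\sum_\sigma\operatorname{sign}(\sigma)[a_{\sigma(1)}\ldots a_{\sigma(D-k)}b_1\ldots b_k]\,a_{\sigma(D-k+1)}\ldots a_{\sigma(j)}\in\Lambda^{j+k-D}(V),$$ the sum being over permutations $\sigma$ of $\{1,\ldots,j\}$ with $\sigma(1)<\ldots<\sigma(D-k)$ and $\sigma(D-k+1)<\ldots<\sigma(j)$.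 Both operations are extended by distributivity. In a Grassmann--Cayley expression involving points of $\mathbb{P}^d$, each point is replaced by a nonzero vector of $V$ representing it; the vanishing of the expression does not depend on the choice of representatives. *)

(* Defs.v *)
From mathcomp Require Import all_boot all_order all_fingroup all_algebra.
From mathcomp Require Import mpoly.

Set Implicit Arguments.
Unset Strict Implicit.
Unset Printing Implicit Defensive.

Import GRing.Theory.
Local Open Scope ring_scope.

(* Points of P^n are represented by nonzero row vectors of length n.+1 (their
   homogeneous coordinates), and subsets of P^n by predicates on row vectors.
   The evaluation of a form F at x is F.@[x 0]. *)

Section ProjectiveSpace.
Variable k : fieldType.

Definition same_point n (x y : 'rV[k]_n) : Prop :=
  exists2 c : k, c != 0 & y = c *: x.

Definition in_hyperplane n (X : 'rV[k]_n -> Prop) : Prop :=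
  exists2 h : 'cV[k]_n, h != 0 & forall x, X x -> x *m h = 0.

Definition vanishes_on n (F : {mpoly k[n]}) (X : 'rV[k]_n -> Prop) : Prop :=
  forall x, X x -> F.@[x 0] = 0.

Definition zclosed n (X : 'rV[k]_n -> Prop) : Prop :=
  exists2 S : {mpoly k[n]} -> Prop,
    forall F, S F -> exists m : nat, F \is m.-homog &
    forall x, X x <-> x != 0 /\ forall F, S F -> F.@[x 0] = 0.

(* For a closed X, the relatively closed subsets of X are the closed sets
   contained in X. *)
Definition connected n (X : 'rV[k]_n -> Prop) : Prop :=
  (exists x, X x) /\
  forall A B : 'rV[k]_n -> Prop, zclosed A -> zclosed B ->
    (forall x, X x <-> A x \/ B x) -> (forall x, ~ (A x /\ B x)) ->
    (forall x, ~ A x) \/ (forall x, ~ B x).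

Definition irreducible_set n (X : 'rV[k]_n -> Prop) : Prop :=
  (exists x, X x) /\
  forall A B : 'rV[k]_n -> Prop, zclosed A -> zclosed B ->
    (forall x, X x <-> A x \/ B x) ->
    (forall x, X x -> A x) \/ (forall x, X x -> B x).

(* The value at m of the Hilbert function of X is h: the forms of degree m
   vanishing on X have codimension h among all forms of degree m. *)
Definition hilbert_value n (X : 'rV[k]_n.+1 -> Prop) (m h : nat) : Prop :=
  exists2 U : {vspace dhomog n.+1 k m},
    forall F : dhomog n.+1 k m, F \in U <-> vanishes_on (mpoly_of_dhomog F) X &
    (\dim U + h)%N = \dim {: dhomog n.+1 k m}.

(* The Hilbert polynomial of X is e * m + c; for e > 0 this says that X has
   dimension 1 and degree e. *)
Definition dim1_degree n (X : 'rV[k]_n.+1 -> Prop) (e : nat) : Prop :=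
  exists (c : int) (m0 : nat), forall m : nat, (m0 <= m)%N ->
    exists2 h : nat, hilbert_value X m h & h%:Z = e%:Z * m%:Z + c.

(* The tangent space of the affine cone over X at each point of X is a plane,
   that is, the tangent space of X there is a line. *)
Definition smooth1 n (X : 'rV[k]_n -> Prop) : Prop :=
  forall x, X x -> exists2 U : {vspace 'rV[k]_n}, \dim U = 2%N &
    forall v : 'rV[k]_n, v \in U <->
      forall (m : nat) (F : {mpoly k[n]}), F \is m.-homog -> vanishes_on F X ->
        \sum_(i < n) (F^`M(i)).@[x 0] * v 0 i = 0.

(* A rational map to P^n is given by forms f of a common degree, and is defined
   where they do not all vanish. *)
Definition forms m n (f : 'I_n -> {mpoly k[m]}) : Prop :=
  exists e : nat, forall j, f j \is e.-homog.

Definition rmap m n (f : 'I_n -> {mpoly k[m]}) (x : 'rV[k]_m) : 'rV[k]_n :=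
  \row_j (f j).@[x 0].

Definition rat_inverse m n (X : 'rV[k]_m -> Prop) (Y : 'rV[k]_n -> Prop)
    (f : 'I_n -> {mpoly k[m]}) (g : 'I_m -> {mpoly k[n]}) : Prop :=
  [/\ forall x, X x -> rmap f x != 0 -> Y (rmap f x),
      exists x, [/\ X x, rmap f x != 0 & rmap g (rmap f x) != 0] &
      forall x, X x -> rmap f x != 0 -> rmap g (rmap f x) != 0 ->
        same_point x (rmap g (rmap f x))].

(* For irreducible closed X and Y. *)
Definition birational m n (X : 'rV[k]_m -> Prop) (Y : 'rV[k]_n -> Prop) : Prop :=
  exists (f : 'I_n -> {mpoly k[m]}) (g : 'I_m -> {mpoly k[n]}),
    [/\ forms f, forms g, rat_inverse X Y f g & rat_inverse Y X g f].

Definition rational n (X : 'rV[k]_n -> Prop) : Prop :=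
  birational (fun t : 'rV[k]_2 => t != 0) X.

(* A rational normal curve spans P^d: the degree d curves lying in a hyperplane
   (e.g. smooth rational quartics in a hyperplane of P^4) are excluded. *)
Definition rational_normal_curve d (C : 'rV[k]_d.+1 -> Prop) : Prop :=
  [/\ zclosed C /\ irreducible_set C, dim1_degree C d, smooth1 C, rational C &
      ~ in_hyperplane C].

(* Curves are reduced, hence given by their sets of points; a connected closed
   set of dimension 1 has no isolated point, hence is a curve. *)
Definition quasi_Veronese d (C : 'rV[k]_d.+1 -> Prop) : Prop :=
  [/\ zclosed C, connected C, dim1_degree C d & ~ in_hyperplane C].

Definition on_rational_normal_curve d n (Q : 'I_n -> 'rV[k]_d.+1) : Prop :=
  [/\ forall i, Q i != 0,
      forall i j, i != j -> ~ same_point (Q i) (Q j) &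
      exists2 C, rational_normal_curve C & forall i, C (Q i)].

(* Polynomials in the n * d.+1 coordinates of n points of P^d, homogeneous in
   the coordinates of each point; the j-th coordinate of the i-th point is
   the variable of index mxvec_index i j. *)
Definition multihomog d n (F : {mpoly k[n * d.+1]}) : Prop :=
  exists e : 'I_n -> nat, forall m, m \in msupp F -> forall i : 'I_n,
    (\sum_(j < d.+1) m (mxvec_index i j))%N = e i.

Definition eval_points d n (F : {mpoly k[n * d.+1]}) (Q : 'I_n -> 'rV[k]_d.+1) : k :=
  F.@[mxvec (\matrix_(i < n) Q i) 0].

(* V_{d,n}: the closed subsets of (P^d)^n are the zero loci of multihomogeneous
   polynomials. *)
Definition Veronese_compactification d n (P : 'I_n -> 'rV[k]_d.+1) : Prop :=
  (forall i, P i != 0) /\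
  forall F : {mpoly k[n * d.+1]}, multihomog F ->
    (forall Q, on_rational_normal_curve Q -> eval_points F Q = 0) ->
    eval_points F P = 0.

End ProjectiveSpace.

Section GrassmannCayley.
Variables (k : fieldType) (D : nat).

(* The exterior algebra of k^D: x S is the coefficient of x on
   e_S = e_{s_1} ... e_{s_r}, for S = {s_1 < ... < s_r}. *)
Local Notation ext := {ffun {set 'I_D} -> k^o}.

Definition ext1 : ext := [ffun S => (S == set0)%:R].

Definition ext_vec (v : 'rV[k]_D) : ext :=
  [ffun S => \sum_(i < D | S == [set i]) v 0 i].

(* For disjoint S and T, e_S e_T = (-1) ^ inversions S T e_(S U T). *)
Definition inversions (S T : {set 'I_D}) : nat :=
  #|[set ij : 'I_D * 'I_D | [&& ij.1 \in S, ij.2 \in T & (ij.2 < ij.1)%N]]|.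

Definition join (x y : ext) : ext :=
  [ffun U : {set 'I_D} => \sum_(S : {set 'I_D} | S \subset U)
     (-1) ^+ inversions S (U :\: S) * x S * y (U :\: S)].

Definition extensor (s : seq 'rV[k]_D) : ext := foldr (fun v => join (ext_vec v)) ext1 s.

(* Meaningful for size s = D. *)
Definition bracket (s : seq 'rV[k]_D) : k := \det (\matrix_(i < D) s`_i).

Definition shuffle j (p : nat) (s : 'S_j) : bool :=
  [forall u : 'I_j, forall v : 'I_j,
     (u < v)%N && ((v < p)%N || (p <= u)%N) ==> (s u < s v)%N].

(* The meet of the extensors a_1 ... a_j and b_1 ... b_r, for r <= D <= j + r. *)
Definition meet (a b : seq 'rV[k]_D) : ext :=
  let p := (D - size b)%N in
  \sum_(s : 'S_(size a) | shuffle p s)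
    let sa := [seq a`_(s i) | i : 'I_(size a)] in
    ((-1) ^+ s * bracket (take p sa ++ b)) *: extensor (drop p sa).

End GrassmannCayley.

(* Main.v *)
From HB Require Import structures.
Require Import Defs.
From mathcomp Require Import all_boot all_order all_fingroup all_algebra.
From mathcomp Require Import mpoly ring zify.
From Stdlib Require Import Classical_Prop.

(** Write d = r + 2.  Projecting from r = d - 2 of the points turns the Grassmann-Cayley
    expression of a six-element set I, up to a nonzero factor, into Pascal's expression of the
    projections of the six points of I to a plane ([gc_pascal]), which vanishes exactly when
    these lie on a conic ([pascal0P]); when the r points are dependent the expression is zero
    anyway.

    Necessity.  A quasi-Veronese curve C is projected from r independent points of itself onto a
    set that lies on a conic ([projected_conic]).  This is a count of quadrics.  Projecting a
    connected closed set from one of its points lowers its Hilbert function at m by at least m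
    ([hge_project]), while C imposes at most 2d + 1 conditions on quadrics ([quadrics_bound]);
    hence at most 2d + 1 - 2r = 5 of the six quadratic monomials of the plane are independent on
    the projection.  As the expression is multihomogeneous, its vanishing on the configurations
    lying on rational normal curves passes to their Zariski closure ([Veronese_gc]).

    Sufficiency.  The d + 4 spanning vectors have a three-dimensional space of linear relations,
    so dually they give d + 4 vectors of k^3, their Gale dual.  Choosing a basis among the
    points normalizes the Gale vectors of the three remaining points to the unit vectors.  The
    conics through the unit points are u yz + v xz + w xy = 0, and the conditions for the
    six-element sets containing these three points say together that some such conic contains
    the whole Gale dual ([gc_conic]).  If the conic is smooth, then its parametrization turns the
    linear relations into interpolation identities that put the points on a rational curve of
    degree d, or on a union of rational curves when Gale vectors coincide or vanish
    ([gale_curve]).  If it is a pair of lines, the same is done for each line, and the two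
    resulting curves share a point or are bridged by a line ([conic_curve]).  The unions are built
    with Hilbert function at most dm + 1, and a connected nondegenerate closed set in P^d has
    Hilbert function at least dm + 1; so they are quasi-Veronese ([curve_dim1]).

    To reach the Zariski closure, deform the Gale dual together with the conic
    ([conic_value]).  If the conic is smooth and the Gale vectors are pairwise distinct points of
    it, then the points lie on a rational normal curve ([nice_curve]).  Every other pair of a
    conic and vectors on it is the value at t = 0 of a polynomial family whose value at almost
    all t is of this kind, or was reached before; a polynomial in t that vanishes for almost all
    t vanishes at t = 0. *)

Set Implicit Arguments.
Unset Strict Implicit.
Unset Printing Implicit Defensive.
Import GRing.Theory.
Local Open Scope ring_scope.

(** * Forms and closed sets *)

Lemma not_forall_exists (T : Type) (P : T -> Prop) :
  ~ (forall x, P x) -> exists x, ~ P x.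
Proof.
by move=> nP; apply: NNPP => nE; apply: nP => x; apply: NNPP => ?; apply: nE; exists x.
Qed.

Section Forms.
Variable k : fieldType.

(** Forms are handled through the functions that they induce: vanishing and linear
    independence on a set of points only depend on these. *)
Definition isform n (m : nat) (f : 'rV[k]_n -> k) : Prop :=
  exists2 F : {mpoly k[n]}, F \is m.-homog & forall x, f x = F.@[x 0].

Section FormTheory.
Variable n : nat.
Implicit Types f g : 'rV[k]_n -> k.

Lemma isform_ext m f g : f =1 g -> isform m f -> isform m g.
Proof. by move=> e [F hF eF]; exists F => // x; rewrite -e. Qed.

Lemma isform0 m : isform m (fun _ : 'rV[k]_n => 0).
Proof. by exists 0; rewrite ?dhomog0 // => x; rewrite meval0. Qed.

Lemma isform_cst c : isform 0 (fun _ : 'rV[k]_n => c).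
Proof.
exists c%:MP => [|x]; last by rewrite mevalC.
by rewrite -alg_mpolyC; apply/dhomogZ/dhomog1.
Qed.

Lemma isformD m f g : isform m f -> isform m g -> isform m (fun x => f x + g x).
Proof.
case=> F hF eF [G hG eG]; exists (F + G); first exact: rpredD.
by move=> x; rewrite mevalD eF eG.
Qed.

Lemma isformZ m c f : isform m f -> isform m (fun x => c * f x).
Proof.
case=> F hF eF; exists (c *: F); first exact: dhomogZ.
by move=> x; rewrite mevalZ eF.
Qed.

Lemma isformB m f g : isform m f -> isform m g -> isform m (fun x => f x - g x).
Proof.
move=> hf hg; have := isformD hf (isformZ (-1) hg).
by apply: isform_ext => x; rewrite mulN1r.
Qed.

Lemma isformM m1 m2 f g :
  isform m1 f -> isform m2 g -> isform (m1 + m2) (fun x => f x * g x).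
Proof.
case=> F hF eF [G hG eG]; exists (F * G); first exact: dhomogM.
by move=> x; rewrite mevalM eF eG.
Qed.

Lemma isformX m e f : isform m f -> isform (m * e) (fun x => f x ^+ e).
Proof.
case=> F hF eF; exists (F ^+ e); first exact: dhomogMn.
by move=> x; rewrite rmorphXn /= eF.
Qed.

Lemma isform_sum (I : Type) (r : seq I) (P : pred I) m (f : I -> 'rV[k]_n -> k) :
  (forall i, P i -> isform m (f i)) ->
  isform m (fun x => \sum_(i <- r | P i) f i x).
Proof.
move=> hf; elim: r => [|a r IH].
  by apply: isform_ext (isform0 m) => x; rewrite big_nil.
case Pa: (P a).
  by apply: isform_ext (isformD (hf a Pa) IH) => x; rewrite big_cons Pa.
by apply: isform_ext IH => x; rewrite big_cons Pa.
Qed.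

Lemma isform_prod (I : Type) (r : seq I) (P : pred I) (e : I -> nat) (f : I -> 'rV[k]_n -> k) :
  (forall i, P i -> isform (e i) (f i)) ->
  isform (\sum_(i <- r | P i) e i) (fun x => \prod_(i <- r | P i) f i x).
Proof.
move=> hf; elim: r => [|a r IH].
  by rewrite big_nil; apply: isform_ext (isform_cst 1) => x; rewrite big_nil.
rewrite big_cons; case Pa: (P a).
  by apply: isform_ext (isformM (hf a Pa) IH) => x; rewrite big_cons Pa.
by apply: isform_ext IH => x; rewrite big_cons Pa.
Qed.

Lemma isform_coord i : isform 1 (fun x : 'rV[k]_n => x 0 i).
Proof.
exists 'X_i; last by move=> x; rewrite mevalXU.
by rewrite dhomogX /= mdeg1.
Qed.

Lemma isform_lin (l : 'cV[k]_n) : isform 1 (fun x => (x *m l) 0 0).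
Proof.
have : isform 1 (fun x : 'rV_n => \sum_i l i 0 * x 0 i).
  by apply: isform_sum => i _; apply/isformZ/isform_coord.
by apply: isform_ext => x; rewrite mxE; apply: eq_bigr => i _; rewrite mulrC.
Qed.

Lemma isform_monE m f : isform m f -> exists2 F : {mpoly k[n]},
  {in msupp F, forall u, mdeg u = m} &
  forall x, f x = \sum_(u <- msupp F) F@_u * \prod_i x 0 i ^+ u i.
Proof.
case=> F /dhomogP hF eF; exists F; first exact: hF.
by move=> x; rewrite eF mevalE.
Qed.

Lemma isform_scale m f c x : isform m f -> f (c *: x) = c ^+ m * f x.
Proof.
case/isform_monE=> F hF eF; rewrite !eF mulr_sumr big_seq [RHS]big_seq.
apply: eq_bigr => u /hF du; rewrite mulrCA; congr (_ * _).
rewrite -du mdegE -prodrXr -big_split /=.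
by apply: eq_bigr => i _; rewrite mxE exprMn.
Qed.

Lemma isform0_const f x y : isform 0 f -> f x = f y.
Proof.
suff H z : isform 0 f -> f z = f 0 by move=> hf; rewrite (H x hf) (H y hf).
by move=> hf; rewrite -(scale0r z) (isform_scale _ _ hf) expr0 mul1r.
Qed.

(** Each monomial of positive degree has a variable to take out; this is what inductions on
    the degree use. *)
Lemma isform_split m f : isform m.+1 f -> exists2 g : 'I_n -> 'rV[k]_n -> k,
  (forall i, isform m (g i)) & forall x, f x = \sum_i x 0 i * g i x.
Proof.
move=> /isform_monE [F hF eF].
suff H (s : seq 'X_{1..n}) : {in s, forall u, mdeg u = m.+1} ->
  exists2 g : 'I_n -> 'rV[k]_n -> k, (forall i, isform m (g i)) &
  forall x : 'rV_n, \sum_(u <- s) F@_u * \prod_i x 0 i ^+ u i = \sum_i x 0 i * g i x.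
  by have [g hg eg] := H _ hF; exists g => // x; rewrite eF eg.
elim: s => [|u s IH] hs.
  exists (fun _ _ => 0) => [i|x]; first exact: isform0.
  by rewrite big_nil big1 // => i _; rewrite mulr0.
have [|g hg eg] := IH; first by move=> v hv; apply: hs; rewrite inE hv orbT.
have /eqP du := hs u (mem_head _ _).
have [i ui] : exists i, (0 < u i)%N.
  apply/existsP; apply: contraLR du; rewrite negb_exists => /forallP h.
  by rewrite mdegE big1 // => i _; apply/eqP; move: (h i); rewrite lt0n negbK.
pose g0 (x : 'rV[k]_n) := F@_u * (x 0 i ^+ (u i).-1 * \prod_(j | j != i) x 0 j ^+ u j).
exists (fun j x => (j == i)%:R * g0 x + g j x) => [j|x].
  apply: isformD (hg j); apply/isformZ/isformZ.
  have -> : m = (1 * (u i).-1 + \sum_(j0 | j0 != i) 1 * u j0)%N.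
    apply: succn_inj; rewrite -(eqP du) mdegE (bigD1 i) //=.
    rewrite mul1n -addSn prednK //; congr (_ + _)%N.
    by apply: eq_bigr => j0 _; rewrite mul1n.
  apply: isformM; first exact/isformX/isform_coord.
  by apply: (@isform_prod _ _ _ (fun j0 => (1 * u j0)%N) (fun j0 x => x 0 j0 ^+ u j0)) => j0 _;
    exact/isformX/isform_coord.
rewrite big_cons eg.
under [RHS]eq_bigr => j _ do rewrite mulrDr.
rewrite big_split /=; congr (_ + _).
rewrite [RHS](bigD1 i) //= [X in _ + X]big1 => [|j /negbTE ->]; last by rewrite mul0r mulr0.
rewrite addr0 eqxx mul1r /g0 mulrCA; congr (_ * _).
by rewrite (bigD1 i) //= mulrA -exprS prednK.
Qed.

Lemma isform_det m h (A : 'I_h -> 'I_h -> 'rV[k]_n -> k) :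
  (forall i j, isform m (A i j)) ->
  isform (h * m) (fun x => \det (\matrix_(i, j) A i j x)).
Proof.
move=> hA; apply: isform_sum => s _; apply: isformZ.
have -> : (h * m = \sum_(i < h) m)%N by rewrite sum_nat_const card_ord.
apply: (@isform_ext _ (fun x => \prod_i A i (s i) x)).
  by move=> x; apply: eq_bigr => i _; rewrite mxE.
by apply: (@isform_prod _ _ _ (fun=> m) (fun i => A i (s i))) => i _.
Qed.

Lemma isform_eq m m' f : m = m' -> isform m f -> isform m' f.
Proof. by move=> <-. Qed.

Lemma isform_neq0 (x : 'rV[k]_n) m : x != 0 ->
  exists2 f, isform m f & f x != 0.
Proof.
move=> /rV0Pn [i xi]; exists (fun x => x 0 i ^+ m); last exact: expf_neq0.
by apply: isform_eq (isformX m (isform_coord i)); rewrite mul1n.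
Qed.

Lemma isform_at0 m f : isform m.+1 f -> f 0 = 0.
Proof. by move=> /isform_split [g _ ->]; rewrite big1 // => i _; rewrite mxE mul0r. Qed.

End FormTheory.

Lemma isform_comp n r (M : 'M[k]_(n, r)) m (f : 'rV[k]_r -> k) :
  isform m f -> isform m (fun x => f (x *m M)).
Proof.
move=> /isform_monE [F hF eF].
apply: (@isform_ext _ _ (fun x => \sum_(u <- msupp F | u \in msupp F) F@_u * \prod_i (x *m M) 0 i ^+ u i)).
  by move=> x; rewrite eF -big_seq.
apply: isform_sum => u /hF du; apply: isformZ.
rewrite -du mdegE; apply: (@isform_prod _ _ _ _ _ (fun i x => (x *m M) 0 i ^+ u i)) => i _.
apply: (isform_eq (mul1n _)); apply: isformX.
apply: isform_ext (isform_lin (col i M)) => x.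
by rewrite !mxE; apply: eq_bigr => j _; rewrite !mxE.
Qed.

(** All the forms vanishing on X can be taken as its equations, so that no choice of
    equations has to be carried around. *)
Lemma zclosedP n (X : 'rV[k]_n -> Prop) : zclosed X <->
  (forall x, X x -> x != 0) /\
  (forall x, x != 0 -> (forall m f, isform m f -> (forall y, X y -> f y = 0) -> f x = 0) -> X x).
Proof.
split=> [[S hS hX]|[h0 hX]].
  split=> [x /hX[]//|x x0 H]; apply/hX; split=> // F SF.
  have [m hF] := hS F SF.
  by apply: (H m (fun x => F.@[x 0])) => [|y /hX [_ /(_ F SF)]]; first by exists F.
exists (fun F => (exists m : nat, F \is m.-homog) /\ forall x, X x -> F.@[x 0] = 0).
  by move=> F [].
move=> x; split=> [Xx|[x0 H]]; first by split=> [|F [_ /(_ x Xx)]//]; exact: h0.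
by apply: hX => // m f [F hF eF] fX; rewrite eF; apply: H; split=> [|y /fX]; [exists m|rewrite eF].
Qed.

Lemma zclosed_neq0 n (X : 'rV[k]_n -> Prop) x : zclosed X -> X x -> x != 0.
Proof. by move/zclosedP=> [h _]; apply: h. Qed.

Lemma zclosed_scale n (X : 'rV[k]_n -> Prop) x c : zclosed X -> c != 0 -> X x -> X (c *: x).
Proof.
move=> /zclosedP[h0 hX] c0 Xx; apply: hX => [|m f hf fX].
  by rewrite scaler_eq0 negb_or c0 h0.
by rewrite (isform_scale _ _ hf) fX // mulr0.
Qed.

Lemma zclosed_and n (X Y : 'rV[k]_n -> Prop) :
  zclosed X -> zclosed Y -> zclosed (fun x => X x /\ Y x).
Proof.
move=> /zclosedP[X0 hX] /zclosedP[Y0 hY]; apply/zclosedP; split=> [x [/X0]//|x x0 H].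
split; [apply: hX|apply: hY] => // m f hf fX; apply: (H m f hf) => y [].
  by move=> /fX.
by move=> _ /fX.
Qed.

(** A product of equations of X and Y vanishes on the union. *)
Lemma zclosed_or n (X Y : 'rV[k]_n -> Prop) :
  zclosed X -> zclosed Y -> zclosed (fun x => X x \/ Y x).
Proof.
move=> /zclosedP[X0 hX] /zclosedP[Y0 hY]; apply/zclosedP; split=> [x [/X0//|/Y0//]|x x0 H].
case: (classic (X x)) => nX; [by left|right].
apply: hY => // m g hg gY; apply: NNPP => gx; apply: nX; apply: hX => // m' f hf fX.
have fg y : X y \/ Y y -> f y * g y = 0.
  by case=> [/fX ->|/gY ->]; rewrite ?mul0r ?mulr0.
by have /eqP := H _ _ (isformM hf hg) fg; rewrite mulf_eq0 => /orP [/eqP//|/eqP].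
Qed.

Lemma zclosed_zero n (X : 'rV[k]_n -> Prop) m f : zclosed X -> isform m f ->
  zclosed (fun x => X x /\ f x = 0).
Proof.
move=> /zclosedP[X0 hX] hf; apply/zclosedP; split=> [x [/X0]//|x x0 H].
split; last by apply: (H m f hf) => y [].
by apply: hX => // m' g hg gX; apply: (H m' g hg) => y [/gX].
Qed.

(** The smallest closed set of projective space containing the nonzero vectors of X. *)
Definition zclosure n (X : 'rV[k]_n -> Prop) : 'rV[k]_n -> Prop := fun x =>
  x != 0 /\ forall m f, isform m f -> (forall y, X y -> f y = 0) -> f x = 0.

Lemma zclosure_closed n (X : 'rV[k]_n -> Prop) : zclosed (zclosure X).
Proof.
apply/zclosedP; split=> [x []//|x x0 H]; split=> // m f hf fX.
by apply: (H m f hf) => y [_ /(_ m f hf fX)].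
Qed.

Lemma sub_zclosure n (X : 'rV[k]_n -> Prop) x : X x -> x != 0 -> zclosure X x.
Proof. by move=> Xx x0; split=> // m f _; apply. Qed.

Lemma irreducible_connected n (C : 'rV[k]_n -> Prop) : irreducible_set C -> connected C.
Proof.
case=> exC irr; split=> // A B zA zB AB dAB.
case: (irr A B zA zB AB) => H; [right|left] => x.
  by move=> Bx; apply: (dAB x); split=> //; apply: H; apply/AB; right.
by move=> Ax; apply: (dAB x); split=> //; apply: H; apply/AB; left.
Qed.

End Forms.

(** * Hilbert functions *)

Section Indep.
Variable k : fieldType.

Lemma left_kernel h N (A : 'M[k]_(h, N)) : (N < h)%N -> exists2 c : 'rV_h, c != 0 & c *m A = 0.
Proof.
move=> lt; have : kermx A != 0.
  by rewrite -mxrank_eq0 mxrank_ker -lt0n subn_gt0 (leq_ltn_trans (rank_leq_col A)).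
by move=> /rowV0Pn [c /sub_kermxP cA c0]; exists c.
Qed.

(** Linear independence modulo the functions that vanish on X. *)
Definition indep (T : Type) (X : T -> Prop) h (F : 'I_h -> T -> k) : Prop :=
  forall c : 'rV[k]_h, (forall x, X x -> \sum_i c 0 i * F i x = 0) -> c = 0.

Lemma indep_sub T (X Y : T -> Prop) h (F : 'I_h -> T -> k) :
  (forall x, X x -> Y x) -> indep X F -> indep Y F.
Proof. by move=> sXY hF c hc; apply: hF => x /sXY /hc. Qed.

Lemma indep_span T (X : T -> Prop) h N (F : 'I_h -> T -> k) (G : 'I_N -> T -> k) (A : 'M_(h, N)) :
  (forall i x, X x -> F i x = \sum_j A i j * G j x) -> indep X F -> (h <= N)%N.
Proof.
move=> eF hF; rewrite leqNgt; apply/negP => lt.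
have [c c0 cA] := left_kernel A lt; case/eqP: c0; apply: hF => x Xx.
transitivity (\sum_j (c *m A) 0 j * G j x).
  under eq_bigr => i _ do rewrite eF // mulr_sumr.
  rewrite exchange_big; apply: eq_bigr => j _; rewrite mxE mulr_suml.
  by apply: eq_bigr => i _; rewrite mulrA.
by rewrite cA big1 // => j _; rewrite mxE mul0r.
Qed.

(** Gaussian elimination: subtract from a new function the combination of the others that
    agrees with it at the points found so far; it is not zero on X, which gives a new point
    and a block-triangular matrix of values. *)
Lemma indep_points T (X : T -> Prop) h (F : 'I_h -> T -> k) : indep X F ->
  exists2 p : 'I_h -> T, (forall j, X (p j)) & (\matrix_(i, j) F i (p j)) \in unitmx.
Proof.
elim: h F => [|h IH] F; last move=> hF0; last have hF : @indep T X (1 + h) F := hF0; first move=> _.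
  exists (fun i : 'I_0 => False_rect _ (notF (ltn_ord i))); first by case.
  by rewrite unitmxE det_mx00 unitr1.
have [|p Xp pU] := IH (fun i => F (rshift 1 i)).
  move=> c hc; suff : row_mx (0 : 'rV[k]_1) c = 0 by rewrite -row_mx0 => /eq_row_mx [].
  apply: hF => x /hc; rewrite big_split_ord /= big_ord1 row_mxEl mxE mul0r add0r.
  by under eq_bigr => i _ do rewrite -(row_mxEr (0 : 'rV_1)).
set A := \matrix_(i, j) _ in pU.
pose c := \row_j F (@lshift 1 h ord0) (p j) *m invmx A.
have [x Xx xn] : exists2 x, X x &
    F (@lshift 1 h ord0) x - \sum_i c 0 i * F (rshift 1 i) x != 0.
  apply: NNPP => H.
  suff : row_mx (1%:M : 'M_1) (- c) = 0.
    by rewrite -row_mx0 => /eq_row_mx [] /matrixP /(_ 0 0); rewrite !mxE => /eqP; rewrite oner_eq0.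
  apply: hF => x Xx; rewrite big_split_ord /= big_ord1 row_mxEl mxE mul1r.
  under eq_bigr => i _ do rewrite row_mxEr mxE mulNr.
  rewrite sumrN; apply/eqP; apply/negP => /negP xn; apply: H; by exists x.
exists (fun j => match split (j : 'I_(1 + h)) with inl _ => x | inr j => p j end).
  by move=> j; case: (split _).
set B := \matrix_(_, _) _.
pose B' : 'M_(1 + h) := block_mx (F (@lshift 1 h ord0) x)%:M (\row_j F (@lshift 1 h ord0) (p j))
                    (\col_i F (rshift 1 i) x) A.
have eB : (B : 'M_(1 + h)) = B'.
  apply/matrixP => i j; rewrite /B mxE /B'.
  have [i' ->|i' ->] := @split_ordP 1 h i;
  have [j' ->|j' ->] := @split_ordP 1 h j;
  rewrite ?(@unsplitK 1 h (inl _)) ?(@unsplitK 1 h (inr _));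
  rewrite /block_mx ?col_mxEu ?col_mxEd ?row_mxEl ?row_mxEr !mxE ?ord1 //=.
pose U : 'M[k]_(1 + h) := block_mx 1 (- c) 0 1%:M.
have dU : \det U = 1 by rewrite det_ublock !det1 mulr1.
change ((B : 'M_(1 + h)) \in unitmx); rewrite eB.
have : U *m B' = block_mx (F (@lshift 1 h ord0) x - \sum_i c 0 i * F (rshift 1 i) x)%:M 0
                    (\col_i F (rshift 1 i) x) A.
  rewrite mulmx_block !mul1mx !mul0mx !add0r mulNmx mulNmx mulmxKV // subrr.
  congr (block_mx _ _ _ _); apply/matrixP => a b; rewrite !ord1 !mxE ?mulr1n.
  by congr (_ - _); apply: eq_bigr => l _; congr (_ * _); rewrite mxE.
move=> /(congr1 determinant); rewrite det_mulmx dU mul1r det_lblock det_scalar1 unitmxE => ->.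
by rewrite unitrM unitfE xn -unitmxE.
Qed.

(** The Hilbert function of X at m is at least (for [hge]), at most (for [hle]) h. The two
    bounds are proved by different means, each with families of forms instead of
    subspaces. *)
Definition hge n (X : 'rV[k]_n -> Prop) m h : Prop :=
  exists2 F : 'I_h -> 'rV[k]_n -> k, (forall i, isform m (F i)) & indep X F.
Definition hle n (X : 'rV[k]_n -> Prop) m h : Prop :=
  forall h' (F : 'I_h' -> 'rV[k]_n -> k), (forall i, isform m (F i)) -> indep X F -> (h' <= h)%N.

Lemma hge_le n (X : 'rV[k]_n -> Prop) m h h' : hge X m h -> hle X m h' -> (h <= h')%N.
Proof. by case=> F hF iF; apply; eauto. Qed.

Lemma hle_trans n (X : 'rV[k]_n -> Prop) m h h' : (h <= h')%N -> hle X m h -> hle X m h'.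
Proof. by move=> le H p F hF iF; apply: leq_trans le; apply: H hF iF. Qed.

Lemma indep_cat T (X : T -> Prop) a b (F : 'I_a -> T -> k) (G : 'I_b -> T -> k) :
  (forall (c : 'rV_a) (c' : 'rV_b),
     (forall x, X x -> \sum_i c 0 i * F i x + \sum_i c' 0 i * G i x = 0) -> c = 0 /\ c' = 0) ->
  indep X (fun i : 'I_(a + b) => match split i with inl i => F i | inr i => G i end).
Proof.
move=> H c hc; rewrite -[c]hsubmxK.
have [x Xx|-> ->] := H (lsubmx c) (rsubmx c); last by rewrite row_mx0.
rewrite -[RHS](hc x Xx) [RHS]big_split_ord /=; congr (_ + _); apply: eq_bigr => i _.
  by rewrite mxE (unsplitK (inl i)).
by rewrite mxE (unsplitK (inr i)).
Qed.

Lemma indep_cat1 T (X : T -> Prop) b (F : T -> k) (G : 'I_b -> T -> k) :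
  indep X G -> (forall c' : 'rV_b, ~ forall x, X x -> F x = \sum_i c' 0 i * G i x) ->
  indep X (fun i : 'I_(1 + b) => match split i with inl i => F | inr i => G i end).
Proof.
move=> iG nF; apply: (@indep_cat _ _ 1 b (fun=> F) G) => c c' H.
case: (eqVneq (c 0 0) 0) => c0.
  have cE : c = 0 by apply/matrixP => i j; rewrite !ord1 c0 mxE.
  split=> //; apply: iG => x /H; by rewrite big_ord1 c0 mul0r add0r.
case: (nF (- (c 0 0)^-1 *: c')) => x /H; rewrite big_ord1 => /eqP; rewrite addr_eq0 => /eqP e.
apply: (mulfI c0); rewrite e mulr_sumr -sumrN; apply: eq_bigr => i _.
by rewrite mxE mulNr mulNr mulrN mulrA mulrA divff // mul1r.
Qed.

(** There are finitely many monomials of degree at most m. *)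
Lemma hle_exists n (X : 'rV[k]_n -> Prop) m : exists h, hle X m h.
Proof.
pose N := #|{: 'X_{1..n < m.+1}}|; exists N => h F hF.
have [G hG eG] : exists2 G : 'I_h -> {mpoly k[n]}, (forall i, {in msupp (G i), forall u, mdeg u = m}) &
    forall i x, F i x = \sum_(u <- msupp (G i)) (G i)@_u * \prod_i x 0 i ^+ u i.
  apply: (@fin_all_exists2 _ _ (fun i G => {in msupp G, forall u, mdeg u = m})
    (fun i G => forall x, F i x = \sum_(u <- msupp G) G@_u * \prod_i x 0 i ^+ u i)) => i.
  by have [G ? ?] := isform_monE (hF i); exists G.
pose A := \matrix_(i < h, j < N) (G i)@_(@enum_val _ {: 'X_{1..n < m.+1}} j : 'X_{1..n}).
apply: (@indep_span _ X h N F (fun j x => \prod_i x 0 i ^+ (@enum_val _ {: 'X_{1..n < m.+1}} j : 'X_{1..n}) i) A).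
move=> i x Xx; have <- : (G i).@[x 0] = F i x by rewrite mevalE eG.
have hs : (msize (G i) <= m.+1)%N.
  by rewrite msizeE big_seq; apply: (big_ind (fun v => v <= m.+1)%N) => // [a b ha hb|u /hG ->]; rewrite // geq_max ha.
rewrite {1}(mpolywE hs) raddf_sum /= (reindex (@enum_val _ {: 'X_{1..n < m.+1}})) /=.
  by apply: eq_bigr => j _; rewrite mevalZ mevalX mxE.
by apply/onW_bij/enum_val_bij.
Qed.

Lemma hmax n (X : 'rV[k]_n -> Prop) m : exists h, hge X m h /\ hle X m h.
Proof.
have [N hN] := hle_exists X m; elim: N hN => [|N IH] hN.
  exists 0%N; split=> //; exists (fun _ _ => 0); first by case.
  by move=> c _; apply/matrixP => i [].
case: (classic (hge X m N.+1)) => H; first by exists N.+1.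
apply: IH => h F hF iF; have := hN _ _ hF iF; rewrite leq_eqVlt => /orP [/eqP e|//].
by case: H; rewrite -e; exists F.
Qed.

(** A form that vanishes at the points, but not on X, would extend the maximal family. *)
Lemma maximal_points n (X : 'rV[k]_n -> Prop) m h (F : 'I_h -> 'rV[k]_n -> k) (p : 'I_h -> 'rV[k]_n) :
  (forall i, isform m (F i)) -> indep X F -> hle X m h -> (forall j, X (p j)) ->
  (\matrix_(i, j) F i (p j)) \in unitmx ->
  forall f, isform m f -> (forall j, f (p j) = 0) -> forall x, X x -> f x = 0.
Proof.
move=> hF iF mF Xp pU f hf fp x Xx; apply: NNPP => fx.
have H : indep X (fun i : 'I_(1 + h) => match split i with inl i => f | inr i => F i end).
  apply: indep_cat1 => // c' H; case: fx; rewrite (H x Xx) big1 // => i _.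
  suff -> : c' = 0 by rewrite mxE mul0r.
  apply: (can_inj (mulmxK pU)); rewrite mul0mx; apply/matrixP => a j.
  rewrite !mxE ord1; under eq_bigr => l _ do rewrite mxE.
  by rewrite -H.
have := mF _ _ _ H; rewrite ltnn => H'; suff : false by [].
by apply: H' => i; case: (split _).
Qed.

(** The forms of degree m that vanish on X are cut out by at most h linear conditions, which
    are evaluations at points of X. *)
Lemma determine n (X : 'rV[k]_n -> Prop) m h : hle X m h ->
  exists r (p : 'I_r -> 'rV[k]_n), [/\ (r <= h)%N, forall j, X (p j) &
    forall f, isform m f -> (forall j, f (p j) = 0) -> forall x, X x -> f x = 0].
Proof.
move=> hX; have [r [[F hF iF] mF]] := hmax X m.
have [p Xp pU] := indep_points iF.
by exists r, p; split=> //; [exact: hX hF iF|exact: maximal_points pU].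
Qed.

Lemma isform_dhomog n m (G : dhomog n k m) : isform m (fun x => (mpoly_of_dhomog G).@[x 0]).
Proof. by exists (mpoly_of_dhomog G) => //; exact: (valP G). Qed.

(** A basis of a complement of the space of forms vanishing on X. *)
Lemma hilbert_hge n (X : 'rV[k]_n.+1 -> Prop) m h : hilbert_value X m h -> hge X m h.
Proof.
case=> U hU dU; pose W := (U^C)%VS.
have dW : \dim W = h.
  by have := dimv_disjoint_sum (capv_compl U); rewrite addv_complf -dU => /addnI.
rewrite -dW; exists (fun i x => (mpoly_of_dhomog (vbasis W)`_i).@[x 0]).
  by move=> i; exact: isform_dhomog.
move=> c hc; pose w := \sum_i c 0 i *: (vbasis W)`_i.
have wW : w \in W.
  by apply: memv_suml => i _; apply/memvZ/vbasis_mem/mem_nth; rewrite size_tuple.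
have wU : w \in U.
  apply/hU => x Xx; rewrite -(hc x Xx) /w !raddf_sum /=.
  by apply: eq_bigr => i _; rewrite mevalZ.
have : w = 0 by apply/eqP; rewrite -memv0 -(capv_compl U) memv_cap wU.
have /andP[_ /freeP fW] := vbasisP W.
move=> /(fW _) c0; apply/matrixP => a j; by rewrite ord1 mxE c0.
Qed.

Lemma hilbert_hle n (X : 'rV[k]_n.+1 -> Prop) m h : hilbert_value X m h -> hle X m h.
Proof.
case=> U hU dU h' F hF iF.
have [D eD] : exists D : 'I_h' -> dhomog n.+1 k m, forall i x, F i x = (mpoly_of_dhomog (D i)).@[x 0].
  apply: (fin_all_exists (P := fun i (D : dhomog n.+1 k m) => forall x, F i x = (mpoly_of_dhomog D).@[x 0])) => i.
  by have [G hG eG] := hF i; exists (DHomog hG).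
pose t := [tuple D i | i < h'].
have tE (c : 'rV[k]_h') (x : 'rV[k]_n.+1) : (mpoly_of_dhomog (\sum_i c 0 i *: t`_i)).@[x 0] = \sum_i c 0 i * F i x.
  rewrite !raddf_sum /=; apply: eq_bigr => i _; rewrite mevalZ eD.
  by rewrite (_ : t`_i = D i) // -tnth_nth tnth_mktuple.
have ft : free t.
  apply/freeP => c hc i; have : \row_i c i = 0.
    apply: iF => x _; rewrite -tE (_ : \sum_i _ = 0) ?raddf0 ?meval0 //.
    by rewrite -[RHS]hc; apply: eq_bigr => j _; rewrite mxE.
  by move/rowP/(_ i); rewrite !mxE.
have cap0 : (<<t>> :&: U = 0)%VS.
  apply/eqP; rewrite -subv0; apply/subvP => w; rewrite memv_cap => /andP [wt wU].
  have : \row_i coord t i w = 0.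
    apply: iF => x Xx; rewrite -tE.
    have -> : \sum_i (\row_i coord t i w) 0 i *: t`_i = w.
      by rewrite [RHS](coord_span wt); apply: eq_bigr => j _; rewrite mxE.
    by have /hU := wU; apply.
  move/rowP => c0; rewrite (coord_span wt) memv0; apply/eqP; apply: big1 => i _.
  by have := c0 i; rewrite !mxE => ->; rewrite scale0r.
have := dimv_disjoint_sum cap0; move/eqP: ft => ->; rewrite size_tuple => e.
by rewrite -(leq_add2r (\dim U)) -e addnC dU dimvS // subvf.
Qed.

(** At suitable points of X the matrix of values of a maximal independent family is
    invertible. So the evaluation of forms at these points is surjective, and its kernel
    consists of the forms vanishing on X. *)
Lemma hilbert_intro n (X : 'rV[k]_n.+1 -> Prop) m h : hge X m h -> hle X m h -> hilbert_value X m h.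
Proof.
move=> [F hF iF] mF; have [p Xp pU] := indep_points iF.
set A := \matrix_(_, _) _ in pU.
pose ev (G : dhomog n.+1 k m) : 'rV[k]_h := \row_j (mpoly_of_dhomog G).@[(p j) 0].
have ev_lin : linear ev.
  by move=> a G H; apply/rowP => j; rewrite !mxE /= mevalD mevalZ.
pose evH := GRing.isLinear.Build _ _ _ _ ev ev_lin.
pose evL : {linear dhomog n.+1 k m -> 'rV[k]_h} := HB.pack ev evH.
exists (lker (linfun evL)) => [G|].
  rewrite memv_ker lfunE /=; split=> [/eqP/rowP e x Xx|H].
    apply: (maximal_points hF iF mF Xp pU (f := fun x => (mpoly_of_dhomog G).@[x 0])) => //.
      exact: isform_dhomog.
    by move=> j; have := e j; rewrite !mxE.
  by apply/eqP/rowP => j; rewrite !mxE; apply: H.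
rewrite -(limg_ker_dim (linfun evL) fullv) capfv; congr (_ + _)%N.
suff -> : limg (linfun evL) = fullv by rewrite dimvf /dim /= mul1n.
apply/eqP; rewrite eqEsubv subvf; apply/subvP => w _.
have [D eD] : exists D : 'I_h -> dhomog n.+1 k m, forall i x, F i x = (mpoly_of_dhomog (D i)).@[x 0].
  apply: (fin_all_exists (P := fun i (D : dhomog n.+1 k m) => forall x, F i x = (mpoly_of_dhomog D).@[x 0])) => i.
  by have [G hG eG] := hF i; exists (DHomog hG).
suff -> : w = linfun evL (\sum_i (w *m invmx A) 0 i *: D i) by apply: memv_img; rewrite memvf.
rewrite lfunE /= -[LHS](mulmxKV pU); apply/rowP => j; rewrite !mxE !raddf_sum /=.
by apply: eq_bigr => i _; rewrite mevalZ -eD; congr (_ * _); rewrite [LHS]mxE || rewrite [RHS]mxE.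
Qed.
End Indep.

(** * Projection of a connected set from its points *)

Section Projection.
Variable k : fieldType.

(** Monomials are indexed by words, which inductions on the degree read letter by letter. *)
Definition word_mon r a (t : a.-tuple 'I_r) (y : 'rV[k]_r) : k := \prod_(i <- t) y 0 i.

Lemma isform_word r a (t : a.-tuple 'I_r) : isform a (word_mon t).
Proof.
have e : (\sum_(i <- t) 1 = a)%N by rewrite sum1_size size_tuple.
rewrite -[a in isform a]e.
by apply: (@isform_prod _ _ _ _ _ (fun=> 1%N) (fun i y => y 0 i)) => i _; apply: isform_coord.
Qed.

Lemma word_split r a b (f : 'rV[k]_r -> k) : isform (a + b) f ->
  exists2 g : a.-tuple 'I_r -> 'rV[k]_r -> k, (forall t, isform b (g t)) &
    forall y, f y = \sum_t g t y * word_mon t y.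
Proof.
elim: a f => [|a IH] f hf.
  exists (fun=> f) => [//|y].
  rewrite (big_pred1 [tuple]) => [|t]; last by apply/esym/eqP; apply: tuple0.
  by rewrite /word_mon /= big_nil mulr1.
have [g hg eg] := isform_split hf.
have [G hG eG] : exists2 G : 'I_r -> a.-tuple 'I_r -> 'rV[k]_r -> k,
    (forall i t, isform b (G i t)) & forall i y, g i y = \sum_t G i t y * word_mon t y.
  apply: (@fin_all_exists2 _ _ (fun i (G : a.-tuple 'I_r -> 'rV[k]_r -> k) => forall t, isform b (G t))
   (fun i G => forall y, g i y = \sum_t G t y * word_mon t y)) => i.
  by have [G ? ?] := IH _ (hg i); exists G.
exists (fun t => G (thead t) [tuple of behead t]) => [t|y]; first exact: hG.
pose K (t : a.+1.-tuple 'I_r) := G (thead t) [tuple of behead t] y * word_mon t y.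
have KE i (t : a.-tuple 'I_r) : K [tuple of i :: t] = G i t y * (y 0 i * word_mon t y).
  by rewrite /K /word_mon /= big_cons theadE; congr (G i _ y * _); apply: val_inj.
rewrite eg -[RHS]/(\sum_t K t) (reindex (fun p : 'I_r * a.-tuple 'I_r => [tuple of p.1 :: p.2])).
  rewrite -(pair_bigA _ (fun (i : 'I_r) (t : a.-tuple 'I_r) => K [tuple of i :: t])) /=.
  apply: eq_bigr => i _; rewrite eG mulr_sumr; apply: eq_bigr => t _.
  by rewrite KE mulrCA.
exists (fun t => (thead t, [tuple of behead t])) => [[i t] _|t _].
  by rewrite /= theadE; congr pair; apply/val_inj.
by rewrite [RHS]tuple_eta; apply/val_inj.
Qed.

Section Drop.
Variables (r m : nat).

Let ell (x : 'rV[k]_(1 + r)) : k := x 0 (lshift r ord0).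
Let e0 : 'rV[k]_(1 + r) := row_mx 1%:M 0.

(** The centre of projection is (1, 0, ..., 0), the coordinate that is nonzero there is the
    first one, and [rsubmx] is the projection. Grade the forms of degree m by their order a
    along the centre: [higher a] are combinations of the words of length a in the projected
    coordinates whose coefficients, of degree m - a, vanish at the centre, so that the order
    is more than a. *)
Definition higher a (N : 'rV[k]_(1 + r) -> k) : Prop :=
  exists2 n : a.-tuple 'I_r -> 'rV[k]_(1 + r) -> k,
    (forall t, isform (m - a) (n t) /\ n t (row_mx 1%:M 0) = 0) &
    forall x, N x = \sum_t n t x * word_mon t (rsubmx x).

(** A form of order b > a along the centre is of order higher than a. *)
Lemma higher_form a b (H : 'rV[k]_r -> k) : (a < b)%N -> (b <= m)%N -> isform b H ->
  higher a (fun x => x 0 (lshift r ord0) ^+ (m - b) * H (rsubmx x)).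
Proof.
move=> ab bm hH; have eb : b = (a + (b - a).-1.+1)%N by lia.
rewrite eb in hH; have [g hg eg] := word_split hH.
exists (fun t x => ell x ^+ (m - b) * g t (rsubmx x)) => [t|x]; last first.
  by rewrite eg mulr_sumr; apply: eq_bigr => t _; rewrite mulrA.
split; last by rewrite row_mxKr (isform_at0 (hg t)) mulr0.
have -> : (m - a = 1 * (m - b) + (b - a).-1.+1)%N by lia.
apply: isformM; first exact/isformX/isform_coord.
apply: isform_ext (isform_comp (col_mx 0 1%:M) (hg t)) => x /=.
by rewrite -{1}[x]hsubmxK mul_row_col mulmx0 add0r mulmx1.
Qed.

Lemma higher0 a : higher a (fun=> 0).
Proof.
exists (fun _ _ => 0) => [t|x]; first by split=> //; exact: isform0.
by rewrite big1 // => t _; rewrite mul0r.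
Qed.

Lemma higherD a N N' : higher a N -> higher a N' -> higher a (fun x => N x + N' x).
Proof.
case=> n hn en [n' hn' en']; exists (fun t x => n t x + n' t x) => [t|x].
  have [h1 h2] := hn t; have [h1' h2'] := hn' t.
  by split; [apply: (isformD h1 h1')|rewrite h2 h2' addr0].
by rewrite en en' -big_split; apply: eq_bigr => t _; rewrite mulrDl.
Qed.

Lemma higherZ a c N : higher a N -> higher a (fun x => c * N x).
Proof.
case=> n hn en; exists (fun t x => c * n t x) => [t|x].
  by have [h1 h2] := hn t; split; [apply: (isformZ c h1)|rewrite h2 mulr0].
by rewrite en mulr_sumr; apply: eq_bigr => t _; rewrite mulrA.
Qed.

Lemma higher_ext a N N' : N =1 N' -> higher a N -> higher a N'.
Proof. by move=> e [n hn en]; exists n => // x; rewrite -e. Qed.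

Lemma higher_sum a I (s : seq I) (P : pred I) (c : I -> k) (N : I -> 'rV[k]_(1 + r) -> k) :
  (forall i, P i -> higher a (N i)) -> higher a (fun x => \sum_(i <- s | P i) c i * N i x).
Proof.
move=> hN; elim: s => [|i s IH].
  by apply: higher_ext (higher0 a) => x; rewrite big_nil.
case Pi: (P i).
  by apply: higher_ext (higherD (higherZ (c i) (hN i Pi)) IH) => x; rewrite big_cons Pi.
by apply: higher_ext IH => x; rewrite big_cons Pi.
Qed.

Variable X : 'rV[k]_(1 + r) -> Prop.
Hypothesis adherent : forall e f, isform e f ->
  (forall x, X x -> rsubmx x != 0 -> f x = 0) -> f (row_mx 1%:M 0) = 0.

(** Not all the words of length a, multiplied by a power of the first coordinate, can agree
    on X with a form of higher order. Otherwise, with x_0 the first coordinate, a matrix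
    x_0^(m-a) - N would annihilate the vector of words, which is nonzero off the centre. Its
    determinant would vanish on X off the centre, thus also at the centre by adherence; but
    it is 1 there, as N vanishes at the centre. *)
Lemma strict_filtration a : (a < m)%N -> exists t : a.-tuple 'I_r, forall N, higher a N ->
  ~ forall x, X x -> x 0 (lshift r ord0) ^+ (m - a) * word_mon t (rsubmx x) = N x.
Proof.
move=> am; apply: NNPP => nE.
have [n hn en] : exists2 n : a.-tuple 'I_r -> a.-tuple 'I_r -> 'rV[k]_(1 + r) -> k,
   (forall s t, isform (m - a) (n s t) /\ n s t (row_mx 1%:M 0) = 0) &
   forall s x, X x -> ell x ^+ (m - a) * word_mon s (rsubmx x) =
     \sum_t n s t x * word_mon t (rsubmx x).
  apply: (@fin_all_exists2 _ _
    (fun s (n : a.-tuple 'I_r -> 'rV[k]_(1 + r) -> k) =>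
       forall t, isform (m - a) (n t) /\ n t (row_mx 1%:M 0) = 0)
    (fun s n => forall x, X x -> ell x ^+ (m - a) * word_mon s (rsubmx x) =
     \sum_t n t x * word_mon t (rsubmx x))) => s.
  apply: NNPP => nEs; apply: nE; exists s => N [n hn eN] H.
  by apply: nEs; exists n => // x Xx; rewrite H // eN.
pose A (i j : 'I_#|{: a.-tuple 'I_r}|) x :=
  (i == j)%:R * ell x ^+ (m - a) - n (enum_val j) (enum_val i) x.
have hA i j : isform (m - a) (A i j).
  apply: isformB; last by case: (hn (enum_val j) (enum_val i)).
  by apply: isformZ; exact: (isform_eq (mul1n _) (isformX (m - a) (isform_coord k (lshift r ord0)))).
have e01 : ell (row_mx 1%:M 0) = 1 by rewrite /ell row_mxEl mxE.
suff /(adherent (isform_det hA)) : forall x, X x -> rsubmx x != 0 -> \det (\matrix_(i, j) A i j x) = 0.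
  have -> : \matrix_(i, j) A i j (row_mx 1%:M 0) = 1%:M.
    apply/matrixP => i j; rewrite !mxE /A e01 expr1n mulr1.
    by case: (hn (enum_val j) (enum_val i)) => _ ->; rewrite subr0.
  by rewrite det1 => /eqP; rewrite oner_eq0.
move=> x Xx /rV0Pn [i yi].
apply/eqP/det0P; exists (\row_s word_mon (enum_val s) (rsubmx x)).
  apply/rV0Pn; exists (enum_rank [tuple of nseq a i]).
  rewrite mxE enum_rankK /word_mon prodf_seq_neq0; apply/allP => l /nseqP[-> _]; exact: yi.
apply/rowP => j; rewrite !mxE.
under eq_bigr => s _ do rewrite !mxE /A mulrBr.
rewrite sumrB (bigD1 j) //= big1 => [|s /negbTE ->]; last by rewrite mul0r mulr0.
rewrite addr0 eqxx mul1r mulrC (en (enum_val j)) // (reindex (@enum_val _ {: a.-tuple 'I_r})) /=.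
  by apply/eqP; rewrite subr_eq0; apply/eqP; apply: eq_bigr => s _; rewrite mulrC.
by apply/onW_bij/enum_val_bij.
Qed.

(** For each order a < m there is a form of this order that is new on X by
    [strict_filtration]; these m forms are independent of each other and of the forms of
    order m, which come from the projection. *)
Lemma hge_drop h : hge (fun y => exists2 x, X x & y = rsubmx x) m h -> hge X m (m + h).
Proof.
case=> G hG iG.
have [t ht] : exists t : forall a : 'I_m, a.-tuple 'I_r, forall (a : 'I_m) N, higher a N ->
  ~ forall x, X x -> x 0 (lshift r ord0) ^+ (m - a) * word_mon (t a) (rsubmx x) = N x.
  apply: (@fin_all_exists _ _ (fun (a : 'I_m) (t : a.-tuple 'I_r) => forall N, higher a N ->
  ~ forall x, X x -> x 0 (lshift r ord0) ^+ (m - a) * word_mon t (rsubmx x) = N x)) => a; exact: strict_filtration.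
pose E (a : 'I_m) (x : 'rV[k]_(1 + r)) := x 0 (lshift r ord0) ^+ (m - a) * word_mon (t a) (rsubmx x).
have hR f : isform m f -> isform m (fun x : 'rV_(1 + r) => f (rsubmx x)).
  move=> hf; apply: isform_ext (isform_comp (col_mx 0 1%:M) hf) => x /=.
  by rewrite -{1}[x]hsubmxK mul_row_col mulmx0 add0r mulmx1.
exists (fun i => match split i with inl a => E a | inr i => fun x => G i (rsubmx x) end).
  move=> i; case: (split i) => a; last exact: hR.
  have am : (1 * (m - a) + a = m)%N by rewrite mul1n subnK // ltnW.
  apply: (isform_eq am); apply: isformM; first exact/isformX/isform_coord.
  apply: isform_ext (isform_comp (col_mx 0 1%:M) (isform_word (t a))) => x /=.
  by rewrite -{1}[x]hsubmxK mul_row_col mulmx0 add0r mulmx1.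
apply: (@indep_cat _ _ _ _ _ E (fun i x => G i (rsubmx x))) => c c' H.
have c0 : c = 0.
  apply/eqP; apply: contraT => /rV0Pn [a0 ca0].
  (* Take a minimal with c_a nonzero: the relation then writes the word of order a, times a
     power of the first coordinate, as a form of higher order. *)
  case: (@arg_minnP _ a0 (fun a => c 0 a != 0) (fun a : 'I_m => a : nat) ca0) => a ca amin.
  exfalso; apply: (ht a (fun x => - (c 0 a)^-1 * ((\sum_(b < m | (a < b)%N) c 0 b * E b x)
      + \sum_i c' 0 i * G i (rsubmx x)))).
    apply/higherZ/higherD; apply: higher_sum => b ab.
      by apply: higher_form ab (ltnW (ltn_ord b)) (isform_word _).
    apply: higher_ext (higher_form (ltn_ord a) (leqnn m) (hG b)) => x.
    by rewrite subnn expr0 mul1r.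
  move=> x Xx; have := H x Xx; rewrite (bigID (fun b : 'I_m => (a < b)%N)) /=.
  rewrite [X in _ + X + _](bigD1 a) ?ltnn //= [X in _ + (_ + X) + _]big1; last first.
    move=> b /andP [nab ba]; suff /eqP -> : c 0 b == 0 by rewrite mul0r.
    apply: contraNT nab => /amin; rewrite leq_eqVlt => /orP [/eqP e|//].
    by move: ba; rewrite (ord_inj e) eqxx.
  rewrite addr0 addrAC => /eqP; rewrite addrC addr_eq0 => /eqP e.
  by apply: (mulfI ca); rewrite [LHS]e mulrA mulrN divff // mulN1r.
split=> //; apply: iG => y [x Xx ->]; rewrite -[RHS](H x Xx) c0 [X in _ = X + _]big1 ?add0r // => i _.
by rewrite mxE mul0r.
Qed.
End Drop.

Lemma hge_sub n (X Y : 'rV[k]_n -> Prop) m h : (forall x, X x -> Y x) -> hge X m h -> hge Y m h.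
Proof. by move=> sXY [F hF iF]; exists F => //; apply: indep_sub iF. Qed.

Lemma zclosed_ker n r (M : 'M[k]_(n, r)) : zclosed (fun x => x != 0 /\ x *m M = 0).
Proof.
apply/zclosedP; split=> [x []//|x x0 H]; split=> //; apply/rowP => j.
have colE (y : 'rV_n) : (y *m M) 0 j = (y *m col j M) 0 0.
  by rewrite !mxE; apply: eq_bigr => i _; rewrite !mxE.
rewrite colE (H _ _ (isform_lin (col j M))) ?mxE // => y [_ yM].
by rewrite -colE yM mxE.
Qed.

(** Otherwise C would be the disjoint union of its part in the centre of projection and the
    closure of the other part. *)
Lemma connected_adherent n r (C : 'rV[k]_n -> Prop) (M : 'M[k]_(n, r)) x1 x2 :
  connected C -> zclosed C -> C x1 -> x1 *m M = 0 -> C x2 -> x2 *m M != 0 ->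
  exists R, [/\ C R, R *m M = 0 & forall e f, isform e f ->
    (forall x, C x -> x *m M != 0 -> f x = 0) -> f R = 0].
Proof.
move=> [_ cC] zC Cx1 x1M Cx2 x2M; apply: NNPP => nE.
pose A x := C x /\ (x != 0 /\ x *m M = 0).
pose B x := C x /\ zclosure (fun x => C x /\ x *m M != 0) x.
have zA : zclosed A by apply: zclosed_and zC (zclosed_ker M).
have zB : zclosed B by apply: zclosed_and zC (@zclosure_closed _ _ _).
case: (cC A B zA zB) => [x|x [[Cx [x0 xM]] [_ [_ xB]]]|H|H].
- split=> [Cx|[[]|[]]//]; have x0 := zclosed_neq0 zC Cx.
  case: (eqVneq (x *m M) 0) => xM; first by left.
  by right; split=> //; apply: sub_zclosure.
- by apply: nE; exists x; split=> // e f hf fC; apply: xB hf _ => y [Cy yM]; apply: fC.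
- by apply: (H x1); split=> //; split=> //; apply: zclosed_neq0 Cx1.
- by apply: (H x2); split=> //; apply: sub_zclosure => //; apply: zclosed_neq0 Cx2.
Qed.

(** By induction on the number j of points that span the centre. Some point R of C in the
    centre is adherent to the rest of C. Exchange a point of the basis of the centre for R,
    project first from the other points and then from the image of R, which costs m by
    [hge_drop]. *)
Lemma hge_project n (C : 'rV[k]_n -> Prop) m j r (B : 'M[k]_(j, n)) (M : 'M[k]_(n, r)) h :
  connected C -> zclosed C -> row_free B -> (forall i, C (row i B)) -> B *m M = 0 ->
  (j + \rank M)%N = n -> (exists2 x, C x & x *m M != 0) ->
  hge (fun y => exists2 x, C x & y = x *m M) m h -> hge C m (j * m + h).
Proof.
move=> cC zC; elim: j r B M h => [|j IH] r B M h fB CB BM rM [x2 Cx2 x2M] hM.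
  case: hM => F hF iF; exists (fun i x => F i (x *m M)) => [i|c hc]; first exact: isform_comp.
  by apply: iF => y [x Cx ->]; apply: hc.
have B0M : row ord0 B *m M = 0 by rewrite -row_mul BM row0.
have [R [CR RM adh]] := connected_adherent cC zC (CB ord0) B0M Cx2 x2M.
have R0 := zclosed_neq0 zC CR.
have /submxP [c Rc] : (R <= B)%MS.
  have BK : (B <= kermx M)%MS by apply/sub_kermxP.
  have : (kermx M <= B)%MS.
    by rewrite -(geq_leqif (mxrank_leqif_sup BK)) mxrank_ker (eqP fB) -{1}rM addnK.
  by apply: submx_trans; apply/sub_kermxP.
have [i ci] : exists i, c 0 i != 0.
  by apply/rV0Pn; apply: contraNneq R0 => c0; rewrite Rc c0 mul0mx.
pose D : 'M[k]_(j, j.+1) := row' i 1%:M.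
have DB : row' i B = D *m B.
  by apply/matrixP => a b; rewrite mxE -[B in LHS]mul1mx !mxE; apply: eq_bigr => l _; rewrite !mxE.
have fRB : row_free (col_mx R (row' i B)).
  rewrite -kermx_eq0; apply/rowV0P => v /sub_kermxP; rewrite -[v]hsubmxK mul_row_col.
  move: (lsubmx v) (rsubmx v) => a b.
  rewrite DB Rc !mulmxA -mulmxDl => /eqP; rewrite mulmx_free_eq0 // => /eqP e.
  have a0 : a = 0.
    move/matrixP/(_ 0 i): (e); rewrite !mxE big_ord1 [X in _ + X]big1 => [|l _].
      rewrite addr0 => /eqP; rewrite mulf_eq0 (negbTE ci) orbF => /eqP a0.
      by apply/matrixP => u v'; rewrite !ord1 a0 mxE.
    by rewrite !mxE eq_sym (negbTE (neq_lift _ _)) mulr0.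
  move: e; rewrite a0 mul0mx add0r => /rowP e.
  suff -> : b = 0 by rewrite row_mx0.
  apply/rowP => l; have := e (lift i l); rewrite !mxE (bigD1 l) //= big1 => [|l' /negbTE nl].
    by rewrite !mxE eqxx mulr1 addr0.
  by rewrite !mxE (inj_eq lift_inj) nl mulr0.
have /row_freeP [Y] := fRB.
rewrite mul_col_mx -[Y]hsubmxK !mul_mx_row scalar_mx_block /block_mx => /eq_col_mx [].
move=> /eq_row_mx [Rl _] /eq_row_mx [Bl _].
move: (lsubmx Y) Rl Bl => l Rl Bl.
pose M' := row_mx l M.
have BM' : row' i B *m M = 0 by rewrite DB -mulmxA BM mulmx0.
have -> : (j.+1 * m + h = j * m + (m + h))%N by rewrite mulSn addnAC addnA addnC addnA.
apply: (IH _ (row' i B) M').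
- move: fRB; rewrite /row_free -addsmxE => /eqP rRB.
  rewrite eqn_leq rank_leq_row /=.
  have := mxrank_adds_leqif R (row' i B) => - [le _]; rewrite rRB in le.
  by rewrite -ltnS; apply: leq_trans le _; rewrite -[leqRHS]add1n leq_add2r rank_leq_row.
- by move=> a; rewrite (_ : row a _ = row (lift i a) B) //; apply/rowP => b; rewrite !mxE.
- by rewrite mul_mx_row Bl BM' row_mx0.
- have le1 : (\rank (row' i B) + \rank M' <= n)%N.
    by apply: mulmx0_rank_max; rewrite mul_mx_row Bl BM' row_mx0.
  have rB' : \rank (row' i B) = j.
    move: fRB; rewrite /row_free -addsmxE => /eqP rRB.
    have := mxrank_adds_leqif R (row' i B) => - [le _]; rewrite rRB in le.
    apply/eqP; rewrite eqn_leq rank_leq_row -ltnS.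
    by apply: leq_trans le _; rewrite -[leqRHS]add1n leq_add2r rank_leq_row.
  have : (kermx M' < kermx M)%MS.
    rewrite ltmxE; apply/andP; split.
      apply/sub_kermxP; have := mulmx_ker M'; rewrite mul_mx_row -row_mx0.
      by move=> /eq_row_mx [].
    apply/negP => /(submx_trans (introT sub_kermxP RM)) /sub_kermxP.
    rewrite mul_mx_row -row_mx0 => /eq_row_mx [R1 _]; move: Rl; rewrite R1.
    by move/matrixP/(_ 0 0); rewrite !mxE => /eqP; rewrite eq_sym oner_eq0.
  move/rank_ltmx; rewrite !mxrank_ker rB' in le1 *.
  move: (\rank M') (\rank M) le1 rM => u v; lia.
- exists x2 => //; rewrite mul_mx_row; apply: contraNneq x2M.
  by rewrite -row_mx0 => /eq_row_mx [_ ->].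
apply: (@hge_drop r m).
  move=> e f hf fX; have := adh e (fun x => f (x *m M')) (isform_comp _ hf).
  rewrite mul_mx_row Rl RM; apply=> x Cx xM; apply: fX; first by exists x.
  by rewrite mul_mx_row row_mxKr.
apply: hge_sub hM => y [x Cx ->]; exists (x *m M'); first by exists x.
by rewrite mul_mx_row row_mxKr.
Qed.

End Projection.

(** * Graded ideals of bounded codimension *)

Lemma nat_max (P : nat -> Prop) b : (exists n, P n) -> (forall n, P n -> (n <= b)%N) ->
  exists2 n, P n & forall n', P n' -> (n' <= n)%N.
Proof.
elim: b => [|b IH] ex bd.
  by case: ex => n Pn; exists n => // n' /bd; rewrite leqn0 => /eqP ->.
case: (classic (P b.+1)) => Pb; first by exists b.+1.
apply: IH => // n Pn; have := bd n Pn; rewrite leq_eqVlt => /orP [/eqP e|//].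
by rewrite e in Pn.
Qed.

Section ClosedField.
Variable k : closedFieldType.

(** A root of prod (X - a) + 1 is none of the a. *)
Lemma avoid_seq (s : seq k) : exists a, a \notin s.
Proof.
case: s => [|b s]; first by exists 0.
set t := b :: s; pose p : {poly k} := \prod_(a <- t) ('X - a%:P) + 1.
have sp : size p != 1%N.
  rewrite /p size_polyDl size_prod_XsubC // size_poly1 //.
have /closed_rootP [x] := sp; rewrite rootE /p hornerD hornerC horner_prod => px.
exists x; apply/negP => /= xt; move: px.
rewrite (big_rem x xt) /= !hornerE subrr mul0r add0r; exact/negP/oner_neq0.
Qed.

(** Add to a form for the old points a multiple of one that is nonzero at the new point,
    avoiding finitely many factors. *)
Lemma avoid_zeros n (xs : seq 'rV[k]_n) : (forall x, x \in xs -> x != 0) ->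
  exists l : 'cV[k]_n, forall x, x \in xs -> (x *m l) 0 0 != 0.
Proof.
elim: xs => [|x xs IH] x0; first by exists 0.
have [|l hl] := IH; first by move=> y ys; apply: x0; rewrite inE ys orbT.
have /rV0Pn [i xi] := x0 x (mem_head _ _).
pose l' : 'cV[k]_n := delta_mx i 0.
have xl' : (x *m l') 0 0 != 0 by rewrite -colE mxE.
have [a ha] := avoid_seq [seq - (y *m l) 0 0 / (y *m l') 0 0 | y <- x :: xs].
exists (l + a *: l') => y ys; rewrite mulmxDr -scalemxAr [X in X != 0]mxE [X in _ + X]mxE.
apply: contra ha; rewrite addr_eq0 => /eqP e.
have yl' : (y *m l') 0 0 != 0.
  move: ys; rewrite inE => /orP [/eqP -> //|ys]; apply: contraNneq (hl y ys) => e0.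
  by rewrite e e0 mulr0 oppr0.
by apply/mapP; exists y => //; rewrite e opprK mulfK.
Qed.

(** Each matrix has an eigenvector in the current space, and its eigenspace is stable under
    the matrices that commute with it. *)
Lemma common_eigenvector_in n (I : finType) (X : I -> 'M[k]_n) (s : seq I) (V : 'M[k]_n) :
  (forall i j, X i *m X j = X j *m X i) -> V != 0 -> (forall i, (V *m X i <= V)%MS) ->
  exists v : 'rV[k]_n, [/\ v != 0, (v <= V)%MS & forall i, i \in s -> exists a, v *m X i = a *: v].
Proof.
move=> cX; elim: s V => [|j s IH] V V0 sV.
  by have /rowV0Pn [v vV v0] := V0; exists v.
have /submxP [A eA] : (row_base V *m X j <= row_base V)%MS.
  by rewrite eq_row_base; apply: submx_trans (sV j); apply: submxMr; rewrite eq_row_base.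
have rV : (0 < \rank V)%N by rewrite lt0n mxrank_eq0.
have /closed_rootP [a ra] : size (char_poly A) != 1%N.
  by rewrite size_char_poly eqSS -lt0n.
move: ra; rewrite -eigenvalue_root_char => /eigenvalueP [u uA u0].
pose W := (V :&: eigenspace (X j) a)%MS.
have [|i|v [v0 vW hv]] := IH W.
- apply/rowV0Pn; exists (u *m row_base V); last by rewrite mulmx_free_eq0 // row_base_free.
  rewrite sub_capmx; apply/andP; split; first by rewrite mulmx_sub // eq_row_base.
  by apply/eigenspaceP; rewrite -mulmxA eA mulmxA uA -scalemxAl.
- rewrite sub_capmx; apply/andP; split.
    by apply: submx_trans (sV i); apply: submxMr; apply: capmxSl.
  apply/eigenspaceP; rewrite -mulmxA cX mulmxA.
  have /eigenspaceP -> : (W <= eigenspace (X j) a)%MS by apply: capmxSr.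
  by rewrite -scalemxAl.
exists v; split=> //; first by apply: submx_trans vW _; apply: capmxSl.
move=> i; rewrite inE => /orP [/eqP ->|/hv//]; exists a.
by apply/eigenspaceP; apply: submx_trans vW _; apply: capmxSr.
Qed.

Section BoundedIdeal.
Variables (n : nat) (Q : nat -> ('rV[k]_n -> k) -> Prop) (m1 D : nat).
Implicit Types f g : 'rV[k]_n -> k.
Hypothesis Qform : forall m f, Q m f -> isform m f.
Hypothesis Qext : forall m f g, f =1 g -> Q m f -> Q m g.
Hypothesis Q0 : forall m, Q m (fun=> 0).
Hypothesis QD : forall m f g, Q m f -> Q m g -> Q m (fun x => f x + g x).
Hypothesis QZ : forall m c f, Q m f -> Q m (fun x => c * f x).
Hypothesis QX : forall m i f, Q m f -> Q m.+1 (fun x => x 0 i * f x).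
Hypothesis Qbound : forall m, (m1 <= m)%N -> forall h (F : 'I_h -> 'rV[k]_n -> k),
  (forall i, isform m (F i)) ->
  (forall c : 'rV_h, Q m (fun x => \sum_i c 0 i * F i x) -> c = 0) -> (h <= D)%N.
Hypothesis Qnozero : forall x, x != 0 -> exists m f, Q m f /\ f x != 0.

Lemma Qsum m (I : Type) (s : seq I) (P : pred I) (f : I -> 'rV[k]_n -> k) :
  (forall i, P i -> Q m (f i)) -> Q m (fun x => \sum_(i <- s | P i) f i x).
Proof.
move=> hf; elim: s => [|i s IH].
  by apply: Qext (Q0 m) => x; rewrite big_nil.
case Pi: (P i).
  by apply: Qext (QD (hf i Pi) IH) => x; rewrite big_cons Pi.
by apply: Qext IH => x; rewrite big_cons Pi.
Qed.

Lemma Qmul e m f g : isform e g -> Q m f -> Q (m + e) (fun x => g x * f x).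
Proof.
elim: e g => [|e IH] g hg Qf.
  by rewrite addn0; apply: Qext (QZ (g 0) Qf) => x; rewrite (isform0_const x 0 hg).
have [G hG eG] := isform_split hg; rewrite addnS.
apply: Qext (@Qsum _ _ (index_enum _) xpredT _ (fun i _ => QX i (IH (G i) (hG i) Qf))) => x.
by rewrite eG mulr_suml; apply: eq_bigr => i _; rewrite mulrA.
Qed.

(** The pigeonhole principle in the exponents of a monomial of large degree. *)
Lemma Q_all_of_powers (e : 'I_n -> nat) : (forall i, Q (e i) (fun x => x 0 i ^+ e i)) ->
  exists N, forall f, isform N f -> Q N f.
Proof.
move=> he; pose E := (\max_i e i)%N; exists (n * E).+1 => f /isform_monE [F hF eF].
apply: (@Qext _ (fun x => \sum_(u <- msupp F | u \in msupp F) F@_u * \prod_i x 0 i ^+ u i)).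
  by move=> x; rewrite eF -big_seq.
apply: Qsum => u /hF du; apply: QZ.
have [i ui] : exists i, (e i <= u i)%N.
  apply/existsP; apply: contraLR (ltnSn (n * E)); rewrite negb_exists => /forallP h.
  rewrite -leqNgt -du mdegE -[n in (n * _)%N]card_ord -sum_nat_const.
  apply: leq_sum => i _; apply: leq_trans (leq_bigmax i).
  by move: (h i); rewrite -ltnNge => /ltnW.
have eN : (e i + (\sum_(j | j != i) 1 * u j + 1 * (u i - e i)) = (n * E).+1)%N.
  have e1 : mdeg u = (u i + \sum_(j | j != i) u j)%N by rewrite mdegE (bigD1 i).
  have e2 : (\sum_(j | j != i) 1 * u j = \sum_(j | j != i) u j)%N.
    by apply: eq_bigr => j _; rewrite mul1n.
  by rewrite e2 mul1n; move: ui e1; rewrite du; lia.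
rewrite -eN; apply: Qext (Qmul (g := fun x => (\prod_(j | j != i) x 0 j ^+ u j) * x 0 i ^+ (u i - e i)) _ (he i)).
  by move=> x; rewrite -mulrA -exprD subnK // mulrC [RHS](bigD1 i).
apply: isformM; last exact/isformX/isform_coord.
by apply: (@isform_prod _ _ _ _ _ (fun j => (1 * u j)%N) (fun j x => x 0 j ^+ u j)) => j _;
   exact/isformX/isform_coord.
Qed.

Section Saturation.
Variable i0 : 'I_n.
Hypothesis i0_nil : forall e, ~ Q e (fun x => x 0 i0 ^+ e).

(** Forms that some power of the coordinate i0 brings into Q. *)
Definition sat m f : Prop := isform m f /\ exists s, Q (m + s) (fun x => x 0 i0 ^+ s * f x).

Lemma sat_ext m f g : f =1 g -> sat m f -> sat m g.
Proof.
move=> e [hf [s hs]]; split; first exact: isform_ext hf.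
by exists s; apply: Qext hs => x; rewrite e.
Qed.

Lemma sat_Q m f : Q m f -> sat m f.
Proof.
move=> Qf; split; first exact: Qform.
by exists 0%N; rewrite addn0; apply: Qext Qf => x; rewrite expr0 mul1r.
Qed.

Lemma isform_pow e : isform e (fun x : 'rV[k]_n => x 0 i0 ^+ e).
Proof. by apply: (isform_eq (mul1n e)); apply/isformX/isform_coord. Qed.

Lemma satD m f g : sat m f -> sat m g -> sat m (fun x => f x + g x).
Proof.
case=> hf [s hs] [hg [s' hs']]; split; first exact: isformD.
exists (s + s')%N.
have h1 := Qmul (isform_pow s') hs; have h2 := Qmul (isform_pow s) hs'.
rewrite -addnA in h1; rewrite -addnA [(s' + s)%N]addnC in h2.
apply: Qext (QD h1 h2) => x.
by rewrite mulrDr !mulrA -!exprD [(s' + s)%N]addnC.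
Qed.

Lemma satZ m c f : sat m f -> sat m (fun x => c * f x).
Proof.
case=> hf [s hs]; split; first exact: isformZ.
by exists s; apply: Qext (QZ c hs) => x; rewrite mulrCA.
Qed.

Lemma sat_mul e m f g : isform e g -> sat m f -> sat (m + e) (fun x => g x * f x).
Proof.
move=> hg [hf [s hs]]; split; first by rewrite addnC; apply: isformM.
exists s; rewrite addnAC; apply: Qext (Qmul hg hs) => x; by rewrite mulrCA.
Qed.

Lemma sat_sum m (I : Type) (s : seq I) (P : pred I) (f : I -> 'rV[k]_n -> k) :
  (forall i, P i -> sat m (f i)) -> sat m (fun x => \sum_(i <- s | P i) f i x).
Proof.
move=> hf; elim: s => [|i s IH].
  by apply: sat_ext (sat_Q (Q0 m)) => x; rewrite big_nil.
case Pi: (P i).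
  by apply: sat_ext (satD (hf i Pi) IH) => x; rewrite big_cons Pi.
by apply: sat_ext IH => x; rewrite big_cons Pi.
Qed.

Lemma sat_cancel e m f : isform m f -> sat (m + e) (fun x => x 0 i0 ^+ e * f x) -> sat m f.
Proof.
move=> hf [_ [s hs]]; split=> //; exists (e + s)%N; rewrite addnA; apply: Qext hs => x.
by rewrite mulrA -exprD [(e + s)%N]addnC.
Qed.

Definition sat_free m h (F : 'I_h -> 'rV[k]_n -> k) : Prop :=
  (forall i, isform m (F i)) /\ forall c : 'rV_h, sat m (fun x => \sum_i c 0 i * F i x) -> c = 0.

(** The codimension of the saturation in degree t is bounded by D. It is nonzero, and where
    it is maximal, multiplication by the coordinate i0 carries a basis to a basis in all
    larger degrees. *)
Lemma sat_basis : exists t h (F : 'I_h -> 'rV[k]_n -> k), [/\ (0 < h)%N, sat_free t F &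
  forall e f, isform (t + e) f -> exists c : 'rV_h,
    sat (t + e) (fun x => f x - \sum_b c 0 b * (x 0 i0 ^+ e * F b x))].
Proof.
pose P h := exists t, (m1 <= t)%N /\ exists F : 'I_h -> 'rV[k]_n -> k, sat_free t F.
have P1 : P 1%N.
  exists m1; split=> //; exists (fun _ x => x 0 i0 ^+ m1); split=> [_|c]; first exact: isform_pow.
  case: (eqVneq (c 0 0) 0) => c0 sc; first by apply/matrixP => a b; rewrite !ord1 c0 mxE.
  have [_ [s hs]] := satZ (c 0 0)^-1 sc; case: (@i0_nil (m1 + s)).
  apply: Qext hs => x; rewrite big_ord1 mulKf // -exprD addnC //.
have [||h Ph hmax] := @nat_max P D; first by exists 1%N.
  move=> h [t [tm [F [hF iF]]]]; apply: (Qbound tm hF) => c Qc; apply: iF; exact: sat_Q.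
have [t [tm [F [hF iF]]]] := Ph; exists t, h, F; split=> //; first exact: hmax P1.
move=> e f hf; apply: NNPP => nE.
suff /hmax : P (1 + h)%N by rewrite add1n ltnn.
exists (t + e)%N; split; first exact: leq_trans tm (leq_addr _ _).
exists (fun i : 'I_(1 + h) => match split i with inl _ => f
    | inr b => fun x => x 0 i0 ^+ e * F b x end); split.
  move=> i; case: (split i) => b //; rewrite addnC; apply: isformM => //; exact: isform_pow.
move=> c; rewrite -[c]hsubmxK; move: (lsubmx c) (rsubmx c) => a b {c}.
have sE x : \sum_(i < 1 + h) (row_mx a b) 0 i * (match split i with inl _ => f
    | inr b => fun x => x 0 i0 ^+ e * F b x end) x =
    a 0 0 * f x + \sum_j b 0 j * (x 0 i0 ^+ e * F j x).
  rewrite big_split_ord big_ord1 /= row_mxEl (unsplitK (inl ord0)); congr (_ + _).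
  by apply: eq_bigr => j _; rewrite row_mxEr (unsplitK (inr j)).
move=> sc; have {}sc := sat_ext sE sc.
case: (eqVneq (a 0 0) 0) => a0; last first.
  case: nE; exists (- (a 0 0)^-1 *: b); apply: sat_ext (satZ (a 0 0)^-1 sc) => x.
  rewrite mulrDr mulKf // -sumrN mulr_sumr; congr (_ + _); apply: eq_bigr => j _.
  by rewrite mxE mulNr mulNr opprK mulrA.
have -> : a = 0 by apply/matrixP => u v; rewrite !ord1 a0 mxE.
suff -> : b = 0 by rewrite row_mx0.
apply: iF; apply: (@sat_cancel e).
  by apply: isform_sum => i _; apply: isformZ.
apply: sat_ext sc => x; rewrite a0 mul0r add0r mulr_sumr.
by apply: eq_bigr => j _; rewrite mulrCA.
Qed.

(** Modulo the saturation, multiplication by the coordinate j followed by division by the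
    coordinate i0 is a matrix Y_j on the basis. These matrices commute and Y_i0 = 1. The
    eigenvalues of a common eigenvector are the coordinates of a zero of Q. *)
Lemma sat_contradiction : False.
Proof.
have [t [h [F [h0 [hF iF] red]]]] := sat_basis.
have uniq e (c : 'rV_h) : sat (t + e) (fun x => \sum_b c 0 b * (x 0 i0 ^+ e * F b x)) -> c = 0.
  move=> sc; apply: iF; apply: (@sat_cancel e).
    by apply: isform_sum => i _; apply: isformZ.
  by apply: sat_ext sc => x; rewrite mulr_sumr; apply: eq_bigr => j _; rewrite mulrCA.
have [X hX] : exists X : 'I_n -> 'I_h -> 'rV[k]_h, forall j a,
    sat (t + 1) (fun x => x 0 j * F a x - \sum_b X j a 0 b * (x 0 i0 ^+ 1 * F b x)).
  apply: (@fin_all_exists _ _ (fun j (X : 'I_h -> 'rV[k]_h) => forall a, sat (t + 1) (fun x => x 0 j * F a x - \sum_b X a 0 b * (x 0 i0 ^+ 1 * F b x)))) => j.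
  apply: (@fin_all_exists _ _ (fun a (X : 'rV[k]_h) => sat (t + 1) (fun x => x 0 j * F a x - \sum_b X 0 b * (x 0 i0 ^+ 1 * F b x)))) => a.
  by apply: red; rewrite addnC; apply: isformM => //; apply: isform_coord.
pose Y j := \matrix_(a < h, b < h) X j a 0 b.
(* The coordinates with respect to the basis are multiplied by Y j when a form is multiplied
   by the coordinate j. *)
have step e (c : 'rV_h) j f : sat (t + e) (fun x => f x - \sum_b c 0 b * (x 0 i0 ^+ e * F b x)) ->
    sat (t + e.+1) (fun x => x 0 j * f x - \sum_b (c *m Y j) 0 b * (x 0 i0 ^+ e.+1 * F b x)).
  move=> sc; have h1 := sat_mul (isform_coord _ j) sc.
  have h2 : sat (t + e.+1) (fun x => \sum_a c 0 a * (x 0 i0 ^+ e * (x 0 j * F a x - \sum_b X j a 0 b * (x 0 i0 ^+ 1 * F b x)))).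
    apply: sat_sum => a _; apply: satZ.
    by have := sat_mul (isform_pow e) (hX j a); rewrite -addnA add1n.
  rewrite -addnA addn1 in h1.
  apply: sat_ext (satD h1 h2) => x.
  rewrite mulrBr -addrA; congr (_ + _).
  have -> : \sum_b (c *m Y j) 0 b * (x 0 i0 ^+ e.+1 * F b x) =
     \sum_a c 0 a * (x 0 i0 ^+ e * \sum_b X j a 0 b * (x 0 i0 ^+ 1 * F b x)).
    under eq_bigr => b _ do rewrite mxE mulr_suml.
    rewrite exchange_big; apply: eq_bigr => a _.
    rewrite !mulr_sumr; apply: eq_bigr => b _; rewrite [Y j a b]mxE expr1 exprSr.
    by rewrite !mulrA; congr (_ * _); rewrite -!mulrA; congr (_ * _); rewrite mulrCA mulrA.
  rewrite mulr_sumr -!sumrN -big_split; apply: eq_bigr => a _ /=; ring.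
have uniq2 e (c c' : 'rV_h) f : sat (t + e) (fun x => f x - \sum_b c 0 b * (x 0 i0 ^+ e * F b x)) ->
    sat (t + e) (fun x => f x - \sum_b c' 0 b * (x 0 i0 ^+ e * F b x)) -> c = c'.
  move=> s1 s2; apply/eqP; rewrite -subr_eq0; apply/eqP; apply: (uniq e).
  apply: sat_ext (satD s2 (satZ (-1) s1)) => x.
  have -> : \sum_b (c - c') 0 b * (x 0 i0 ^+ e * F b x) =
     \sum_b c 0 b * (x 0 i0 ^+ e * F b x) - \sum_b c' 0 b * (x 0 i0 ^+ e * F b x).
    by rewrite -sumrB; apply: eq_bigr => b _; rewrite !mxE mulrBl.
  by ring.
have base a : sat (t + 0) (fun x => F a x - \sum_b (delta_mx 0 a : 'rV_h) 0 b * (x 0 i0 ^+ 0 * F b x)).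
  apply: sat_ext (sat_Q (Q0 _)) => x; rewrite (bigD1 a) //= big1 => [|b /negbTE nb].
    by rewrite mxE !eqxx expr0 !mul1r addr0 subrr.
  by rewrite mxE nb andbF mul0r.
have cY i j : Y i *m Y j = Y j *m Y i.
  apply/row_matrixP => a; rewrite !rowE !mulmxA.
  apply: (uniq2 2%N _ _ (fun x => x 0 j * (x 0 i * F a x))); first exact/step/step/base.
  by apply: sat_ext (step _ _ i _ (step _ _ j _ (base a))) => x; rewrite mulrCA.
have Y0 : Y i0 = 1%:M.
  apply/row_matrixP => a; rewrite !rowE mulmx1.
  apply: (uniq2 1%N _ _ (fun x => x 0 i0 * F a x)); first exact/step/base.
  apply: sat_ext (sat_Q (Q0 _)) => x; rewrite (bigD1 a) //= big1 => [|b /negbTE nb].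
    by rewrite mxE !eqxx expr1 !mul1r addr0 subrr.
  by rewrite mxE nb andbF mul0r.
have cYT i j : (Y i)^T *m (Y j)^T = (Y j)^T *m (Y i)^T by rewrite -!trmx_mul cY.
have [||v [v0 _ hv]] := @common_eigenvector_in h 'I_n (fun j => (Y j)^T) (enum 'I_n) 1%:M cYT.
  by rewrite -mxrank_eq0 mxrank1 -lt0n.
  by move=> i; rewrite submx1.
have [lam hlam] : exists lam : 'I_n -> k, forall j, Y j *m v^T = lam j *: v^T.
  apply: (@fin_all_exists _ _ (fun j a => Y j *m v^T = a *: v^T)) => j.
  have [|a ha] := hv j; first by rewrite mem_enum.
  by exists a; rewrite -[Y j]trmxK -trmx_mul ha linearZ.
pose p : 'rV[k]_n := \row_j lam j.
have val e f a (c : 'rV[k]_h) : isform e f ->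
    sat (t + e) (fun x => f x * F a x - \sum_b c 0 b * (x 0 i0 ^+ e * F b x)) ->
    c *m v^T = f p *: (delta_mx 0 a *m v^T) :> 'M_1.
  elim: e f c => [|e IH] f c hf sc.
    suff -> : c = f p *: delta_mx 0 a by rewrite -scalemxAl.
    apply: (uniq2 0%N _ _ _ sc); apply: sat_ext (satZ (f p) (base a)) => x.
    rewrite mulrBr; congr (_ - _).
      by rewrite (isform0_const x p hf).
    by rewrite mulr_sumr; apply: eq_bigr => b _; rewrite [in RHS]mxE !mulrA.
  have [g hg eg] := isform_split hf.
  have [C hC] : exists C : 'I_n -> 'rV[k]_h, forall j,
      sat (t + e) (fun x => g j x * F a x - \sum_b C j 0 b * (x 0 i0 ^+ e * F b x)).
    apply: (@fin_all_exists _ _ (fun j (C : 'rV[k]_h) => sat (t + e) (fun x => g j x * F a x - \sum_b C 0 b * (x 0 i0 ^+ e * F b x)))) => j.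
    by apply: red; rewrite addnC; apply: isformM.
  have -> : c = \sum_j C j *m Y j.
    apply: (uniq2 e.+1 _ _ _ sc).
    apply: sat_ext (@sat_sum _ _ (index_enum _) xpredT _ (fun j _ => step _ _ j _ (hC j))) => x.
    rewrite sumrB eg mulr_suml; congr (_ - _); first by apply: eq_bigr => j _; rewrite mulrA.
    rewrite exchange_big; apply: eq_bigr => b _; rewrite summxE mulr_suml.
    by apply: eq_bigr.
  rewrite mulmx_suml eg scaler_suml; apply: eq_bigr => j _.
  by rewrite -mulmxA hlam -scalemxAr (IH _ _ (hg j) (hC j)) scalerA mxE.
have p0 : p != 0.
  apply/rV0Pn; exists i0; rewrite mxE; apply: contraNneq v0 => l0.
  by have := hlam i0; rewrite Y0 mul1mx l0 scale0r => /(congr1 trmx); rewrite trmxK trmx0 => ->.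
have [m [f [Qf fp]]] := Qnozero p0.
have /rV0Pn [a va] := v0.
have : (0 : 'rV_h) *m v^T = f p *: (delta_mx 0 a *m v^T).
  apply: (@val m); first exact: Qform.
  rewrite addnC; apply: sat_ext (sat_mul (hF a) (sat_Q Qf)) => x.
  by rewrite [X in _ - X]big1 ?subr0 1?mulrC // => b _; rewrite mxE mul0r.
rewrite mul0mx => /matrixP /(_ 0 0); rewrite -rowE !mxE => /esym/eqP.
by rewrite mulf_eq0 (negbTE fp) (negbTE va).
Qed.
End Saturation.

(** A homogeneous ideal Q without zeros in projective space and of bounded codimension
    contains all forms of some degree. With the bound, the Nullstellensatz comes down to a
    common eigenvector of commuting matrices, see [sat_contradiction]. *)
Theorem bounded_nullstellensatz : exists N, forall f, isform N f -> Q N f.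
Proof.
apply: NNPP => nE.
have [i0 hi0] : exists i0 : 'I_n, forall e, ~ Q e (fun x => x 0 i0 ^+ e).
  apply: NNPP => nI; apply: nE.
  have [e he] : exists e : 'I_n -> nat, forall i, Q (e i) (fun x => x 0 i ^+ e i).
    apply: (@fin_all_exists _ _ (fun i e => Q e (fun x => x 0 i ^+ e))) => i.
    by apply: NNPP => nQ; apply: nI; exists i => e he; apply: nQ; exists e.
  exact: Q_all_of_powers he.
exact: sat_contradiction hi0.
Qed.
End BoundedIdeal.
End ClosedField.

(** * Quadrics through a connected curve *)

Section Upper.
Variable k : closedFieldType.

Lemma zclosed_ext n (X Y : 'rV[k]_n -> Prop) : (forall x, X x <-> Y x) -> zclosed X -> zclosed Y.
Proof.
move=> e /zclosedP [h0 h]; apply/zclosedP; split=> [x /e/h0//|x x0 H].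
by apply/e/h => // m f hf fX; apply: (H m f hf) => y /e /fX.
Qed.

Lemma zclosed_empty n : zclosed (fun _ : 'rV[k]_n => False).
Proof.
apply/zclosedP; split=> // x x0 H.
by have /eqP := H _ _ (@isform_cst k n 1) (fun _ => False_ind _); rewrite oner_eq0.
Qed.

Lemma zclosed_exists n (I : eqType) (s : seq I) (X : I -> 'rV[k]_n -> Prop) :
  (forall i, i \in s -> zclosed (X i)) -> zclosed (fun x => exists2 i, i \in s & X i x).
Proof.
elim: s => [|i s IH] hX.
  by apply: zclosed_ext (zclosed_empty n) => x; split=> // - [].
have h1 := hX i (mem_head _ _).
have {IH} h2 := IH (fun j js => hX j (mem_behead (s := i :: s) js)).
apply: zclosed_ext (zclosed_or h1 h2) => x; split.
  by case=> [Xx|[j js Xx]]; [exists i => //; rewrite mem_head|exists j => //; rewrite inE js orbT].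
by case=> j; rewrite inE => /orP [/eqP ->|js]; [left|right; exists j].
Qed.

(** A linear form that separates two points of projective space. *)
Lemma not_submx_form n (z x : 'rV[k]_n) : ~~ (x <= z)%MS ->
  exists l : 'cV[k]_n, (z *m l) 0 0 = 0 /\ (x *m l) 0 0 != 0.
Proof.
rewrite submxE => /rV0Pn [j xj]; exists (col j (cokermx z)).
have colE (y : 'rV_n) : (y *m col j (cokermx z)) 0 0 = (y *m cokermx z) 0 j.
  by rewrite !mxE; apply: eq_bigr => i _; rewrite !mxE.
by rewrite !colE mulmx_coker mxE; split=> //; exact: xj.
Qed.

Lemma submx_same n (z x : 'rV[k]_n) : x != 0 -> (x <= z)%MS -> same_point z x.
Proof.
move=> x0 /sub_rVP [a e]; exists a => //; apply: contraNneq x0 => a0.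
by rewrite e a0 scale0r.
Qed.

Variables (n : nat) (C : 'rV[k]_n -> Prop) (d m0 : nat).
Hypothesis zC : zclosed C.
Hypothesis cC : connected C.
Hypothesis growth : forall m, (m0 <= m)%N ->
  exists h, [/\ hge C m h, hle C m h & hle C m.+1 (h + d)].

Let lin (l : 'cV[k]_n) (x : 'rV[k]_n) : k := (x *m l) 0 0.

Let lin_form l : isform 1 (lin l). Proof. exact: isform_lin. Qed.

(** Take L nonzero at finitely many points of C that determine the forms of degree t + 1 on
    C. Then multiplication by L is injective on forms of degree t on C, and its cokernel in
    degree t + 1 has dimension at most d. As q distinct points of the section by L impose q
    conditions on forms of degree at least q - 1 modulo L, their number is at most d. *)
Lemma section_finite : exists L : 'cV[k]_n, exists s : seq 'rV[k]_n, [/\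
  exists2 x, C x & lin L x != 0,
  forall z, z \in s -> C z /\ lin L z = 0 &
  forall x, C x -> lin L x = 0 -> exists2 z, z \in s & same_point z x].
Proof.
have [[x0 Cx0] _] := cC.
set t := (m0 + d)%N; have [h [[G hG iG] hle1 hle2]] := growth (leq_addr d m0).
have [r [p [_ Cp pdet]]] := determine hle2.
have [|L hL] := @avoid_zeros k n (x0 :: [seq p j | j <- enum 'I_r]).
  move=> x; rewrite inE => /orP [/eqP ->|/mapP [j _ ->]]; exact: zclosed_neq0 zC _.
have Lx0 : lin L x0 != 0 by apply: hL; rewrite mem_head.
have Lp j : lin L (p j) != 0 by apply: hL; rewrite inE map_f ?orbT // mem_enum.
have Linj f : isform t f -> (forall x, C x -> lin L x * f x = 0) -> forall x, C x -> f x = 0.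
  move=> hf Lf x Cx; have /rV0Pn [i xi] := zclosed_neq0 zC Cx.
  have : x 0 i * f x = 0.
    apply: (pdet (fun x => x 0 i * f x)) => // [|j]; first exact: (isformM (isform_coord _ i) hf).
    have /eqP := Lf _ (Cp j); rewrite mulf_eq0 (negbTE (Lp j)) => /eqP ->; exact: mulr0.
  by move/eqP; rewrite mulf_eq0 (negbTE xi) => /eqP.
pose P q := exists z : 'I_q -> 'rV[k]_n, (forall i, C (z i) /\ lin L (z i) = 0) /\
  forall i j, i != j -> ~~ (z i <= z j)%MS.
have [|q Pq|q [z [hz zz]] qmax] := @nat_max P d.
- by exists 0%N, (fun=> 0); split=> [[]|[]].
- case: Pq => z [hz zz].
  have [l hl] : exists l : 'I_q -> 'I_q -> 'cV[k]_n, forall i j, i != j ->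
      lin (l i j) (z j) = 0 /\ lin (l i j) (z i) != 0.
    apply: (@fin_all_exists _ _ (fun i (l : 'I_q -> 'cV[k]_n) => forall j, i != j ->
      lin (l j) (z j) = 0 /\ lin (l j) (z i) != 0)) => i.
    apply: (@fin_all_exists _ _ (fun j (l : 'cV[k]_n) => i != j ->
      lin l (z j) = 0 /\ lin l (z i) != 0)) => j.
    case: (eqVneq i j) => ij; first by exists 0.
    by have [l hl] := not_submx_form (zz i j ij); exists l.
  rewrite leqNgt; apply/negP => dq.
  pose w (i : 'I_d.+1) : 'I_q := widen_ord dq i.
  have [u hu] : exists u : 'I_d.+1 -> 'rV[k]_n -> k, forall i, isform (t.+1 - d) (u i) /\ u i (z (w i)) != 0.
    apply: (@fin_all_exists _ _ (fun i u => isform (t.+1 - d) u /\ u (z (w i)) != 0)) => i.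
    have [f hf fz] := isform_neq0 (t.+1 - d) (zclosed_neq0 zC (hz (w i)).1).
    by exists f.
  pose H (i : 'I_d.+1) x := (\prod_(j | j != i) lin (l (w i) (w j)) x) * u i x.
  have wij i j : (w i == w j) = (i == j) by rewrite -!val_eqE.
  have hH i : isform t.+1 (H i).
    have e : (\sum_(j | j != i) 1 + (t.+1 - d) = t.+1)%N.
      by rewrite sum1_card cardC1 card_ord /= subnKC // /t; lia.
    apply: (isform_eq e); apply: isformM; last by case: (hu i).
    by apply: (@isform_prod _ _ _ _ _ (fun=> 1%N) (fun j x => lin (l (w i) (w j)) x)) => j _.
  have Hd i j : j != i -> H i (z (w j)) = 0.
    move=> ij; rewrite /H (bigD1 j) //=.
    have [|-> _] := hl (w i) (w j); last by rewrite !mul0r.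
    by rewrite wij eq_sym.
  have Hn i : H i (z (w i)) != 0.
    rewrite mulf_neq0 //; last by case: (hu i).
    apply/prodf_neq0 => j ji; have [|_ ->//] := hl (w i) (w j).
    by rewrite wij eq_sym.
  have : (h + d.+1 <= h + d)%N; last by rewrite leq_add2l ltnn.
  apply: (hle2 _ (fun a : 'I_(h + d.+1) => match split a with inl a => fun x => lin L x * G a x | inr i => H i end)).
    by move=> a; case: (split a) => i //; apply: (isformM (lin_form L) (hG i)).
  apply: (@indep_cat _ _ _ _ _ (fun a x => lin L x * G a x) H) => c c' Hc.
  have c'0 : c' = 0.
    apply/rowP => i; rewrite mxE; have [Cz Lz] := hz (w i).
    have := Hc _ Cz; rewrite big1 => [|a _]; last by rewrite Lz mul0r mulr0.
    rewrite add0r (bigD1 i) //= big1 => [|j ji]; last by rewrite Hd ?mulr0 // eq_sym.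
    by rewrite addr0 => /eqP; rewrite mulf_eq0 (negbTE (Hn i)) orbF => /eqP.
  split=> //; apply: iG => x Cx; apply: (Linj (fun x => \sum_i c 0 i * G i x)) => // [|y Cy].
    by apply: isform_sum => a _; apply: isformZ.
  rewrite -[RHS](Hc y Cy) c'0 [X in _ = _ + X]big1 ?addr0 => [|i _]; last by rewrite mxE mul0r.
  by rewrite mulr_sumr; apply: eq_bigr => a _; rewrite mulrCA.
exists L, [seq z i | i <- enum 'I_q]; split; first by exists x0.
  by move=> _ /mapP [i _ ->].
move=> x Cx Lx; apply: NNPP => nE.
have xn := zclosed_neq0 zC Cx.
have xz i : ~~ (x <= z i)%MS.
  apply/negP => /(submx_same xn) sp; apply: nE; exists (z i) => //.
  by rewrite map_f // mem_enum.
suff /qmax : P (q + 1)%N by rewrite addn1 ltnn.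
exists (fun a => match split a with inl i => z i | inr _ => x end); split.
  by move=> a; case: (split a).
move=> a b; case: (split_ordP a) => i ->; case: (split_ordP b) => j -> ab;
  rewrite ?(unsplitK (inl _)) ?(unsplitK (inr _)) //.
- by apply: zz; apply: contraNneq ab => ->.
- apply/negP => /(submx_same (zclosed_neq0 zC (hz i).1)) [c c0 e].
  by have /negP := xz i; apply; rewrite e eqmx_scale.
- by move: ab; rewrite !ord1 eqxx.
Qed.

(** If L f vanishes on C, then C is the union of the zeros of f and of the points of the
    section by L at which f is nonzero. The latter form a finite, hence closed, set, so it is
    empty as C is connected and not contained in the section. *)
Lemma section_injective L (s : seq 'rV[k]_n) :
  (exists2 x, C x & lin L x != 0) ->
  (forall x, C x -> lin L x = 0 -> exists2 z, z \in s & same_point z x) ->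
  forall t f, isform t f -> (forall x, C x -> lin L x * f x = 0) -> forall x, C x -> f x = 0.
Proof.
move=> [x0 Cx0 Lx0] hs t f hf Lf.
pose A x := C x /\ exists2 z, z \in [seq z <- s | (lin L z == 0) && (f z != 0)] & x != 0 /\ x *m cokermx z = 0.
pose B x := C x /\ f x = 0.
have same_zero m g (z x : 'rV[k]_n) : isform m g -> same_point z x -> (g x == 0) = (g z == 0).
  move=> hg [c c0 ->]; rewrite (isform_scale _ _ hg) mulf_eq0 expf_eq0 (negbTE c0).
  by rewrite andbF.
have zA : zclosed A by apply: zclosed_and zC (zclosed_exists _) => z _; apply: zclosed_ker.
have zB : zclosed B by apply: zclosed_zero hf.
have AP x : A x -> f x != 0.
  case=> Cx [z]; rewrite mem_filter => /andP [/andP [_ fz] zs] [x1 xz].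
  have sz : same_point z x by apply: submx_same x1 _; rewrite submxE xz.
  by rewrite (same_zero _ _ _ _ hf sz).
case: (cC.2 A B zA zB) => [x|x [/AP fx [_ f0]]|H x Cx|H].
- split=> [Cx|[[]|[]]//].
  case: (eqVneq (f x) 0) => fx; first by right.
  have Lx : lin L x = 0 by have /eqP := Lf x Cx; rewrite mulf_eq0 (negbTE fx) orbF => /eqP.
  have [z zs sz] := hs x Cx Lx; left; split=> //; exists z.
    rewrite mem_filter zs andbT -(same_zero _ _ _ _ hf sz) fx andbT.
    by rewrite -(same_zero _ _ _ _ (lin_form L) sz) Lx.
  split; first exact: zclosed_neq0 zC Cx.
  by case: sz => c c0 ->; rewrite -scalemxAl mulmx_coker scaler0.
- by rewrite f0 eqxx in fx.
- case: (eqVneq (f x) 0) => // fx; case: (H x); split=> //.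
  have Lx : lin L x = 0 by have /eqP := Lf x Cx; rewrite mulf_eq0 (negbTE fx) orbF => /eqP.
  have [z zs sz] := hs x Cx Lx; exists z.
    rewrite mem_filter zs andbT -(same_zero _ _ _ _ hf sz) fx andbT.
    by rewrite -(same_zero _ _ _ _ (lin_form L) sz) Lx.
  split; first exact: zclosed_neq0 zC Cx.
  by case: sz => c c0 ->; rewrite -scalemxAl mulmx_coker scaler0.
- case: (H x0); split=> //.
  by have /eqP := Lf x0 Cx0; rewrite mulf_eq0 (negbTE Lx0) => /eqP.
Qed.

Section TwoSections.
Variables L L2 : 'cV[k]_n.
Hypothesis Linj : forall t f, isform t f ->
  (forall x, C x -> lin L x * f x = 0) -> forall x, C x -> f x = 0.
Hypothesis LL2 : forall x, C x -> lin L x = 0 -> lin L2 x != 0.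

Let Q m f := isform m f /\ match m with
  | 0%N => forall x, C x -> f x = 0
  | m'.+1 => exists g1 g2, [/\ isform m' g1, isform m' g2 &
      forall x, C x -> f x = lin L x * g1 x + lin L2 x * g2 x]
  end.

(** The ideal of L, L2 and the forms vanishing on C has no zeros, and its codimension is
    bounded since that of L is. *)
Lemma two_sections_cover : exists2 N, (0 < N)%N & forall f, isform N f -> Q N f.
Proof.
have [|||||||x x0|N hN] := @bounded_nullstellensatz k n Q m0.+1 d.
- by move=> m f [].
- move=> m f g e [hf Qf]; split; first exact: isform_ext hf.
  case: m hf Qf => [|m] hf; first by move=> Qf x /Qf; rewrite e.
  by case=> g1 [g2 [h1 h2 h]]; exists g1, g2; split=> // x /h; rewrite e.
- move=> m; split; first exact: isform0.
  case: m => [//|m]; exists (fun=> 0), (fun=> 0); split=> [||x _]; try exact: isform0.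
  by rewrite !mulr0 addr0.
- move=> m f g [hf Qf] [hg Qg]; split; first exact: isformD.
  case: m hf hg Qf Qg => [|m] hf hg; first by move=> Qf Qg x Cx; rewrite Qf // Qg // addr0.
  case=> f1 [f2 [h1 h2 h]] [g1 [g2 [h1' h2' h']]].
  exists (fun x => f1 x + g1 x), (fun x => f2 x + g2 x); split; try exact: isformD.
  by move=> x Cx; rewrite h // h' //; ring.
- move=> m c f [hf Qf]; split; first exact: isformZ.
  case: m hf Qf => [|m] hf; first by move=> Qf x Cx; rewrite Qf // mulr0.
  case=> f1 [f2 [h1 h2 h]].
  exists (fun x => c * f1 x), (fun x => c * f2 x); split; try exact: isformZ.
  by move=> x Cx; rewrite h //; ring.
- move=> m i f [hf Qf]; split; first exact: (isformM (isform_coord _ i) hf).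
  case: m hf Qf => [|m] hf Qf.
    exists (fun=> 0), (fun=> 0); split=> [||x Cx]; try exact: isform0.
    by rewrite Qf // !mulr0 addr0.
  case: Qf => f1 [f2 [h1 h2 h]].
  exists (fun x : 'rV[k]_n => x 0 i * f1 x), (fun x : 'rV[k]_n => x 0 i * f2 x).
  split; try exact: (isformM (isform_coord _ i)).
  by move=> x Cx; rewrite h //; ring.
- move=> m; case: m => [//|m]; rewrite ltnS => mm q H hH iH.
  have [h [[G hG iG] _ hle2]] := growth mm.
  rewrite -(leq_add2l h).
  apply: (hle2 _ (fun a : 'I_(h + q) => match split a with inl a => fun x => lin L x * G a x | inr i => H i end)).
    by move=> a; case: (split a) => i //; apply: (isformM (lin_form L) (hG i)).
  apply: (@indep_cat _ _ _ _ _ (fun a x => lin L x * G a x) H) => c c' Hc.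
  have e x : \sum_i c 0 i * (lin L x * G i x) = lin L x * \sum_i c 0 i * G i x.
    by rewrite mulr_sumr; apply: eq_bigr => a _; rewrite mulrCA.
  have c'0 : c' = 0.
    apply: iH; split; first by apply: isform_sum => i _; apply: isformZ.
    exists (fun x => - \sum_i c 0 i * G i x), (fun=> 0); split=> [||x Cx]; last 1 first.
    - have /eqP := Hc x Cx; rewrite e addrC addr_eq0 => /eqP ->.
      by rewrite mulr0 addr0 mulrN.
    - apply: (@isform_ext _ _ _ (fun x => -1 * \sum_i c 0 i * G i x)) => [x|]; first by rewrite mulN1r.
      by apply: isformZ; apply: isform_sum => i _; apply: isformZ.
    - exact: isform0.
  split=> //; apply: iG => x Cx; apply: (Linj (f := fun x => \sum_i c 0 i * G i x)) => // [|y Cy].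
    by apply: isform_sum => a _; apply: isformZ.
  rewrite -[RHS](Hc y Cy) c'0 [X in _ = _ + X]big1 ?addr0 => [|i _]; last by rewrite mxE mul0r.
  by rewrite e.
- case: (classic (C x)) => Cx.
    case: (eqVneq (lin L x) 0) => Lx; [exists 1%N, (lin L2)|exists 1%N, (lin L)]; split=> //; last 2 first.
    - exact: LL2.
    - split=> //; exists (fun=> 1), (fun=> 0); split=> [||y Cy]; [exact: isform_cst|exact: isform0|].
      by rewrite mulr0 mulr1 addr0.
    split=> //; exists (fun=> 0), (fun=> 1); split=> [||y Cy]; [exact: isform0|exact: isform_cst|].
    by rewrite mulr0 mulr1 add0r.
  apply: NNPP => nE; apply: Cx; have /zclosedP [_ h] := zC; apply: h => // m f hf fC.
  apply: NNPP => fx; apply: nE; exists m, f; split; last exact/eqP.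
  split=> //; case: m hf => [//|m] hf; exists (fun=> 0), (fun=> 0); split=> [||y Cy]; try exact: isform0.
  by rewrite fC // !mulr0 addr0.
case: N hN => [|N] hN; last by exists N.+1.
have [_ h] := hN (fun=> 1) (isform_cst _ _).
have [[x0 Cx0] _] := cC.
by have /eqP := h x0 Cx0; rewrite oner_eq0.
Qed.

Lemma two_sections_powers A B : exists M, [/\ (A <= M)%N, (B <= M)%N & forall M', (M <= M')%N ->
  forall f, isform M' f -> exists g1 g2, [/\ isform (M' - A) g1, isform (M' - B) g2 &
   forall x, C x -> f x = lin L x ^+ A * g1 x + lin L2 x ^+ B * g2 x]].
Proof.
have [N N0 hN] := two_sections_cover.
have hN' M : (N <= M)%N -> forall f, isform M f -> exists g1 g2, [/\ isform M.-1 g1, isform M.-1 g2 &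
      forall x, C x -> f x = lin L x * g1 x + lin L2 x * g2 x].
  move=> NM f; rewrite -(subnK NM); elim: (M - N)%N f => [|e IH] f hf.
    have [_] := hN f hf; case: (N) N0 => [//|N'] _; exact.
  have [g hg eg] := isform_split hf.
  have [G [hG eG]] : exists G : 'I_n -> ('rV[k]_n -> k) * ('rV[k]_n -> k),
     (forall i, isform (e + N).-1 (G i).1 /\ isform (e + N).-1 (G i).2) /\
     forall i x, C x -> g i x = lin L x * (G i).1 x + lin L2 x * (G i).2 x.
    have [G hG] : exists G : 'I_n -> ('rV[k]_n -> k) * ('rV[k]_n -> k), forall i,
     (isform (e + N).-1 (G i).1 /\ isform (e + N).-1 (G i).2) /\
     forall x, C x -> g i x = lin L x * (G i).1 x + lin L2 x * (G i).2 x.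
      apply: (@fin_all_exists _ _ (fun i (G : ('rV[k]_n -> k) * ('rV[k]_n -> k)) =>
       (isform (e + N).-1 G.1 /\ isform (e + N).-1 G.2) /\
        forall x, C x -> g i x = lin L x * G.1 x + lin L2 x * G.2 x)) => i.
      by have [g1 [g2 [h1 h2 h]]] := IH _ (hg i); exists (g1, g2).
    by exists G; split=> i; case: (hG i).
  exists (fun x : 'rV[k]_n => \sum_i x 0 i * (G i).1 x), (fun x : 'rV[k]_n => \sum_i x 0 i * (G i).2 x).
  have eN : ((e.+1 + N).-1 = 1 + (e + N).-1)%N by lia.
  split=> [||x Cx].
  - rewrite eN; apply: isform_sum => i _; apply: isformM; first exact: isform_coord.
    by case: (hG i).
  - rewrite eN; apply: isform_sum => i _; apply: isformM; first exact: isform_coord.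
    by case: (hG i).
  by rewrite eg !mulr_sumr -big_split; apply: eq_bigr => i _ /=; rewrite eG //; ring.
elim: A B => [|A IHA] B.
  exists B; split=> // M' BM f hf; exists f, (fun=> 0); rewrite subn0; split=> // [|x Cx].
    exact: isform0.
  by rewrite expr0 mul1r mulr0 addr0.
elim: B => [|B IHB].
  exists A.+1; split=> // M' AM f hf; exists (fun=> 0), f; rewrite subn0; split=> // [|x Cx].
    exact: isform0.
  by rewrite expr0 mul1r mulr0 add0r.
have [M1 [AM1 BM1 h1]] := IHA B.+1; have [M2 [AM2 BM2 h2]] := IHB.
exists (N + M1 + M2).+1; split=> [||M' MM f hf]; try lia.
have [|g1 [g2 [hg1 hg2 e]]] := hN' M' _ f hf; first by lia.
have [|u [w [hu hw e1]]] := h1 M'.-1 _ g1 hg1; first by lia.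
have [|u' [w' [hu' hw' e2]]] := h2 M'.-1 _ g2 hg2; first by lia.
exists (fun x => u x + lin L2 x * u' x), (fun x => lin L x * w x + w' x); split=> [||x Cx].
- apply: isformD; first by apply: isform_eq hu; lia.
  by apply: isform_eq (isformM (lin_form L2) hu'); lia.
- apply: isformD; last by apply: isform_eq hw'; lia.
  by apply: isform_eq (isformM (lin_form L) hw); lia.
by rewrite e // e1 // e2 // !exprS; ring.
Qed.

(** The quotient of a by L^A equals that of b by L2^B, so it is a regular function on C. In a
    large degree M, where the forms are L^A g1 + L2^B g2 on C, multiplication by this
    function is a matrix acting on the monomials. Its values are eigenvalues of this matrix,
    so they are finitely many; they cut C into disjoint closed sets, of which only one is not
    empty. *)
Lemma regular_constant A B a b : isform A a -> isform B b ->
  (forall x, C x -> lin L2 x ^+ B * a x = lin L x ^+ A * b x) ->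
  exists lam, forall x, C x -> a x = lam * lin L x ^+ A.
Proof.
move=> ha hb ab; have [M [AM BM hM]] := two_sections_powers A B.
pose w (t : M.-tuple 'I_n) : 'rV[k]_n -> k := word_mon t.
have [tau htau] : exists tau : M.-tuple 'I_n -> M.-tuple 'I_n -> k, forall t x, C x ->
   a x * w t x = lin L x ^+ A * \sum_s tau t s * w s x /\
   b x * w t x = lin L2 x ^+ B * \sum_s tau t s * w s x.
  apply: (@fin_all_exists _ _ (fun t (tau : M.-tuple 'I_n -> k) => forall x, C x ->
   a x * w t x = lin L x ^+ A * \sum_s tau s * w s x /\
   b x * w t x = lin L2 x ^+ B * \sum_s tau s * w s x)) => t.
  have [g1 [g2 [hg1 hg2 e]]] := hM M (leqnn M) (w t) (isform_word k t).
  have hu : isform (M + 0) (fun x => a x * g1 x + b x * g2 x).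
    apply: isformD.
      by apply: isform_eq (isformM ha hg1); lia.
    by apply: isform_eq (isformM hb hg2); lia.
  have [g hg eg] := word_split hu.
  exists (fun s => g s 0) => x Cx.
  have -> : \sum_s g s 0 * w s x = a x * g1 x + b x * g2 x.
    by rewrite eg; apply: eq_bigr => s _; rewrite (isform0_const 0 x (hg s)).
  have eab := ab x Cx; rewrite e //; split.
    by rewrite !mulrDr !mulrA -eab; ring.
  by rewrite !mulrDr !mulrA; congr (_ + _); [rewrite [_ * a x]eab; ring|ring].
pose T := \matrix_(j, i) tau (enum_val i) (enum_val j) : 'M_#|{: M.-tuple 'I_n}|.
have [rs ers] := closed_field_poly_normal (char_poly T).
pose X mu x := (C x /\ a x - mu * lin L x ^+ A = 0) /\ b x - mu * lin L2 x ^+ B = 0.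
have Lform e l : isform e (fun x => lin l x ^+ e).
  by apply: (isform_eq (mul1n e)); apply: isformX.
have zX mu : zclosed (X mu).
  apply: (zclosed_zero _ (isformB hb (isformZ mu (Lform B L2)))).
  exact: (zclosed_zero zC (isformB ha (isformZ mu (Lform A L)))).
have XC x : C x -> exists2 mu, mu \in rs & X mu x.
  move=> Cx; suff [mu emu [ea eb]] : exists2 mu, eigenvalue T mu &
      a x = mu * lin L x ^+ A /\ b x = mu * lin L2 x ^+ B.
    exists mu; last by split; [split=> //; rewrite ea subrr|rewrite eb subrr].
    move: emu; rewrite eigenvalue_root_char ers rootZ ?root_prod_XsubC //.
    by rewrite lead_coef_eq0 monic_neq0 // char_poly_monic.
  pose v := \row_i w (enum_val i) x : 'rV_#|{: M.-tuple 'I_n}|.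
  have v0 : v != 0.
    have /rV0Pn [i xi] := zclosed_neq0 zC Cx.
    apply/rV0Pn; exists (enum_rank [tuple of nseq M i]).
    rewrite mxE enum_rankK /w /word_mon prodf_seq_neq0; apply/allP => l /nseqP[-> _]; exact: xi.
  have vT i : (v *m T) 0 i = \sum_s tau (enum_val i) s * w s x.
    rewrite mxE (reindex (@enum_val _ {: M.-tuple 'I_n})) /=.
      by apply: eq_bigr => j _; rewrite !mxE mulrC.
    by apply/onW_bij/enum_val_bij.
  case: (eqVneq (lin L x) 0) => Lx.
    have L2x := LL2 Cx Lx; have L2B := expf_neq0 B L2x.
    exists (b x / lin L2 x ^+ B).
      apply/eigenvalueP; exists v => //; apply/rowP => i; rewrite vT [RHS]mxE [v 0 i]mxE.
      by apply: (mulfI L2B); rewrite -(htau _ _ Cx).2 mulrA mulrCA divff // mulr1.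
    split; last by rewrite divfK.
    have /eqP := ab x Cx; rewrite Lx; case: (A) ha => [|A'] ha.
      rewrite !expr0 mul1r mulr1 => /eqP <-; by rewrite mulrC mulKf.
    rewrite exprS !mul0r mulr0 mulf_eq0 (negbTE L2B) => /eqP //.
  have LA := expf_neq0 A Lx.
  exists (a x / lin L x ^+ A).
    apply/eigenvalueP; exists v => //; apply/rowP => i; rewrite vT [RHS]mxE [v 0 i]mxE.
    by apply: (mulfI LA); rewrite -(htau _ _ Cx).1 mulrA mulrCA divff // mulr1.
  split; first by rewrite divfK.
  by apply: (mulfI LA); rewrite -ab // mulrA mulrCA divff // mulr1 mulrC.
have [[x0 Cx0] _] := cC; have [mu0 mu0s Xx0] := XC x0 Cx0.
exists mu0 => x Cx; apply/eqP; rewrite -subr_eq0; apply/eqP.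
pose Y x := exists2 mu, mu \in [seq mu <- rs | mu != mu0] & X mu x.
have zY : zclosed Y by apply: zclosed_exists => mu _; apply: zX.
case: (cC.2 (X mu0) Y (zX mu0) zY) => [y|y [[[Cy ea] eb] [mu]]|H|H].
- split=> [Cy|[[[]]//|[mu _ [[]]//]]]; have [mu mus Xy] := XC y Cy.
  case: (eqVneq mu mu0) => e; first by left; rewrite -e.
  by right; exists mu => //; rewrite mem_filter e.
- rewrite mem_filter => /andP [nmu _] [[_ ea'] eb'].
  have d0 : mu0 - mu != 0 by rewrite subr_eq0 eq_sym.
  have ha' : (mu0 - mu) * lin L y ^+ A = 0 by rewrite mulrBl -[RHS](subrr 0) -{1}ea' -ea; ring.
  have hb' : (mu0 - mu) * lin L2 y ^+ B = 0 by rewrite mulrBl -[RHS](subrr 0) -{1}eb' -eb; ring.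
  move/eqP: ha'; rewrite mulf_eq0 (negbTE d0) expf_eq0 => /andP [_ /eqP /(LL2 Cy) Ly].
  by move/eqP: hb'; rewrite mulf_eq0 (negbTE d0) expf_eq0 (negbTE Ly) andbF.
- by case: (H x0).
have [mu mus Xx] := XC x Cx.
case: (eqVneq mu mu0) => e; first by move: Xx; rewrite e => - [[]].
by case: (H x); exists mu => //; rewrite mem_filter e.
Qed.
End TwoSections.

(** Multiply the forms of degree 2 by L2^m0 and the forms of degree m0 by L^2. A relation on
    C between them says that F / L^2 = - G / L2^m0 is regular, thus constant, so that F is a
    multiple of L^2. Hence h(2) - 1 + h(m0) is at most h(m0 + 2), which is at most h(m0) +
    2d. *)
Theorem quadrics_bound : hle C 2 (d + d).+1.
Proof.
have [L [s [exL hs Ls]]] := section_finite.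
have Linj := section_injective exL Ls.
have [|L2 hL2] := @avoid_zeros k n s.
  by move=> z /hs [Cz _]; apply: zclosed_neq0 zC Cz.
have LL2 x : C x -> lin L x = 0 -> lin L2 x != 0.
  move=> Cx Lx; have [z zs [c c0 ->]] := Ls x Cx Lx.
  by rewrite /lin -scalemxAl mxE mulf_neq0 //; apply: hL2.
have [h [[G hG iG] _ hle1]] := growth (leqnn m0).
have [h1 [hge1 _ hle2]] := growth (leqnSn m0).
have le12 := hge_le hge1 hle1.
have Lform e l : isform e (fun x => lin l x ^+ e).
  by apply: (isform_eq (mul1n e)); apply: isformX.
(* The multiples of L^2 on C cost at most one quadric, which is given back below. *)
have key q (F : 'I_q -> 'rV[k]_n -> k) : (forall i, isform 2 (F i)) ->
    (forall (c : 'rV_q) lam, (forall x, C x -> \sum_i c 0 i * F i x = lam * lin L x ^+ 2) -> c = 0) ->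
    (q <= d + d)%N.
  move=> hF iF; rewrite -(leq_add2r h).
  have hle2' : hle C m0.+2 (d + d + h) by apply: hle_trans hle2; lia.
  apply: (hle2' _ (fun a : 'I_(q + h) => match split a with
    inl i => fun x => lin L2 x ^+ m0 * F i x | inr i => fun x => lin L x ^+ 2 * G i x end)).
    move=> a; case: (split a) => i.
      by apply: isform_eq (isformM (Lform m0 L2) (hF i)); lia.
    by apply: isform_eq (isformM (Lform 2 L) (hG i)); lia.
  apply: (@indep_cat _ _ _ _ _ (fun i x => lin L2 x ^+ m0 * F i x) (fun i x => lin L x ^+ 2 * G i x)).
  move=> c c' H.
  have eF x : \sum_i c 0 i * (lin L2 x ^+ m0 * F i x) = lin L2 x ^+ m0 * \sum_i c 0 i * F i x.
    by rewrite mulr_sumr; apply: eq_bigr => i _; rewrite mulrCA.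
  have eG x : \sum_i c' 0 i * (lin L x ^+ 2 * G i x) = lin L x ^+ 2 * \sum_i c' 0 i * G i x.
    by rewrite mulr_sumr; apply: eq_bigr => i _; rewrite mulrCA.
  have hcF : isform 2 (fun x => \sum_i c 0 i * F i x) by apply: isform_sum => i _; apply: isformZ.
  have hcG : isform m0 (fun x => -1 * \sum_i c' 0 i * G i x).
    by apply: isformZ; apply: isform_sum => i _; apply: isformZ.
  have [x Cx|lam hlam] := regular_constant Linj LL2 hcF hcG.
    by have := H x Cx; rewrite eF eG => /eqP; rewrite addr_eq0 => /eqP ->; rewrite mulN1r mulrN.
  have c0 : c = 0 by apply: iF hlam.
  split=> //; apply: iG.
  have hcG' : isform m0 (fun x => \sum_i c' 0 i * G i x).
    by apply: isform_sum => i _; apply: isformZ.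
  apply: (Linj _ _ hcG'); apply: (Linj _ _ (isformM (lin_form L) hcG')) => x Cx.
  rewrite mulrA -expr2 -eG -[RHS](H x Cx) [X in _ = X + _]big1 ?add0r // => i _.
  by rewrite c0 mxE mul0r.
move=> q F hF iF; case: q F hF iF => [//|q] F hF iF; rewrite ltnS.
(* Either some combination of the quadrics is a multiple of L^2 on C, and one of them can be
   dropped, or none is. *)
case: (classic (exists (c : 'rV_q.+1) lam, c != 0 /\
    forall x, C x -> \sum_i c 0 i * F i x = lam * lin L x ^+ 2)) => [[c [lam [c0 hc]]]|nE].
  have /rV0Pn [i0 ci0] := c0.
  apply: (key q (fun i => F (lift i0 i))) => // c' lam' hc'.
  case: (eqVneq lam 0) => lam0.
    by case/eqP: c0; apply: iF => x Cx; rewrite hc // lam0 mul0r.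
  pose b : 'rV[k]_q.+1 := \row_j (if unlift i0 j is Some i then c' 0 i else 0).
  have hb x : \sum_j b 0 j * F j x = \sum_i c' 0 i * F (lift i0 i) x.
    rewrite (bigD1_ord i0) //= !mxE unlift_none mul0r add0r.
    by apply: eq_bigr => i _; rewrite mxE liftK.
  have e0 : b - (lam' / lam) *: c = 0.
    apply: iF => x Cx.
    have -> : \sum_i (b - (lam' / lam) *: c) 0 i * F i x =
       \sum_i b 0 i * F i x - lam' / lam * \sum_i c 0 i * F i x.
      by rewrite mulr_sumr -sumrB; apply: eq_bigr => i _; rewrite !mxE mulrBl mulrA.
    by rewrite hb hc' // hc // mulrA divfK // subrr.
  have l0 : lam' = 0.
    have /rowP /(_ i0) := e0; rewrite !mxE unlift_none sub0r => /eqP.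
    rewrite oppr_eq0 mulf_eq0 (negbTE ci0) orbF mulf_eq0 invr_eq0 (negbTE lam0) orbF.
    by move/eqP.
  apply/rowP => i; have /rowP /(_ (lift i0 i)) := e0.
  by rewrite l0 mul0r scale0r subr0 !mxE liftK.
apply: ltnW; apply: (key q.+1 F) => // c lam hc.
by apply/eqP; apply: contraT => c0; case: nE; exists c, lam.
Qed.
End Upper.

(** * Nondegenerate curves and their plane projections *)

Section Curves.
Variable k : closedFieldType.

Lemma spanning_points n (X : 'rV[k]_n -> Prop) : ~ in_hyperplane X ->
  exists2 B : 'M[k]_n, (forall i, X (row i B)) & B \in unitmx.
Proof.
move=> nX; have [c hc|p Xp pU] := @indep_points k _ X n (fun i x => x 0 i).
  apply/eqP; apply: contraT => c0; case: nX; exists c^T.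
    by apply: contraNneq c0 => /(congr1 trmx); rewrite trmxK trmx0 => ->.
  move=> x /hc e; apply/matrixP => a b; rewrite !ord1 !mxE -[RHS]e.
  by apply: eq_bigr => i _; rewrite mxE mulrC.
exists (\matrix_j p j) => [i|]; first by rewrite rowK.
rewrite -unitmx_tr; congr (_ \in unitmx): pU.
by apply/matrixP => i j; rewrite !mxE.
Qed.

(** Project from d of d + 1 points of C that span: this leaves one point. *)
Lemma nondegenerate_hge d (C : 'rV[k]_d.+1 -> Prop) m :
  connected C -> zclosed C -> ~ in_hyperplane C -> hge C m (d * m).+1.
Proof.
move=> cC zC /spanning_points [U CU uU].
pose M := col ord0 (invmx U).
have UM i : row i U *m M = ((i == ord0)%:R)%:M.
  rewrite -row_mul /M colE mulmxA mulmxV // mul1mx.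
  by apply/matrixP => a b; rewrite !ord1 !mxE eqxx andbT mulr1n.
have -> : (d * m).+1 = (d * m + 1)%N by rewrite addn1.
apply: (@hge_project k d.+1 C m d 1 (row' ord0 U) M 1) => //.
- rewrite /row_free eqn_leq rank_leq_row /=.
  have : (\rank U <= \rank (row ord0 U) + \rank (row' ord0 U))%N.
    apply: leq_trans (mxrank_adds_leqif _ _); apply: mxrankS.
    apply/row_subP => i; case: (unliftP ord0 i) => [j ->|->]; last exact: addsmxSl.
    apply: submx_trans (addsmxSr _ _).
    by rewrite (_ : row _ U = row j (row' ord0 U)) ?row_sub //; apply/rowP => b; rewrite !mxE.
  rewrite mxrank_unit // => h; rewrite -ltnS; apply: leq_trans h _.
  by rewrite -[leqRHS]add1n leq_add2r rank_leq_row.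
- by move=> i; rewrite (_ : row i _ = row (lift ord0 i) U) //; apply/rowP => b; rewrite !mxE.
- apply/row_matrixP => i; rewrite row_mul row0.
  rewrite (_ : row i _ = row (lift ord0 i) U); last by apply/rowP => b; rewrite !mxE.
  by rewrite UM /= scalemx0 || rewrite UM; apply/matrixP => a b; rewrite !mxE mul0rn.
- have M0 : M != 0.
    apply/eqP => M0; have := UM ord0; rewrite M0 mulmx0 eqxx => /matrixP /(_ 0 0).
    by rewrite !mxE => /eqP; rewrite eq_sym oner_eq0.
  have : (0 < \rank M)%N by rewrite lt0n mxrank_eq0.
  have := rank_leq_col M; move: (\rank M) => u; lia.
- exists (row ord0 U) => //; rewrite UM eqxx; apply/eqP => /matrixP /(_ 0 0).
  by rewrite !mxE => /eqP; rewrite oner_eq0.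
exists (fun _ y => y 0 0 ^+ m).
  by move=> _; apply: (isform_eq (mul1n m)); apply/isformX/isform_coord.
move=> c hc; apply/matrixP => a b; rewrite !ord1 mxE.
have := hc (row ord0 U *m M); rewrite big_ord1 UM eqxx !mxE expr1n mulr1.
by apply; exists (row ord0 U) => //; rewrite UM eqxx.
Qed.

(** The lower bound by projection and the upper bound of the hypothesis agree, so the Hilbert
    function is dm + 1 for all m. *)
Lemma curve_dim1 d (C : 'rV[k]_d.+1 -> Prop) :
  connected C -> zclosed C -> ~ in_hyperplane C ->
  (forall m, hle C m (d * m).+1) -> dim1_degree C d.
Proof.
move=> cC zC nC hC; exists 1%Z, 0%N => m _; exists (d * m).+1; last by lia.
by apply: hilbert_intro (hC m); apply: nondegenerate_hge.
Qed.

(** All that is used of the Hilbert polynomial is that it grows by d. *)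
Lemma dim1_growth n (C : 'rV[k]_n.+1 -> Prop) d : dim1_degree C d ->
  exists m0, forall m, (m0 <= m)%N ->
  exists h, [/\ hge C m h, hle C m h & hle C m.+1 (h + d)].
Proof.
case=> c [m0 H]; exists m0 => m mm; have [h hh eh] := H m mm.
have [h' hh' eh'] := H m.+1 (leqW mm).
exists h; split; [exact: hilbert_hge|exact: hilbert_hle|].
suff <- : h' = (h + d)%N by apply: hilbert_hle.
by move: eh eh'; rewrite -addn1 PoszD mulrDr; lia.
Qed.

(** The six quadratic monomials; a conic is a linear form in them. *)
Definition veronese (y : 'rV[k]_3) : 'rV[k]_6 :=
  let a := y 0 0 in let b := y 0 1 in let c := y 0 2%:R in
  \row_j nth 0 [:: a * a; a * b; a * c; b * b; b * c; c * c] j.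

Lemma veronese_form j : isform 2 (fun y => veronese y 0 j).
Proof.
have h i i' : isform 2 (fun y : 'rV[k]_3 => y 0 i * y 0 i').
  by apply: (isformM (isform_coord _ i) (isform_coord _ i')).
case: j => [[|[|[|[|[|[|//]]]]]] lt]; apply: isform_ext (h _ _) => y;
  rewrite mxE /=; reflexivity.
Qed.

(** If no conic contains the projection, then the six quadratic monomials are independent on
    it, and h(2) is at least 2r + 6 on C, more than 2(r + 2) + 1. *)
Lemma projected_conic r (C : 'rV[k]_(3 + r) -> Prop) (J : 'M[k]_(r, 3 + r)) (M : 'M[k]_(3 + r, 3)) :
  @quasi_Veronese k (2 + r) C -> row_free J -> (forall i, C (row i J)) -> J *m M = 0 -> \rank M = 3%N ->
  exists2 c : 'cV[k]_6, c != 0 & forall x, C x -> veronese (x *m M) *m c = 0.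
Proof.
move=> [zC cC dC nC] fJ CJ JM rM.
have [m0 growth] := dim1_growth dC.
have h2 := quadrics_bound zC cC growth.
apply: NNPP => nE.
have iV : indep (fun y => exists2 x, C x & y = x *m M) (fun j y => veronese y 0 j).
  move=> c hc; apply/eqP; apply: contraT => c0; case: nE; exists c^T.
    by apply: contraNneq c0 => /(congr1 trmx); rewrite trmxK trmx0 => ->.
  move=> x Cx; apply/matrixP => a b; rewrite !ord1 [RHS]mxE -[RHS](hc (x *m M)); last by exists x.
  by rewrite mxE; apply: eq_bigr => i _; rewrite [c^T _ _]mxE mulrC.
have : hge C 2 (r * 2 + 6).
  apply: (@hge_project k (3 + r) C 2 r 3 J M 6) => //.
  - by rewrite rM addnC.
  - apply: NNPP => nM; apply: nC; exists (col 0 M) => [|x Cx].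
      apply/eqP => M0; suff : (\rank M <= 2)%N by rewrite rM.
      apply: (@leq_trans (\rank (row' 0 M^T))); last exact: rank_leq_row.
      rewrite -mxrank_tr; apply: mxrankS; apply/row_subP => i.
      case: (unliftP 0 i) => [j ->|->].
        by rewrite (_ : row _ M^T = row j (row' 0 M^T)) ?row_sub //; apply/rowP => b; rewrite !mxE.
      rewrite (_ : row _ _ = 0) ?sub0mx //; apply/rowP => b; rewrite !mxE.
      by move/matrixP/(_ b 0): M0; rewrite !mxE.
    have xM : x *m M = 0 by apply/eqP; apply: contraT => xM; case: nM; exists x.
    by rewrite colE mulmxA xM mul0mx.
  by exists (fun j y => veronese y 0 j) => //; apply: veronese_form.
move=> /hge_le /(_ h2); lia.
Qed.
End Curves.

(** * Pascal's theorem *)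

Section ConicDet.
Variable k : closedFieldType.

(** Laplace expansion with indices in nat, which unfolds to an expression that [ring]
    understands. *)
Fixpoint ndet (R : comRingType) n (f : nat -> nat -> R) : R :=
  match n with
  | 0%N => 1
  | n'.+1 => foldr (fun j s => (-1) ^+ j * f 0%N j * ndet n' (fun a b => f a.+1 (if (j <= b)%N then b.+1 else b)) + s) 0 (iota 0 n)
  end.

Lemma ndetE (R : comRingType) n (f : nat -> nat -> R) : \det (\matrix_(i < n, j < n) f i j) = ndet n f.
Proof.
elim: n f => [|n IH] f; first by rewrite det_mx00.
rewrite (expand_det_row _ ord0).
have foldE (g : nat -> R) s : foldr (fun j t => g j + t) 0 s = \sum_(j <- s) g j.
  by elim: s => [|a s IHs]; rewrite ?big_nil // big_cons -IHs.
rewrite /ndet -/ndet foldE -[X in iota _ X]subn0 -/(index_iota 0 n.+1) big_mkord.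
apply: eq_bigr => j _; rewrite /cofactor mxE add0n mulrCA mulrA; congr (_ * _).
rewrite -IH; congr (\det _); apply/matrixP => a b; rewrite !mxE /=; congr f.
by rewrite /bump; case: leqP.
Qed.

Definition d3 (R : comRingType) (x y z x' y' z' x'' y'' z'' : R) : R :=
  x * (y' * z'' - z' * y'') - y * (x' * z'' - z' * x'') + z * (x' * y'' - y' * x'').

(** With six vectors of indeterminates, Pascal's determinant is minus the determinant of the
    quadratic monomials of the vectors. The theorem of Pascal and its converse are thus the
    same identity. *)
Lemma pascal_identity (R : comRingType) (x1 y1 z1 x2 y2 z2 x3 y3 z3 x4 y4 z4 x5 y5 z5 x6 y6 z6 : R) :
  let a1 := d3 x1 y1 z1 x4 y4 z4 x5 y5 z5 in let b1 := d3 x2 y2 z2 x4 y4 z4 x5 y5 z5 in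
  let a2 := d3 x2 y2 z2 x5 y5 z5 x6 y6 z6 in let b2 := d3 x3 y3 z3 x5 y5 z5 x6 y6 z6 in
  let a3 := d3 x3 y3 z3 x6 y6 z6 x1 y1 z1 in let b3 := d3 x4 y4 z4 x6 y6 z6 x1 y1 z1 in
  d3 (a1 * x2 - b1 * x1) (a1 * y2 - b1 * y1) (a1 * z2 - b1 * z1)
     (a2 * x3 - b2 * x2) (a2 * y3 - b2 * y2) (a2 * z3 - b2 * z2)
     (a3 * x4 - b3 * x3) (a3 * y4 - b3 * y3) (a3 * z4 - b3 * z3) =
  - ndet 6 (fun i => nth (fun _ => 0) [seq (fun j => nth 0 [:: u.1.1 * u.1.1; u.1.1 * u.1.2; u.1.1 * u.2; u.1.2 * u.1.2; u.1.2 * u.2; u.2 * u.2] j) |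
   u <- [:: (x1, y1, z1); (x2, y2, z2); (x3, y3, z3); (x4, y4, z4); (x5, y5, z5); (x6, y6, z6)]] i).
Proof.
by rewrite /= /d3; ring.
Qed.

Lemma det3E (u v w : 'rV[k]_3) : \det (col_mx u (col_mx v w)) =
  d3 (u 0 0) (u 0 1) (u 0 2%:R) (v 0 0) (v 0 1) (v 0 2%:R) (w 0 0) (w 0 1) (w 0 2%:R).
Proof.
pose f (x : 'rV[k]_3) (j : nat) := match j with 0%N => x 0 0 | 1%N => x 0 1 | _ => x 0 2%:R end.
have fE (x : 'rV[k]_3) (j : 'I_3) : x 0 j = f x j.
  case: j => [[|[|[|//]]]] lt /=; congr (x 0 _); exact: val_inj.
have -> : col_mx u (col_mx v w) =
   \matrix_(i < 3, j < 3) f (nth u [:: u; v; w] i) j.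
  apply/matrixP => i j; rewrite [RHS]mxE -fE.
  by case: (split_ordP (i : 'I_(1 + 2))) => i' ->; rewrite ?col_mxEu ?col_mxEd ?ord1 //;
    case: (split_ordP (i' : 'I_(1 + 1))) => i'' ->; rewrite ?col_mxEu ?col_mxEd ?ord1 //.
rewrite (ndetE 3 (fun i j => f (nth u [:: u; v; w] i) j)) /= /d3; ring.
Qed.

(** The determinant of the intersection points of the sides 12 and 45, 23 and 56, 34 and 61
    of a hexagon. *)
Definition pascal (q1 q2 q3 q4 q5 q6 : 'rV[k]_3) : k :=
  let br (u v w : 'rV[k]_3) : k := \det (col_mx u (col_mx v w)) in
  br (br q1 q4 q5 *: q2 - br q2 q4 q5 *: q1)
     (br q2 q5 q6 *: q3 - br q3 q5 q6 *: q2)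
     (br q3 q6 q1 *: q4 - br q4 q6 q1 *: q3).

Lemma pascal_veronese (q1 q2 q3 q4 q5 q6 : 'rV[k]_3) :
  pascal q1 q2 q3 q4 q5 q6 =
  - \det (\matrix_(i < 6) veronese (nth 0 [:: q1; q2; q3; q4; q5; q6] i)).
Proof.
have combE a b (u v : 'rV[k]_3) j : (a *: u - b *: v) 0 j = a * u 0 j - b * v 0 j.
  by rewrite !mxE.
rewrite /pascal !det3E !combE.
rewrite pascal_identity -ndetE; congr (- \det _); apply/matrixP => i j; rewrite !mxE.
by case: i => [[|[|[|[|[|[|//]]]]]] lt].
Qed.

Lemma pascal0P (q1 q2 q3 q4 q5 q6 : 'rV[k]_3) : pascal q1 q2 q3 q4 q5 q6 = 0 <->
  exists2 c : 'cV[k]_6, c != 0 & forall q, q \in [:: q1; q2; q3; q4; q5; q6] -> veronese q *m c = 0.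
Proof.
rewrite pascal_veronese; set V := \matrix_i _.
have rV (i : 'I_6) : row i V = veronese (nth 0 [:: q1; q2; q3; q4; q5; q6] i) by rewrite rowK.
split=> [/eqP|[c c0 hc]].
  rewrite oppr_eq0 -det_tr => /det0P [v v0 hv]; exists v^T.
    by apply: contraNneq v0 => /(congr1 trmx); rewrite trmxK trmx0 => ->.
  move=> q /(nthP 0) [i lt <-]; rewrite -(rV (Ordinal lt)) -row_mul.
  by rewrite -[V]trmxK -trmx_mul hv trmx0 row0.
apply/eqP; rewrite oppr_eq0 -det_tr; apply/det0P; exists c^T.
  by apply: contraNneq c0 => /(congr1 trmx); rewrite trmxK trmx0 => ->.
rewrite -trmx_mul; suff -> : V *m c = 0 by rewrite trmx0.
by apply/row_matrixP => i; rewrite row_mul rV row0; apply: hc; apply: mem_nth.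
Qed.
End ConicDet.

(** * Extensors as determinants *)

Section Exterior.
Variables (k : fieldType) (D : nat).
Local Notation ext := {ffun {set 'I_D} -> k^o}.
Implicit Types (S T U : {set 'I_D}) (x y z : ext) (v w : 'rV[k]_D).

Lemma inversionsE S T : inversions S T = (\sum_(i in S) \sum_(j in T) (j < i)%N)%N.
Proof.
rewrite /inversions -sum1_card pair_big_dep /=.
rewrite [RHS]big_mkcond [LHS]big_mkcond; apply: eq_bigr => [[i j] _] /=.
by rewrite inE /=; case: (i \in S); case: (j \in T); case: (j < i)%N.
Qed.

Lemma inversions_splitl S T U : T \subset S ->
  inversions S U = (inversions T U + inversions (S :\: T) U)%N.
Proof.
move=> sTS; rewrite !inversionsE (big_setID T) /=; congr (_ + _)%N.
by apply: eq_bigl => i; rewrite (setIidPr sTS).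
Qed.

Lemma inversions_splitr S T U : T \subset U ->
  inversions S U = (inversions S T + inversions S (U :\: T))%N.
Proof.
move=> sTU; rewrite !inversionsE -big_split /=; apply: eq_bigr => i _.
rewrite (big_setID T) /=; congr (_ + _)%N.
by apply: eq_bigl => j; rewrite (setIidPr sTU).
Qed.

(** Both sides are sums over the ways to cut U into three parts, with the same number of
    inversions. *)
Lemma joinA x y z : join (join x y) z = join x (join y z).
Proof.
apply/ffunP => U; rewrite !ffunE.
have e1 S : S \subset U -> (-1) ^+ inversions S (U :\: S) * join x y S * z (U :\: S) =
   \sum_(T : {set 'I_D} | T \subset S)
     (-1) ^+ (inversions T (S :\: T) + inversions T (U :\: S) + inversions (S :\: T) (U :\: S)) *
     (x T * y (S :\: T) * z (U :\: S)).
  move=> sSU; rewrite ffunE mulr_sumr mulr_suml; apply: eq_bigr => T sTS.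
  rewrite (inversions_splitl _ sTS) !exprD; ring.
rewrite (eq_bigr _ e1) (exchange_big_dep (fun T => T \subset U)) /=; last first.
  by move=> S T sSU sTS; apply: subset_trans sTS sSU.
apply: eq_bigr => T sTU; rewrite ffunE mulr_sumr.
rewrite (reindex_onto (fun R => T :|: R) (fun S => S :\: T)) /=; last first.
  by move=> S /andP [_ sTS]; apply/setP => i; rewrite !inE; case: (boolP (i \in T)) => //= /(subsetP sTS) ->.
apply: eq_big => [R|R].
  rewrite subsetUl andbT subUset sTU /=.
  apply/andP/idP => [[sRU /eqP e]|sR].
    by apply/subsetP => i iR; rewrite inE (subsetP sRU) // andbT; move: iR; rewrite -e !inE => /andP[].
  split; first by apply: subset_trans sR (subsetDl _ _).
  apply/eqP/setP => i; rewrite !inE; case: (boolP (i \in T)) => //= iT.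
  by apply/esym/negbTE/negP => /(subsetP sR); rewrite inE iT.
move=> /andP [/andP [sRU _] /eqP e].
have eU : U :\: (T :|: R) = (U :\: T) :\: R by rewrite setDDl.
rewrite e eU.
have sR : R \subset U :\: T.
  by rewrite -e; apply: setSD; move: sRU.
rewrite [inversions T (U :\: T)](inversions_splitr _ sR) !exprD; ring.
Qed.

Lemma ext_vecN v : ext_vec (- v) = - ext_vec v.
Proof. by apply/ffunP => S; rewrite !ffunE -sumrN; apply: eq_bigr => i _; rewrite mxE. Qed.
Lemma ext_vecD v w : ext_vec (v + w) = ext_vec v + ext_vec w.
Proof. by apply/ffunP => S; rewrite !ffunE -big_split; apply: eq_bigr => i _; rewrite mxE. Qed.
Lemma ext_vecZ (c : k) v : ext_vec (c *: v) = c *: ext_vec v.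
Proof.
apply/ffunP => S; rewrite !ffunE /= /GRing.scale /= mulr_sumr.
by apply: eq_bigr => i _; rewrite mxE.
Qed.

Lemma join_vec v y U : join (ext_vec v) y U =
  \sum_(i in U) (-1) ^+ inversions [set i] (U :\ i) * v 0 i * y (U :\ i).
Proof.
rewrite ffunE.
have e1 S : S \subset U -> (-1) ^+ inversions S (U :\: S) * ext_vec v S * y (U :\: S) =
  \sum_(i | S == [set i]) (-1) ^+ inversions [set i] (U :\ i) * v 0 i * y (U :\ i).
  move=> _; rewrite ffunE mulr_sumr mulr_suml; apply: eq_bigr => i /eqP ->; by [].
rewrite (eq_bigr _ e1) (exchange_big_dep (fun i => i \in U)) /=; last first.
  by move=> S i sS /eqP e; move: sS; rewrite e sub1set.
apply: eq_bigr => i iU; rewrite (big_pred1 [set i]) // => S /=.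
by apply/andP/eqP => [[_ /eqP]//|->]; rewrite sub1set iU.
Qed.

Lemma join1 v : join (ext_vec v) (@ext1 k D) = ext_vec v.
Proof.
apply/ffunP => U; rewrite join_vec ffunE big_mkcond [RHS]big_mkcond; apply: eq_bigr => i _.
rewrite ffunE; case: (eqVneq U [set i]) => [->|nU].
  rewrite set11 setDv eqxx mulr1 /inversions (_ : [set _ | _] = set0) ?cards0 ?mul1r //.
  by apply/setP => ij; rewrite !inE andbF.
case: ifP => // iU; case: (eqVneq (U :\ i) set0) => [U0|]; last by rewrite mulr0.
by case/eqP: nU; rewrite -(setD1K iU) U0 setU0.
Qed.

End Exterior.

Section ExtensorDet.
Variables (k : fieldType) (n : nat).
Local Notation D := n.+1.

Lemma enum_setD1 (U : {set 'I_D}) i : enum (U :\ i) = rem i (enum U).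
Proof.
rewrite rem_filter ?enum_uniq // /enum_mem -filter_predI; apply: eq_filter => j /=.
by rewrite !inE.
Qed.

Lemma sorted_enum_set (U : {set 'I_D}) : sorted (fun a b : 'I_D => (a < b)%N) (enum U).
Proof.
apply: sorted_filter; first by move=> a b c; apply: ltn_trans.
by rewrite -enumT -(@sorted_map _ _ val ltn) val_enum_ord iota_ltn_sorted.
Qed.

(** This makes the sign of the join a sign of the Laplace expansion. *)
Lemma inversions_rank (U : {set 'I_D}) j : (j < #|U|)%N ->
  inversions [set nth ord0 (enum U) j] (U :\ nth ord0 (enum U) j) = j.
Proof.
move=> ltj; set i := nth _ _ _.
rewrite inversionsE big_set1 -big_mkcondr /= sum1_card.
have lt_nth a b : (a < #|U|)%N -> (b < #|U|)%N ->
    (nth ord0 (enum U) a < nth ord0 (enum U) b)%N = (a < b)%N.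
  move=> ha hb; have mono a' b' : (a' < #|U|)%N -> (b' < #|U|)%N -> (a' < b')%N ->
      (nth ord0 (enum U) a' < nth ord0 (enum U) b')%N.
    by move=> ha' hb' ab; apply: (sorted_ltn_nth _ ord0 (sorted_enum_set U)); rewrite ?inE -?cardE // => x y z; apply: ltn_trans.
  case: (ltngtP a b) => [ab|ba|->]; last by rewrite ltnn.
    by rewrite mono.
  by apply/negbTE; rewrite -leqNgt ltnW // mono.
transitivity (size [seq l <- iota 0 #|U| | (l < j)%N]).
  rewrite -sum1_card -big_filter sum1_size.
  transitivity (size [seq t : 'I_D <- enum U | (t < i)%N]).
    have -> : [seq t : 'I_D <- enum U | (t < i)%N] = [seq t : 'I_D <- index_enum 'I_D | (t \in U :\ i) && (t < i)%N].
      rewrite /enum_mem -filter_predI; apply: eq_filter => t /=.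
      rewrite !inE; case: (eqVneq t i) => [->|]; first by rewrite ltnn.
      by rewrite andbC.
    by congr size; apply: eq_filter => t; rewrite unfold_in /= unfold_in.
  have eU : enum U = [seq nth ord0 (enum U) l | l <- iota 0 #|U|] by rewrite cardE map_nth_iota0 ?take_size.
  rewrite eU filter_map size_map; congr size; apply: eq_in_filter => l; rewrite mem_iota add0n => /andP [_ hl] /=.
  by rewrite /i lt_nth.
rewrite -(subnKC (ltnW ltj)) iotaD filter_cat size_cat add0n.
rewrite (eq_in_filter (a2 := xpredT)) => [|l]; last by rewrite mem_iota => /andP[_ ->].
rewrite (eq_in_filter (a2 := xpred0) (s := iota j _)) => [|l]; last first.
  by rewrite mem_iota => /andP[jl _]; apply/negbTE; rewrite -leqNgt.
by rewrite filter_predT filter_pred0 size_iota addn0.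
Qed.

(** The coefficients of an extensor are its maximal minors, by Laplace expansion along the
    first vector. *)
Theorem extensor_coef (s : seq 'rV[k]_D) (U : {set 'I_D}) : extensor s U =
  if #|U| == size s then \det (\matrix_(i < size s, j < size s) (s`_i) 0 (nth ord0 (enum U) j)) else 0.
Proof.
elim: s U => [|v s IH] U.
  by rewrite ffunE /= cards_eq0; case: eqP => _; rewrite ?det_mx00.
rewrite /= join_vec; case: ifP => [/eqP cU|/eqP cU]; last first.
  apply: big1 => i iU; rewrite IH ifF ?mulr0 //; apply/eqP => c; apply: cU.
  by rewrite (cardsD1 i) iU c.
rewrite (expand_det_row _ ord0) -big_enum /= (big_nth ord0) big_mkord -cardE cU.
apply: eq_bigr => j _; have ltj : (j < #|U|)%N by rewrite cU.
set i := nth _ _ _; have iU : i \in U by rewrite -mem_enum mem_nth // -cardE.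
have ci : #|U :\ i| == size s by move: cU; rewrite (cardsD1 i) iU /= add1n => - [->].
rewrite inversions_rank // IH ci mxE /= /cofactor add0n mulrCA mulrA; congr (_ * _).
congr (\det _); apply/matrixP => a b; rewrite !mxE /= enum_setD1 remE; congr (_ 0 _).
rewrite index_uniq ?enum_uniq -?cardE // nth_cat size_take -cardE ltj /bump.
case: leqP => jb.
  by rewrite nth_drop addSn subnKC.
by rewrite nth_take.
Qed.

Lemma extensor_eq0 (s : seq 'rV[k]_D) : size s = D -> extensor s = 0 <-> bracket s = 0.
Proof.
move=> ss.
have eT : extensor s setT = bracket s.
  rewrite extensor_coef cardsT card_ord ss eqxx /bracket; congr (\det _).
  apply/matrixP => i j; rewrite !mxE; congr (_ 0 _); apply: val_inj => /=.
  by rewrite enum_setT -enumT nth_ord_enum.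
split=> [e|e]; first by rewrite -eT e ffunE.
apply/ffunP => U; rewrite [RHS]ffunE.
case: (eqVneq U setT) => [->|nU]; first by rewrite eT.
rewrite extensor_coef ifF //; apply/negbTE; apply: contra nU => /eqP cU.
by rewrite eqEcard subsetT cardsT card_ord cU ss leqnn.
Qed.

Lemma big_S2 (F : 'S_2 -> {ffun {set 'I_D} -> k^o}) : \sum_s F s = F 1%g + F (tperm ord0 ord_max).
Proof.
rewrite (bigD1 1%g) //= (bigD1 (tperm ord0 ord_max)) /=; last first.
  by apply/eqP => /permP /(_ ord0); rewrite tpermL perm1.
rewrite big1 ?addr0 // => s /andP [s1 st].
have I2 (i : 'I_2) : i = ord0 \/ i = ord_max.
  by case: i => [[|[|//]] lt]; [left|right]; apply: val_inj.
case: (I2 (s ord0)) => e0; case: (I2 (s ord_max)) => e1.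
- by have := perm_inj (etrans e0 (esym e1)).
- by case/eqP: s1; apply/permP => i; rewrite perm1; case: (I2 i) => ->.
- by case/eqP: st; apply/permP => i; case: (I2 i) => ->; rewrite ?tpermL ?tpermR.
- by have := perm_inj (etrans e0 (esym e1)).
Qed.

(** Two shuffles of the two vectors contribute: the meet of a line and a hyperplane is their
    common point. *)
Lemma meet_line (p1 p2 : 'rV[k]_D) (b : seq 'rV[k]_D) : size b = n ->
  meet [:: p1; p2] b = ext_vec (bracket (p1 :: b) *: p2 - bracket (p2 :: b) *: p1).
Proof.
move=> sb; rewrite /meet sb subSnn.
rewrite (eq_bigl xpredT) => [|s]; last first.
  apply/forallP => u; apply/forallP => v; apply/implyP => /andP [uv /orP [|]].
    by case: v uv => [[|//]].
  by case: u uv => [[|[|//]]] // lt; case: v => [[|[|//]]].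
rewrite big_S2 odd_perm1 odd_tperm /=.
have e2 : enum 'I_2 = [:: ord0; ord_max].
  by apply: (inj_map val_inj); rewrite val_enum_ord.
rewrite /image_mem e2 /= !perm1 tpermL tpermR.
rewrite expr0 expr1 mul1r mulN1r !join1.
by rewrite ext_vecD ext_vecN !ext_vecZ scaleNr.
Qed.
End ExtensorDet.

(** * The Grassmann-Cayley expression is Pascal's expression in a plane *)

Section GCPascal.
Variables (k : closedFieldType) (r : nat).
Local Notation D := (3 + r)%N.
Variable J : seq 'rV[k]_D.
Hypothesis sJ : size J = r.
Let Jm := \matrix_(i < r) J`_i.

Lemma bracket_block (u v w : 'rV[k]_D) :
  bracket [:: u, v, w & J] = \det (col_mx (col_mx u (col_mx v w)) Jm).
Proof.
rewrite /bracket; congr (\det _); apply/matrixP => i j; rewrite mxE.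
case: (split_ordP i) => i' ->; last by rewrite col_mxEd mxE.
rewrite col_mxEu.
have [a ->|i2 ->] := split_ordP (i' : 'I_(1 + (1 + 1))).
  by rewrite (@col_mxEu _ 1 (1 + 1) D u (col_mx v w) a j) (ord1 a).
rewrite (@col_mxEd _ 1 (1 + 1) D u (col_mx v w) i2 j).
by have [a ->|a ->] := split_ordP i2; rewrite ?col_mxEu ?col_mxEd (ord1 a).
Qed.

Lemma bracket_dependent (u v w : 'rV[k]_D) : ~~ row_free Jm -> bracket [:: u, v, w & J] = 0.
Proof.
rewrite -kermx_eq0 => /rowV0Pn [x /sub_kermxP xJ x0]; rewrite bracket_block.
apply/eqP/det0P; exists (row_mx 0 x); last by rewrite mul_row_col mul0mx xJ addr0.
by apply: contraNneq x0 => /eqP; rewrite row_mx_eq0 => /andP [_ /eqP ->].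
Qed.

(** With a section N of the projection M, each vector is the lift of its projection plus a
    combination of the rows of J. So the matrix of u, v, w and J is the product of a
    block-triangular one and the matrix of N and J. *)
Lemma bracket_project (M : 'M[k]_(D, 3)) : row_free Jm -> Jm *m M = 0 -> \rank M = 3%N ->
  exists2 c : k, c != 0 & forall u v w : 'rV[k]_D,
    bracket [:: u, v, w & J] = c * \det (col_mx (u *m M) (col_mx (v *m M) (w *m M))).
Proof.
move=> fJ JM rM.
have /row_fullP [N NM] : row_full M by rewrite /row_full rM.
have kerJ : (kermx M <= Jm)%MS.
  have JK : (Jm <= kermx M)%MS by apply/sub_kermxP.
  by rewrite -(geq_leqif (mxrank_leqif_sup JK)) mxrank_ker (eqP fJ) rM addKn.
exists (\det (col_mx N Jm)) => [|u v w].
  rewrite -unitfE -unitmxE -row_free_unit -kermx_eq0; apply/rowV0P => x /sub_kermxP.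
  rewrite -[x]hsubmxK mul_row_col; move: (lsubmx x) (rsubmx x) => a b e.
  have a0 : a = 0.
    by have := congr1 (mulmx^~ M) e; rewrite mulmxDl -!mulmxA NM JM mulmx1 mulmx0 addr0 mul0mx.
  move: e; rewrite a0 mul0mx add0r => /eqP; rewrite mulmx_free_eq0 // => /eqP ->.
  exact: row_mx0.
rewrite bracket_block; set U := col_mx u _.
have -> : col_mx (u *m M) (col_mx (v *m M) (w *m M)) = U *m M by rewrite !mul_col_mx.
have /submxP [A eA] : (U - U *m M *m N <= Jm)%MS.
  apply: submx_trans kerJ; apply/sub_kermxP.
  by rewrite mulmxBl -!mulmxA NM mulmx1 subrr.
have -> : col_mx U Jm = block_mx (U *m M) A 0 1%:M *m col_mx N Jm.
  by rewrite mul_block_col mul0mx mul1mx add0r -eA addrC subrK.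
by rewrite det_mulmx det_ublock det1 mulr1 mulrC.
Qed.

Variables p1 p2 p3 p4 p5 p6 : 'rV[k]_D.
Let E := join (join (join
         (meet [:: p1; p2] (p4 :: p5 :: J))
         (meet [:: p2; p3] (p5 :: p6 :: J)))
         (meet [:: p3; p4] (p6 :: p1 :: J)))
         (extensor J).

(** The meets are vectors, so the expression is an extensor of step D. *)
Lemma gc_bracket : E = 0 <-> bracket [::
   bracket [:: p1, p4, p5 & J] *: p2 - bracket [:: p2, p4, p5 & J] *: p1,
   bracket [:: p2, p5, p6 & J] *: p3 - bracket [:: p3, p5, p6 & J] *: p2,
   bracket [:: p3, p6, p1 & J] *: p4 - bracket [:: p4, p6, p1 & J] *: p3 & J] = 0.
Proof.
rewrite /E !(@meet_line k (2 + r)) /= ?sJ // !joinA.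
by apply: (@extensor_eq0 k (2 + r) [:: _, _, _ & J]); rewrite /= sJ.
Qed.

(** All brackets containing the points of J vanish. *)
Theorem gc_dependent : ~~ row_free Jm -> E = 0.
Proof. by move=> nJ; apply/gc_bracket; apply: bracket_dependent. Qed.

Theorem gc_pascal (M : 'M[k]_(D, 3)) : row_free Jm -> Jm *m M = 0 -> \rank M = 3%N ->
  E = 0 <-> pascal (p1 *m M) (p2 *m M) (p3 *m M) (p4 *m M) (p5 *m M) (p6 *m M) = 0.
Proof.
move=> fJ JM rM; have [c c0 hc] := bracket_project fJ JM rM.
have -> : (E = 0) <-> c ^+ 4 * pascal (p1 *m M) (p2 *m M) (p3 *m M) (p4 *m M) (p5 *m M) (p6 *m M) = 0.
  rewrite gc_bracket !hc !mulmxBl -!scalemxAl -!scalerA -!scalerBr /pascal.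
  set u := _ - _; set v := _ - _; set w := _ - _.
  suff -> : \det (col_mx (c *: u) (col_mx (c *: v) (c *: w))) = c ^+ 3 * \det (col_mx u (col_mx v w)).
    by rewrite mulrA -exprS.
  by rewrite -!scale_col_mx detZ.
split=> [/eqP|->]; last exact: mulr0.
by rewrite mulf_eq0 expf_eq0 (negbTE c0) andbF => /eqP.
Qed.
End GCPascal.

(** * Necessity of the Grassmann-Cayley condition *)

Section Necessity.
Variable k : closedFieldType.

Lemma kernel_matrix r n m (A : 'M[k]_(r, n)) : n = (\rank A + m)%N ->
  exists M : 'M[k]_(n, m), A *m M = 0 /\ \rank M = m.
Proof.
move=> e; suff H m' : \rank (kermx A^T) = m' -> exists M : 'M[k]_(n, m'), A *m M = 0 /\ \rank M = m'.
  by apply: H; rewrite mxrank_ker mxrank_tr {1}e addKn.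
move=> <-; exists (row_base (kermx A^T))^T; split; last by rewrite mxrank_tr eq_row_base.
apply: (can_inj (@trmxK _ _ _)); rewrite trmx_mul trmxK trmx0.
by apply/sub_kermxP; rewrite eq_row_base.
Qed.

Lemma quasi_Veronese_gc r (C : 'rV[k]_(3 + r) -> Prop) (J : seq 'rV[k]_(3 + r)) p1 p2 p3 p4 p5 p6 :
  @quasi_Veronese k (2 + r) C -> size J = r -> (forall x, x \in J -> C x) ->
  (forall x, x \in [:: p1; p2; p3; p4; p5; p6] -> C x) ->
  join (join (join
         (meet [:: p1; p2] (p4 :: p5 :: J))
         (meet [:: p2; p3] (p5 :: p6 :: J)))
         (meet [:: p3; p4] (p6 :: p1 :: J)))
         (extensor J) = 0.
Proof.
move=> qC sJ CJ Cp; case: (boolP (row_free (\matrix_(i < r) J`_i))) => fJ; last exact: gc_dependent.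
have [|M [JM rM]] := @kernel_matrix r (3 + r) 3 (\matrix_(i < r) J`_i).
  by rewrite (eqP fJ) addnC.
have [|c c0 hc] := projected_conic qC fJ _ JM rM.
  by move=> i; rewrite rowK; apply: CJ; rewrite mem_nth // sJ.
apply/(gc_pascal sJ _ _ _ _ _ _ fJ JM rM)/pascal0P; exists c => // q.
rewrite !inE => hq; have {hq} : q \in [seq p *m M | p <- [:: p1; p2; p3; p4; p5; p6]] by rewrite !inE.
by move=> /mapP [p hp ->]; apply: hc; apply: Cp.
Qed.

Section Multihomogeneous.
Variables (d n : nat).
Implicit Types (e : 'I_n -> nat) (f g : ('I_n -> 'rV[k]_d.+1) -> k).

(** Multihomogeneous polynomials, handled through the functions of n points that they
    induce. *)
Definition mhom e f : Prop := exists2 F : {mpoly k[n * d.+1]},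
  forall m, m \in msupp F -> forall i, (\sum_(j < d.+1) m (mxvec_index i j))%N = e i &
  forall Q, f Q = eval_points F Q.

Lemma mhom_ext e e' f g : e =1 e' -> f =1 g -> mhom e f -> mhom e' g.
Proof. by move=> ee fg [F hF eF]; exists F => [m /hF h i|Q]; rewrite -?ee -?fg. Qed.

Lemma mhom0 e : mhom e (fun=> 0).
Proof. by exists 0 => [m|Q]; rewrite ?msupp0 // /eval_points meval0. Qed.

Lemma mhom1 : mhom (fun=> 0%N) (fun=> 1).
Proof.
exists 1 => [m|Q]; last by rewrite /eval_points meval1.
by rewrite msupp1 inE => /eqP -> i; rewrite big1 // => j _; rewrite mnm0E.
Qed.

Lemma mhomD e f g : mhom e f -> mhom e g -> mhom e (fun Q => f Q + g Q).
Proof.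
case=> F hF eF [G hG eG]; exists (F + G) => [m /msuppD_le|Q].
  by rewrite mem_cat => /orP [/hF|/hG].
by rewrite /eval_points mevalD eF eG.
Qed.

Lemma mhomZ c e f : mhom e f -> mhom e (fun Q => c * f Q).
Proof.
case=> F hF eF; exists (c *: F) => [m /msuppZ_le /hF//|Q].
by rewrite /eval_points mevalZ eF.
Qed.

Lemma mhomM e e' f g : mhom e f -> mhom e' g -> mhom (fun i => (e i + e' i)%N) (fun Q => f Q * g Q).
Proof.
case=> F hF eF [G hG eG]; exists (F * G) => [m /msuppM_le|Q].
  move=> /allpairsP [[u v] /= [/hF hu /hG hv ->]] i.
  by rewrite -hu -hv -big_split; apply: eq_bigr => j _; rewrite mnmDE.
by rewrite /eval_points mevalM eF eG.
Qed.

Lemma mhom_coord i j : mhom (fun i' => i == i') (fun Q => Q i 0 j).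
Proof.
exists 'X_(mxvec_index i j) => [m|Q]; last by rewrite /eval_points mevalXU mxvecE mxE.
rewrite msuppX inE => /eqP -> i'.
under eq_bigr => j' _ do rewrite mnm1E.
have mxi (a a' : 'I_n) (b b' : 'I_d.+1) : (mxvec_index a b == mxvec_index a' b') = (a == a') && (b == b').
  apply/eqP/andP => [e|[/eqP -> /eqP ->]//].
  by have [] := enum_rank_inj (cast_ord_inj e) => -> ->.
case: (eqVneq i i') => [<-|ne].
  by rewrite (bigD1 j) //= mxi !eqxx big1 // => j' /negbTE nj; rewrite mxi eq_sym nj andbF.
by rewrite big1 // => j' _; rewrite mxi (negbTE ne).
Qed.

Lemma mhom_sum (I : Type) (s : seq I) e (F : I -> ('I_n -> 'rV[k]_d.+1) -> k) :
  (forall a, mhom e (F a)) -> mhom e (fun Q => \sum_(a <- s) F a Q).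
Proof.
move=> hF; elim: s => [|a s IH].
  by apply: mhom_ext (mhom0 e) => // Q; rewrite big_nil.
by apply: mhom_ext (mhomD (hF a) IH) => // Q; rewrite big_cons.
Qed.

Lemma mhom_prod (I : Type) (s : seq I) (e : I -> 'I_n -> nat) (F : I -> ('I_n -> 'rV[k]_d.+1) -> k) :
  (forall a, mhom (e a) (F a)) -> mhom (fun i => \sum_(a <- s) e a i)%N (fun Q => \prod_(a <- s) F a Q).
Proof.
move=> hF; elim: s => [|a s IH].
  by apply: mhom_ext mhom1 => [i|Q]; rewrite big_nil.
by apply: mhom_ext (mhomM (hF a) IH) => [i|Q]; rewrite big_cons.
Qed.

Lemma mhom_det m (e : 'I_m -> 'I_n -> nat) (A : 'I_m -> 'I_m -> ('I_n -> 'rV[k]_d.+1) -> k) :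
  (forall a b, mhom (e a) (A a b)) ->
  mhom (fun i => \sum_a e a i)%N (fun Q => \det (\matrix_(a, b) A a b Q)).
Proof.
move=> hA; apply: mhom_sum => s; apply: mhomZ.
apply: mhom_ext (mhom_prod (index_enum _) (fun a => hA a (s a))) => // Q.
by apply: eq_bigr => a _; rewrite mxE.
Qed.

Lemma mhom_bracket (l : seq 'I_n) : size l = d.+1 ->
  mhom (fun i => count_mem i l) (fun Q => bracket [seq Q i | i <- l]).
Proof.
move=> sl; case: l sl => [//|i0 l0]; set l := i0 :: l0 => sl.
apply: mhom_ext (mhom_det (fun a b : 'I_d.+1 => mhom_coord (nth i0 l a) b)) => [i|Q].
  rewrite -sum1_count [RHS]big_mkcond (big_nth i0) big_mkord sl.
  by apply: eq_bigr => a _ /=; case: eqP.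
by congr (\det _); apply/matrixP => a b; rewrite !mxE (nth_map i0) // sl.
Qed.

Lemma Veronese_mhom e f (P : 'I_n -> 'rV[k]_d.+1) : mhom e f -> Veronese_compactification P ->
  (forall Q, on_rational_normal_curve Q -> f Q = 0) -> f P = 0.
Proof.
move=> [F hF eF] [_ hV] fQ; rewrite eF; apply: hV; first by exists e.
by move=> Q /fQ; rewrite eF.
Qed.
End Multihomogeneous.

Lemma rnc_quasi_Veronese d (C : 'rV[k]_d.+1 -> Prop) : rational_normal_curve C -> quasi_Veronese C.
Proof.
by case=> [[zC irr] dC _ _ nC]; split=> //; apply: irreducible_connected.
Qed.

(** The expression is one bracket of brackets by [gc_bracket], hence multihomogeneous in all
    the points, and it vanishes on the points of rational normal curves because these are
    quasi-Veronese. *)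
Lemma Veronese_gc r n (P : 'I_n -> 'rV[k]_(3 + r)) (s : seq 'I_n) i1 i2 i3 i4 i5 i6 :
  @Veronese_compactification k (2 + r) n P -> size s = r ->
  let J := [seq P j | j <- s] in
  join (join (join
         (meet [:: P i1; P i2] (P i4 :: P i5 :: J))
         (meet [:: P i2; P i3] (P i5 :: P i6 :: J)))
         (meet [:: P i3; P i4] (P i6 :: P i1 :: J)))
         (extensor J) = 0.
Proof.
move=> VP ss J.
pose br a b c (Q : 'I_n -> 'rV[k]_(3 + r)) := bracket [:: Q a, Q b, Q c & [seq Q j | j <- s]].
pose mt a b c e Q := br a c e Q *: Q b - br b c e Q *: Q a.
pose f Q := bracket [:: mt i1 i2 i4 i5 Q, mt i2 i3 i5 i6 Q, mt i3 i4 i6 i1 Q & [seq Q j | j <- s]].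
have hmt a b c e j : @mhom (2 + r) n (fun i => count_mem i [:: a, b, c, e & s]) (fun Q => mt a b c e Q 0 j).
  have h1 := mhomM (@mhom_bracket (2 + r) n [:: a, c, e & s] (congr1 (fun u => u.+3) ss)) (mhom_coord b j).
  have h2 := mhomM (@mhom_bracket (2 + r) n [:: b, c, e & s] (congr1 (fun u => u.+3) ss)) (mhom_coord a j).
  have h2' : @mhom (2 + r) n (fun i => (count_mem i [:: a, c, e & s] + (b == i))%N)
     (fun Q => -1 * (bracket [seq Q i | i <- [:: b, c, e & s]] * Q a 0 j)).
    by apply: mhomZ; apply: mhom_ext h2 => // i /=; lia.
  apply: mhom_ext (mhomD h1 h2') => [i|Q] /=; first by lia.
  by rewrite /mt mulN1r !mxE.
have hf : exists e, @mhom (2 + r) n e f.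
  (* The degree of row a of the bracket in the i-th point. *)
  pose e (a : 'I_(3 + r)) (i : 'I_n) : nat := match val a with
    0%N => count_mem i [:: i1, i2, i4, i5 & s] | 1%N => count_mem i [:: i2, i3, i5, i6 & s]
    | 2%N => count_mem i [:: i3, i4, i6, i1 & s] | b.+3 => nth i1 s b == i end.
  exists (fun i => \sum_a e a i)%N.
  apply: (@mhom_ext (2 + r) n _ _ _ _ (fun=> erefl) _
   (@mhom_det (2 + r) n (3 + r) e (fun a b Q => (nth 0 [:: mt i1 i2 i4 i5 Q, mt i2 i3 i5 i6 Q, mt i3 i4 i6 i1 Q & [seq Q j | j <- s]] a) 0 b) _)).
    by move=> Q; congr (\det _); apply/matrixP => a b; rewrite !mxE.
  move=> [[|[|[|a]]] lt] b; try exact: hmt.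
  have la : (a < size s)%N by rewrite ss.
  apply: mhom_ext (mhom_coord (nth i1 s a) b) => // Q.
  by rewrite /= (nth_map i1).
have [e he] := hf.
apply/gc_bracket; first by rewrite size_map.
apply: (Veronese_mhom he VP) => Q [_ _ [C /rnc_quasi_Veronese qC CQ]].
apply/(gc_bracket (J := [seq Q j | j <- s])); first by rewrite size_map.
apply: (quasi_Veronese_gc qC) => [|x /mapP [j _ ->]//|x]; first by rewrite size_map.
by rewrite !inE => /orP [|/orP [|/orP [|/orP [|/orP [|]]]]] /eqP ->.
Qed.
End Necessity.

(** * Rational curves and their unions *)

Section RationalCurves.
Variable k : closedFieldType.

Lemma poly_nonroot (p : {poly k}) : p != 0 -> exists a, p.[a] != 0.
Proof.
move=> p0; have [rs e] := closed_field_poly_normal p.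
have [a ha] := avoid_seq rs; exists a.
rewrite -/(root p a) e rootZ ?lead_coef_eq0 // root_prod_XsubC //.
Qed.

(** The binary form of degree e that p is the dehomogenization of. *)
Definition bform e (p : {poly k}) (s t : k) : k := \sum_(l < e.+1) p`_l * (s ^+ (e - l) * t ^+ l).

Implicit Types p q : {poly k}.

Lemma bform_horner e p t : (size p <= e.+1)%N -> bform e p 1 t = p.[t].
Proof.
move=> sp; rewrite (horner_coef_wide _ sp); apply: eq_bigr => l _.
by rewrite expr1n mul1r.
Qed.

Lemma bform_s e p s t : s != 0 -> bform e p s t = s ^+ e * bform e p 1 (t / s).
Proof.
move=> s0; rewrite mulr_sumr; apply: eq_bigr => l _.
rewrite expr1n mul1r [RHS]mulrCA; congr (_ * _); rewrite expr_div_n.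
have -> : s ^+ e = s ^+ (e - l) * s ^+ l by rewrite -exprD subnK // -ltnS.
by rewrite -mulrA; congr (_ * _); rewrite mulrCA divff ?mulr1 // expf_neq0.
Qed.

Lemma bform_0 e p t : bform e p 0 t = p`_e * t ^+ e.
Proof.
rewrite /bform big_ord_recr /= subnn expr0 mul1r big1 ?add0r // => l _.
by rewrite expr0n subn_eq0 leqNgt ltn_ord mul0r mulr0.
Qed.

Lemma bformM e e' p q s t : (size p <= e.+1)%N -> (size q <= e'.+1)%N ->
  bform (e + e') (p * q) s t = bform e p s t * bform e' q s t.
Proof.
move=> sp sq; have spq : (size (p * q)%R <= (e + e').+1)%N.
  by apply: leq_trans (size_polyMleq _ _) _; lia.
case: (eqVneq s 0) => [->|s0]; last first.
  by rewrite !(bform_s _ _ _ s0) !bform_horner // hornerM exprD mulrACA.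
rewrite !bform_0 coefM exprD.
have le : (e < (e + e').+1)%N by rewrite ltnS leq_addr.
rewrite (bigD1 (Ordinal le)) //= big1 => [|j nj].
  by rewrite addr0 addKn mulrACA.
have : val j != e by move: nj; rewrite -val_eqE.
rewrite neq_ltn orbC => /orP [lj|lj]; first by rewrite nth_default ?mul0r // (leq_trans sp).
by rewrite [q`_ _]nth_default ?mulr0 //; apply: leq_trans sq _; move: lj => /=; lia.
Qed.

Lemma bformD e p q s t : bform e (p + q) s t = bform e p s t + bform e q s t.
Proof. by rewrite -big_split; apply: eq_bigr => l _; rewrite coefD mulrDl. Qed.

Lemma bform_sum e (I : Type) (r : seq I) (p : I -> {poly k}) s t :
  bform e (\sum_(i <- r) p i) s t = \sum_(i <- r) bform e (p i) s t.
Proof.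
elim: r => [|i r IH]; rewrite ?big_nil ?big_cons ?bformD ?IH //.
by rewrite /bform big1 // => l _; rewrite coef0 mul0r.
Qed.

Section Image.
Variables (n e : nat) (psi : 'I_n -> {poly k}).
Hypothesis spsi : forall j, (size (psi j) <= e.+1)%N.

Definition rpoint (s t : k) : 'rV[k]_n := \row_j bform e (psi j) s t.
(** Taking the closure avoids the elimination theory that would show the image to be
    closed. *)
Definition rcurve : 'rV[k]_n -> Prop := zclosure (fun x => exists s t, x = rpoint s t).

(** A form of degree m pulls back to a binary form of degree em. *)
Lemma isform_pullback m f : isform m f -> exists2 q : {poly k}, (size q <= (e * m).+1)%N &
  forall s t, f (rpoint s t) = bform (e * m) q s t.
Proof.
elim: m f => [|m IH] f hf.
  exists (f 0)%:P => [|s t]; first by rewrite muln0 size_polyC; case: eqP.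
  by rewrite muln0 /bform big_ord1 coefC eqxx subn0 expr0 !mulr1; apply: isform0_const.
have [g hg eg] := isform_split hf.
have [q sq eq] : exists2 q : 'I_n -> {poly k}, (forall i, (size (q i) <= (e * m).+1)%N) &
    forall i s t, g i (rpoint s t) = bform (e * m) (q i) s t.
  apply: (@fin_all_exists2 _ _ (fun i (q : {poly k}) => (size q <= (e * m).+1)%N)
     (fun i q => forall s t, g i (rpoint s t) = bform (e * m) q s t)) => i.
  by have [q ? ?] := IH _ (hg i); exists q.
exists (\sum_i psi i * q i) => [|s t].
  apply: (leq_trans (size_sum _ _ _)); apply/bigmax_leqP => i _.
  apply: leq_trans (size_polyMleq _ _) _.
  by have := spsi i; have := sq i; rewrite mulnS; lia.
rewrite eg bform_sum; apply: eq_bigr => i _.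
by rewrite eq mulnS bformM // mxE.
Qed.

(** There are em + 1 monomials of degree em in two variables. *)
Lemma rcurve_hle m : hle rcurve m (e * m).+1.
Proof.
move=> h F hF iF.
have [q hq] : exists q : 'I_h -> {poly k}, forall i s t, F i (rpoint s t) = bform (e * m) (q i) s t.
  apply: (@fin_all_exists _ _ (fun i q => forall s t, F i (rpoint s t) = bform (e * m) q s t)) => i.
  by have [q _ ?] := isform_pullback (hF i); exists q.
apply: (@indep_span k (k * k) (fun=> True) h _ (fun i st => F i (rpoint st.1 st.2))
   (fun l st => st.1 ^+ (e * m - l) * st.2 ^+ l) (\matrix_(i, l) (q i)`_l)).
  by move=> i st _; rewrite hq; apply: eq_bigr => l _; rewrite mxE.
move=> c hc; apply: iF => x [_ hx]; apply: (hx m (fun x => \sum_i c 0 i * F i x)).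
  by apply: isform_sum => i _; apply: isformZ.
by move=> y [s [t ->]]; apply: (hc (s, t)).
Qed.

(** If neither A nor B contains the curve, then two binary forms that are not zero vanish on
    the respective preimages, and their product has a parameter at which it is nonzero. *)
Lemma rcurve_irreducible : (exists j, psi j != 0) -> irreducible_set rcurve.
Proof.
move=> [j pj]; split.
  have [a pa] := poly_nonroot pj; exists (rpoint 1 a); apply: sub_zclosure; first by exists 1, a.
  by apply/rV0Pn; exists j; rewrite mxE bform_horner.
move=> A B /zclosedP [A0 hA] /zclosedP [B0 hB] AB; apply: NNPP => /not_or_and [nA nB].
have witness (X : 'rV[k]_n -> Prop) : (forall x, x != 0 -> (forall m f, isform m f -> (forall y, X y -> f y = 0) -> f x = 0) -> X x) ->
    ~ (forall x, rcurve x -> X x) -> exists m f (q : {poly k}), [/\ forall y, X y -> f y = 0, q != 0,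
      (size q <= (e * m).+1)%N & forall s t, f (rpoint s t) = bform (e * m) q s t].
  move=> hX nX; have [x Hx] := not_forall_exists nX; have [Cx Xx] := imply_to_and _ _ Hx.
  apply: NNPP => nE; apply: Xx; apply: hX => [|m f hf fX]; first by case: Cx.
  apply: NNPP => fx; apply: nE; have [q sq eq] := isform_pullback hf.
  exists m, f, q; split=> //; apply/eqP => q0; apply: fx; case: Cx => _ HC; apply: (HC m f hf) => y [s [t ->]].
  by rewrite eq q0 /bform big1 // => l _; rewrite coef0 mul0r.
have [m [f [q [fA q0 sq eq]]]] := witness A hA nA.
have [m' [f' [q' [fB q0' sq' eq']]]] := witness B hB nB.
have : psi j * (q * q') != 0 by rewrite !mulf_neq0.
case/poly_nonroot => a; rewrite !hornerM !mulf_eq0 !negb_or => /andP [pa /andP [qa qa']].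
have : rcurve (rpoint 1 a).
  apply: sub_zclosure; first by exists 1, a.
  by apply/rV0Pn; exists j; rewrite mxE bform_horner.
move=> /AB [/fA|/fB]; rewrite ?eq ?eq' bform_horner // => /eqP; exact/negP.
Qed.
End Image.

(** Connected closed sets with the Hilbert function of a rational normal curve of degree e,
    or a smaller one. *)
Definition curve_le n e (C : 'rV[k]_n -> Prop) : Prop :=
  [/\ zclosed C, connected C & forall m, hle C m (e * m).+1].

Lemma curve_weaken n e e' (C : 'rV[k]_n -> Prop) : (e <= e')%N -> curve_le e C -> curve_le e' C.
Proof.
move=> le [zC cC hC]; split=> // m; apply: hle_trans (hC m).
by rewrite ltnS leq_mul2r le orbT.
Qed.

Lemma rcurve_le n e (psi : 'I_n -> {poly k}) : (forall j, (size (psi j) <= e.+1)%N) ->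
  (exists j, psi j != 0) -> curve_le e (rcurve e psi).
Proof.
move=> sp pj; split; [exact: zclosure_closed|exact/irreducible_connected/rcurve_irreducible|].
exact: rcurve_hle.
Qed.

Lemma line_curve n (x y : 'rV[k]_n) : x != 0 -> exists2 C, curve_le 1 C &
  forall a b : k, a *: x + b *: y != 0 -> C (a *: x + b *: y).
Proof.
move=> /rV0Pn [j xj]; pose psi j := (x 0 j)%:P + y 0 j *: 'X.
have spsi i : (size (psi i) <= 2)%N.
  rewrite /psi; apply: leq_trans (size_polyD _ _) _; rewrite geq_max.
  apply/andP; split; first by apply: leq_trans (size_polyC_leq1 _) _.
  by apply: leq_trans (size_scale_leq _ _) _; rewrite size_polyX.
exists (rcurve 1 psi).
  apply: rcurve_le => //; exists j; apply: contraNneq xj => /(congr1 (fun p : {poly k} => p`_0)).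
  by rewrite !coefE mulr0 addr0 => ->.
move=> a b ne; apply: sub_zclosure => //; exists a, b; apply/rowP => i; rewrite !mxE.
by rewrite /bform !big_ord_recl big_ord0 !coefE /=; ring.
Qed.

Lemma point_curve n (x : 'rV[k]_n) : x != 0 -> exists2 C, curve_le 0 C & C x.
Proof.
move=> x0; pose psi j := (x 0 j)%:P; have /rV0Pn [j xj] := x0.
exists (rcurve 0 psi).
  apply: rcurve_le => [i|]; first exact: size_polyC_leq1.
  by exists j; rewrite polyC_eq0.
apply: sub_zclosure => //; exists 1, 1; apply/rowP => i.
by rewrite mxE /bform big_ord1 coefC eqxx !expr1n !mulr1.
Qed.

(** The Hilbert functions add up to at most e1 m + 1 + e2 m + 1. One unit is gained at the
    common point x: the forms counted on C2 vanish on C1, in particular at x, so a form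
    nonzero at x is independent of them. *)
Lemma curve_join n e1 e2 (C1 C2 : 'rV[k]_n -> Prop) x : curve_le e1 C1 -> curve_le e2 C2 ->
  C1 x -> C2 x -> curve_le (e1 + e2) (fun y => C1 y \/ C2 y).
Proof.
move=> [z1 c1 h1] [z2 c2 h2] C1x C2x; split; first exact: zclosed_or.
- split=> [|A B zA zB AB dAB]; first by exists x; left.
  have part (C : 'rV[k]_n -> Prop) : zclosed C -> connected C -> (forall y, C y -> A y \/ B y) -> C x ->
      (A x -> forall y, C y -> ~ B y) /\ (B x -> forall y, C y -> ~ A y).
    move=> zC [_ cC] CAB Cx.
    have [y|y [[_ Ay] [_ By]]|H|H] := cC _ _ (zclosed_and zC zA) (zclosed_and zC zB).
    - by split=> [Cy|[[]|[]]//]; case: (CAB y Cy); [left|right].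
    - by apply: (dAB y).
    - split=> [Ax|Bx y Cy Ay]; first by case: (H x).
      by apply: (H y).
    - split=> [Ax y Cy By|Bx]; last by case: (H x).
      by apply: (H y).
  have [p1 p1'] := part C1 z1 c1 (fun y Cy => (AB y).1 (or_introl Cy)) C1x.
  have [p2 p2'] := part C2 z2 c2 (fun y Cy => (AB y).1 (or_intror Cy)) C2x.
  case: ((AB x).1 (or_introl C1x)) => ABx; [right|left] => y Hy.
    by case: ((AB y).2 (or_intror Hy)) => Cy; [apply: (p1 ABx y)|apply: (p2 ABx y)].
  by case: ((AB y).2 (or_introl Hy)) => Cy; [apply: (p1' ABx y)|apply: (p2' ABx y)].
move=> m h F hF iF.
have [r [p [rle C1p pdet]]] := determine (h1 m).
pose E := \matrix_(i < h, j < r) F i (p j).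
(* The combinations of F that vanish at the points p, hence on C1; there are at least h - r
   independent ones. *)
pose K := row_base (kermx E); pose q := \rank (kermx E).
have qE : (h <= r + q)%N.
  by rewrite /q mxrank_ker; have := rank_leq_col E; lia.
pose G (a : 'I_q) y := \sum_i K a i * F i y.
have hG a : isform m (G a) by apply: isform_sum => i _; apply: isformZ.
have GC1 a y : C1 y -> G a y = 0.
  apply: (pdet (G a)) => // j.
  have : row a K *m E = 0.
    by apply/sub_kermxP; apply: submx_trans (row_sub _ _) _; rewrite eq_row_base.
  by move/rowP/(_ j); rewrite !mxE => <-; apply: eq_bigr => i _; rewrite !mxE.
have iG : indep C2 G.
  move=> c hc; have cK : c *m K = 0.
    apply: iF => y; have -> : \sum_i (c *m K) 0 i * F i y = \sum_a c 0 a * G a y.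
      under eq_bigr => i _ do rewrite mxE mulr_suml.
      rewrite exchange_big; apply: eq_bigr => a _; rewrite mulr_sumr.
      by apply: eq_bigr => i _; rewrite mulrA.
    case=> Cy; last exact: hc.
    by rewrite big1 // => a _; rewrite GC1 // mulr0.
  by apply/eqP; rewrite -(mulmx_free_eq0 c (row_base_free (kermx E))); apply/eqP.
have [u hu ux] := isform_neq0 m (zclosed_neq0 z1 C1x).
have : (1 + q <= (e2 * m).+1)%N.
  apply: (h2 m _ (fun i : 'I_(1 + q) => match split i with inl _ => u | inr a => G a end)).
    by move=> i; case: (split i).
  apply: indep_cat1 iG _ => c' H; case/negP: ux; rewrite (H x C2x) big1 // => a _.
  by rewrite GC1 // mulr0.
by rewrite mulnDl; lia.
Qed.

(** Join both curves by a line through a point of each. *)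
Lemma curve_bridge n e1 e2 (C1 C2 : 'rV[k]_n -> Prop) : curve_le e1 C1 -> curve_le e2 C2 ->
  exists2 C, curve_le (e1 + e2).+1 C & forall x, C1 x \/ C2 x -> C x.
Proof.
move=> h1 h2; have [z1 [[x1 C1x] _] _] := h1; have [z2 [[x2 C2x] _] _] := h2.
have [L hL Lx] := line_curve x2 (zclosed_neq0 z1 C1x).
have Lx1 : L x1.
  by have := Lx 1 0; rewrite scale1r scale0r addr0; apply; apply: zclosed_neq0 C1x.
have Lx2 : L x2.
  by have := Lx 0 1; rewrite scale1r scale0r add0r; apply; apply: zclosed_neq0 C2x.
have h1L := curve_join h1 hL C1x Lx1.
have := curve_join h1L h2 (or_intror Lx2) C2x.
rewrite -addnA add1n addnS => H; eexists; first exact: H.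
by move=> x [] ?; [left; left|right].
Qed.
End RationalCurves.

(** * Curves through points with Gale dual on a rational curve *)

(** Extracts a bad pair up to permutation, as the lists stand for configurations without
    order. *)
Lemma not_pairwise (T : eqType) (r : rel T) (l : seq T) : ~~ pairwise r l ->
  exists x y l', perm_eq l [:: x, y & l'] /\ ~~ r x y.
Proof.
elim: l => [//|a l IH] /=; rewrite negb_and => /orP [/allPn [y yl ray]|/IH [x [y [l' [pl rxy]]]]].
  by exists a, y, (rem y l); rewrite perm_cons perm_to_rem.
exists x, y, (a :: l'); split=> //.
rewrite (perm_trans (y := a :: [:: x, y & l'])) ?perm_cons //.
by apply/permPl; exact: (perm_catCA [:: a] [:: x; y] l').
Qed.

Lemma pairwise_symP (T : eqType) (r : rel T) (l : seq T) : ssrbool.symmetric r -> irreflexive r ->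
  pairwise r l -> uniq l /\ {in l &, forall a b, a != b -> r a b}.
Proof.
move=> sr ir; elim: l => [//|x l IH] /= /andP [/allP xl /IH [ul rl]]; split.
  by rewrite ul andbT; apply/negP => /xl; rewrite ir.
move=> a b; rewrite !inE => /orP [/eqP ->|al] /orP [/eqP ->|bl]; rewrite ?eqxx // => ab.
- exact: xl.
- by rewrite sr xl.
- exact: rl.
Qed.

Lemma parallel (k : fieldType) (u v u' v' : k) : (u, v) != (0, 0) -> u * v' - v * u' = 0 ->
  exists c, u' = c * u /\ v' = c * v.
Proof.
have [->|u0] := eqVneq u 0.
  rewrite xpair_eqE eqxx /= => v0 /eqP; rewrite mul0r sub0r oppr_eq0 mulf_eq0 (negbTE v0) => /eqP ->.
  by exists (v' / v); rewrite mulr0 divfK.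
move=> _ /eqP; rewrite subr_eq0 => /eqP E; exists (u' / u); rewrite divfK //; split=> //.
by rewrite mulrAC [u' * v]mulrC -E mulrAC divff // mul1r.
Qed.

Section Gale.
Variables (k : closedFieldType) (D rho : nat).

(** A vector P together with its Gale dual vector, which is lam times the point (s : t) of
    the rational normal curve of degree rho. For rho = 2 this is a conic, for rho = 1 a
    line. *)
Definition item := (k * (k * k) * 'rV[k]_D)%type.
Implicit Types (i j x y : item) (l : seq item) (phi : {poly k}).
Definition lam i := i.1.1.
Definition pt i := i.2.
(** The value at the Gale dual vector of the linear form with coefficients phi, that is, lam
    times a binary form at (s : t). *)
Definition dual phi i : k := lam i * bform rho phi i.1.2.1 i.1.2.2.
Definition det2 i j : k := i.1.2.1 * j.1.2.2 - i.1.2.2 * j.1.2.1.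

(** Each linear form, evaluated on the dual vectors, is a linear relation between the
    vectors. *)
Definition gale_relations l : Prop := forall phi, (size phi <= rho.+1)%N ->
  \sum_(i <- l) dual phi i *: pt i = 0.
(** The dual vectors span, so the relations above are independent. *)
Definition gale_spans l : Prop := forall phi, (size phi <= rho.+1)%N ->
  (forall i, i \in l -> dual phi i = 0) -> phi = 0.

Lemma gale_spans_size l : gale_spans l -> (rho.+1 <= size l)%N.
Proof.
move=> sl; rewrite leqNgt; apply/negP => lt.
pose A := \matrix_(a < rho.+1, b < size l) dual 'X^a (nth (0, (0, 0), 0) l b).
have bX (a : 'I_rho.+1) (s t : k) : bform rho 'X^a s t = s ^+ (rho - a) * t ^+ a.
  rewrite /bform (bigD1 a) //= coefXn eqxx mul1r big1 ?addr0 // => b nb.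
  by rewrite coefXn (negbTE (_ : (b : nat) != a)) ?mul0r.
have [c c0 cA] := left_kernel A lt; case/negP: c0.
pose phi := \poly_(a < rho.+1) c 0 (inord a).
have : phi = 0.
  apply: sl => [|i]; first exact: size_poly.
  move=> /(nthP (0, (0, 0), 0)) [b blt <-].
  have := congr1 (fun M : 'rV_(size l) => M 0 (Ordinal blt)) cA; rewrite [LHS]mxE [RHS]mxE => e.
  rewrite -[RHS]e {1}/dual {1}/bform mulr_sumr; apply: eq_bigr => a _.
  by rewrite mxE /dual bX coef_poly ltn_ord inord_val mulrCA.
move=> phi0; apply/eqP/rowP => a; have := congr1 (fun p : {poly k} => p`_a) phi0.
by rewrite coef_poly ltn_ord inord_val coef0 mxE.
Qed.

Lemma dual_proportional x y c phi : y.1.2 = (c * x.1.2.1, c * x.1.2.2) ->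
  bform rho phi y.1.2.1 y.1.2.2 = c ^+ rho * bform rho phi x.1.2.1 x.1.2.2.
Proof.
move=> ->; rewrite /bform mulr_sumr; apply: eq_bigr => a _ /=.
rewrite [RHS]mulrCA; congr (_ * _); rewrite !exprMn mulrACA -exprD subnK //.
by rewrite -ltnS.
Qed.

(** The binary linear form that vanishes at the parameter of j. *)
Definition lpoly j : {poly k} := j.1.2.2%:P - j.1.2.1 *: 'X.

Lemma size_lpoly j : (size (lpoly j) <= 2)%N.
Proof.
apply: leq_trans (size_polyD _ _) _; rewrite geq_max size_polyN.
apply/andP; split; first by apply: leq_trans (size_polyC_leq1 _) _.
by apply: leq_trans (size_scale_leq _ _) _; rewrite size_polyX.
Qed.

Lemma size_prod_lpoly l : (size (\prod_(j <- l) lpoly j)%R <= (size l).+1)%N.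
Proof.
elim: l => [|j l IH]; first by rewrite big_nil size_poly1.
rewrite big_cons; apply: leq_trans (size_polyMleq _ _) _.
move: (size_lpoly j) IH; move: (size (lpoly j)) (size (\prod_(i <- l) lpoly i)%R) => a b /=; lia.
Qed.

Lemma bform_prod i l : bform (size l) (\prod_(j <- l) lpoly j) i.1.2.1 i.1.2.2 = \prod_(j <- l) det2 i j.
Proof.
elim: l => [|j l IH].
  by rewrite !big_nil /bform big_ord1 coefC eqxx !expr0 !mulr1.
rewrite !big_cons -[size _]/(1 + size l)%N bformM ?size_lpoly ?size_prod_lpoly // IH; congr (_ * _).
rewrite /bform !big_ord_recl big_ord0 /lpoly !coefE /= /det2; ring.
Qed.

Lemma det2_self i : det2 i i = 0.
Proof. by rewrite /det2 mulrC subrr. Qed.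
Lemma det2_sym i j : det2 i j = - det2 j i.
Proof. by rewrite /det2; ring. Qed.

(** Let rho + 1 items form l2, and omega be the product of the linear forms vanishing at
    their parameters.  The curve is
      psi(sigma) = sum_(j in l1) lam_j omega(sigma_j) prod_(l in l1, l <> j) det(sigma, sigma_l) P_j.
    At the parameter of an item of l1 only its own term is left.  At the parameter of an item i of l2,
    the value is a multiple of P_i by the relation whose binary form vanishes at the
    other items of l2. *)
Lemma distinct_curve l1 l2 : size l2 = rho.+1 -> gale_relations (l1 ++ l2) ->
  uniq (l1 ++ l2) -> {in l1 ++ l2 &, forall a b, a != b -> det2 a b != 0} ->
  {in l1 ++ l2, forall i, lam i != 0} ->
  exists2 psi : 'I_D -> {poly k}, (forall c, (size (psi c) <= (size l1).-1.+1)%N) &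
   forall i, i \in l1 ++ l2 -> exists2 c : k, c != 0 & pt i = c *: rpoint (size l1).-1 psi i.1.2.1 i.1.2.2.
Proof.
move=> s2 rel u12 d12 lam0; have [u1 [/hasPn n12 u2]] : uniq l1 /\ ~~ has (mem l1) l2 /\ uniq l2.
  by move: u12; rewrite cat_uniq => /and3P [].
pose om i := \prod_(b <- l2) det2 i b.
pose psi c := \sum_(j <- l1) (lam j * om j * pt j 0 c) *: \prod_(l <- rem j l1) lpoly l.
have psize j : j \in l1 -> size (rem j l1) = (size l1).-1 by move=> jl; rewrite size_rem.
have spsi c : (size (psi c) <= (size l1).-1.+1)%N.
  rewrite /psi big_seq; apply: (leq_trans (size_sum _ _ _)); apply/bigmax_leqP_seq => j _ jl.
  by apply: leq_trans (size_scale_leq _ _) _; rewrite -(psize j jl) size_prod_lpoly.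
have rE i : rpoint (size l1).-1 psi i.1.2.1 i.1.2.2 =
    \sum_(j <- l1) (lam j * om j * \prod_(l <- rem j l1) det2 i l) *: pt j.
  apply/rowP => c; rewrite mxE bform_sum summxE big_seq [RHS]big_seq; apply: eq_bigr => j jl.
  rewrite mxE -bform_prod (psize j jl) /bform mulr_sumr mulr_suml; apply: eq_bigr => a _.
  rewrite coefZ; ring.
exists psi => // i; rewrite mem_cat => /orP [il|il].
  have ne : lam i * om i * \prod_(l <- rem i l1) det2 i l != 0.
    have ii : i \in l1 ++ l2 by rewrite mem_cat il.
    rewrite !mulf_neq0 ?lam0 //.
      rewrite prodf_seq_neq0; apply/allP => b bl /=; apply: d12; [done|by rewrite mem_cat bl orbT|].
      by apply: contraNneq (n12 b bl) => <-.
    rewrite prodf_seq_neq0; apply/allP => b bl /=; apply: d12 => //.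
      by rewrite mem_cat (mem_rem bl).
    by apply: contraTneq bl => <-; rewrite mem_rem_uniqF.
  eexists; first exact: (invr_neq0 ne).
  rewrite rE (big_rem i il) /= [X in _ + X]big_seq [X in _ + X]big1 ?addr0 => [|j jl].
    by rewrite scalerA mulVf // scale1r.
  have ij : i \in rem j l1.
    by rewrite mem_rem_uniq // inE il andbT; apply: contraTneq jl => <-; rewrite mem_rem_uniqF.
  by rewrite [X in _ * X](big_rem i ij) /= det2_self mul0r mulr0 scale0r.
have ii : i \in l1 ++ l2 by rewrite mem_cat il orbT.
pose phi := \prod_(b <- rem i l2) lpoly b.
have srem : size (rem i l2) = rho by rewrite size_rem // s2.
have sphi : (size phi <= rho.+1)%N by rewrite -srem size_prod_lpoly.
have phiE j : bform rho phi j.1.2.1 j.1.2.2 = \prod_(b <- rem i l2) det2 j b.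
  by rewrite -srem bform_prod.
pose pi := \prod_(l <- l1) det2 i l.
have pi0 : pi != 0.
  rewrite prodf_seq_neq0; apply/allP => b bl /=; apply: d12; [done|by rewrite mem_cat bl|].
  by apply: contraTneq bl => <-; apply: n12.
have phi0 : dual phi i != 0.
  rewrite mulf_neq0 ?lam0 // phiE prodf_seq_neq0; apply/allP => b bl /=; apply: d12 => //.
    by rewrite mem_cat (mem_rem bl) orbT.
  by apply: contraTneq bl => <-; rewrite mem_rem_uniqF.
have := rel phi sphi; rewrite big_cat /= (big_rem i il) /= [X in _ + (_ + X)]big_seq.
rewrite [X in _ + (_ + X)]big1 => [|b bl]; last first.
  by rewrite /dual phiE (big_rem b bl) /= det2_self mul0r mulr0 scale0r.
rewrite addr0 addrC => /eqP; rewrite addr_eq0 => /eqP e.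
exists (dual phi i * pi)^-1; first by rewrite invr_neq0 // mulf_neq0.
have -> : rpoint (size l1).-1 psi i.1.2.1 i.1.2.2 = (dual phi i * pi) *: pt i.
  rewrite mulrC -scalerA e scalerN rE scaler_sumr -sumrN big_seq [RHS]big_seq.
  apply: eq_bigr => j jl; rewrite scalerA -scaleNr; congr (_ *: _).
  rewrite /pi (big_rem j jl) /= /om (big_rem i il) /= /dual phiE (det2_sym j i); ring.
by rewrite scalerA mulVf ?scale1r // mulf_neq0.
Qed.

Lemma gale_perm l l' : perm_eq l l' -> gale_relations l -> gale_relations l'.
Proof. by move=> p h phi sphi; rewrite -(perm_big _ p) h. Qed.
Lemma gale_spans_perm l l' : perm_eq l l' -> gale_spans l -> gale_spans l'.
Proof. by move=> p h phi sphi h'; apply: h => // i il; apply: h'; rewrite -(perm_mem p). Qed.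

(** If the parameters are distinct and no dual vector is zero, this is [distinct_curve]. An
    item with zero dual vector takes no part in the relations: remove it, and reach it by a
    line. Two items x and y with the same parameter are replaced by the combination Q of
    their vectors that enters the relations; the line through Q and the vector of x contains
    also the vector of y, and meets the curve found for the rest at Q. Each such step uses
    one item and one unit of the degree. *)
Theorem gale_curve l : gale_relations l -> gale_spans l -> (forall i, i \in l -> i.1.2 != (0, 0)) ->
  (exists2 i, i \in l & pt i != 0) ->
  (rho.+1 < size l)%N /\ exists2 C, curve_le (size l - rho.+2) C & forall i, i \in l -> pt i != 0 -> C (pt i).
Proof.
elim: {l}(size l) {-2}l (erefl (size l)) => [|n IH] l sl rel spn nz [i0 i0l pi0].
  by case: l sl i0l {rel spn nz}.
rewrite sl.
(* The case distinctions below bring the items concerned to the head of a permuted list. *)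
have reduce l' : perm_eq l l' -> ((rho.+1 < n.+1)%N /\ exists2 C, curve_le (n.+1 - rho.+2) C &
    forall i, i \in l' -> pt i != 0 -> C (pt i)) ->
    (rho.+1 < n.+1)%N /\ exists2 C, curve_le (n.+1 - rho.+2) C & forall i, i \in l -> pt i != 0 -> C (pt i).
  by move=> p [lt [C hC CP]]; split=> //; exists C => // i il; apply: CP; rewrite -(perm_mem p).
have next (C : 'rV[k]_D -> Prop) : curve_le (n - rho.+2) C -> curve_le (n.+1 - rho.+2) C.
  by apply: curve_weaken; lia.
case: (boolP (has (fun i => lam i == 0) l)) => [/hasP [x xl /eqP lx]|].
  have pl := perm_to_rem xl; set l' := rem x l in pl.
  have sl' : size l' = n by rewrite size_rem // sl.
  have dx phi : dual phi x = 0 by rewrite /dual lx mul0r.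
  have rel' : gale_relations l'.
    by move=> phi sphi; have := gale_perm pl rel sphi; rewrite big_cons dx scale0r add0r.
  have spn' : gale_spans l'.
    move=> phi sphi h; apply: (gale_spans_perm pl spn sphi) => i; rewrite inE => /orP [/eqP -> //|/h //].
  have lt := gale_spans_size spn'; rewrite sl' in lt.
  have nz' i : i \in l' -> i.1.2 != (0, 0) by move=> /mem_rem /nz.
  apply: (reduce _ pl).
  case: (boolP (has (fun i => pt i != 0) l')) => [/hasP ex|/hasPn all0].
    have [lt' [C' hC' CP]] := IH l' sl' rel' spn' nz' ex; rewrite sl' in hC' lt'; split; first exact: leqW.
    case: (eqVneq (pt x) 0) => px.
      exists C'; first exact: next.
      by move=> i; rewrite inE => /orP [/eqP ->|/CP//]; rewrite px eqxx.
    have [C1 hC1 C1x] := point_curve px; have [C hC CC] := curve_bridge hC' hC1.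
    exists C; first by apply: curve_weaken hC; lia.
    move=> i; rewrite inE => /orP [/eqP -> _|il pi]; apply: CC; first by right.
    by left; apply: CP.
  split=> //.
  have [px|px] := eqVneq (pt x) 0.
    move: i0l; rewrite (perm_mem pl) inE => /orP [/eqP e|/all0]; last by rewrite pi0.
    by rewrite e px eqxx in pi0.
  have [C1 hC1 C1x] := point_curve px; exists C1; first by apply: curve_weaken hC1.
  by move=> i; rewrite inE => /orP [/eqP -> //|/all0]; rewrite negbK => /eqP ->; rewrite eqxx.
move=> /hasPn lam0.
case: (boolP (pairwise (fun i j => det2 i j != 0) l)) => [pw|].
  have [u12 d12] : uniq l /\ {in l &, forall a b, a != b -> det2 a b != 0}.
    apply: pairwise_symP pw => [a b|a]; first by rewrite det2_sym oppr_eq0.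
    by rewrite det2_self eqxx.
  have le := gale_spans_size spn; rewrite sl in le.
  set m := (n.+1 - rho.+1)%N.
  have s2 : size (drop m l) = rho.+1 by rewrite size_drop sl /m subKn.
  have s1 : size (take m l) = m by rewrite size_takel // sl leq_subr.
  have [||||psi spsi hpsi] := @distinct_curve (take m l) (drop m l) s2; rewrite ?cat_take_drop //.
  rewrite s1 cat_take_drop in spsi hpsi.
  (* With only rho + 1 items, the relation that vanishes at all items but one makes the
     vector of that item zero. *)
  have m0 : (0 < m)%N.
    rewrite lt0n; apply/eqP => m0; have [c c0 e] := hpsi _ i0l.
    have [|||||psi' _ h'] := @distinct_curve [::] l; rewrite ?cat0s //.
      by rewrite -s2 m0 drop0.
    have [c' c'0 e'] := h' _ i0l.
    have := rel (\prod_(b <- rem i0 l) lpoly b).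
    have sl2 : size l = rho.+1 by rewrite -s2 m0 drop0.
    have srem : size (rem i0 l) = rho by rewrite size_rem // sl2.
    rewrite -srem size_prod_lpoly => /(_ isT); rewrite (big_rem i0 i0l) /= [X in _ + X]big_seq [X in _ + X]big1 => [|b bl].
      rewrite addr0 => /eqP; rewrite scaler_eq0 (negbTE pi0) orbF /dual -srem bform_prod.
      rewrite mulf_eq0 (negbTE (lam0 _ i0l)) /= => /negPn /negP; case.
      rewrite prodf_seq_neq0; apply/allP => b bl /=; apply: d12 => //; first exact: mem_rem bl.
      by apply: contraTneq bl => <-; rewrite mem_rem_uniqF.
    by rewrite /dual -srem bform_prod (big_rem b bl) /= det2_self mul0r mulr0 scale0r.
  have em : m.-1 = (n.+1 - rho.+2)%N by rewrite /m; lia.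
  rewrite em in spsi hpsi.
  split; first by move: m0; rewrite /m subn_gt0.
  exists (rcurve (n.+1 - rho.+2) psi).
    apply: rcurve_le => //; apply: NNPP => nE; have [c c0 e] := hpsi _ i0l.
    case/eqP: pi0; rewrite e (_ : rpoint _ _ _ _ = 0) ?scaler0 //.
    apply/rowP => a; rewrite !mxE (_ : psi a = 0).
      by rewrite /bform big1 // => b _; rewrite coef0 mul0r.
    by apply/eqP; apply: contraT => pa; case: nE; exists a.
  move=> i il pi; have [c c0 e] := hpsi _ il.
  rewrite e; apply: (zclosed_scale (zclosure_closed _)) => //.
  apply: sub_zclosure; first by exists i.1.2.1, i.1.2.2.
  by apply: contraNneq pi => e0; rewrite e e0 scaler0.
move=> /not_pairwise [x [y [l' [pl]]]]; rewrite negbK => /eqP dxy.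
have xl : x \in l by rewrite (perm_mem pl) mem_head.
have yl : y \in l by rewrite (perm_mem pl) !inE eqxx orbT.
have sl' : size l' = n.-1 by have := perm_size pl; rewrite sl /= => - [->].
have n0 : (0 < n)%N by have := perm_size pl; rewrite sl /= => - [->].
have [c c0 ec] : exists2 c, c != 0 & y.1.2 = (c * x.1.2.1, c * x.1.2.2).
  have nzx : (x.1.2.1, x.1.2.2) != (0, 0) by have := nz _ xl; case: (x.1.2).
  have [c [e1 e2]] := parallel nzx dxy.
  have ey : y.1.2 = (c * x.1.2.1, c * x.1.2.2) by rewrite -e1 -e2; case: (y.1.2).
  by exists c => //; apply: contraNneq (nz _ yl) => c0; rewrite ey c0 !mul0r.
pose Q := lam x *: pt x + (lam y * c ^+ rho) *: pt y.
pose z : item := (1, x.1.2, Q).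
have dz phi : dual phi z = bform rho phi x.1.2.1 x.1.2.2 by rewrite /dual /lam /= mul1r.
have dy phi : dual phi y = lam y * c ^+ rho * dual phi z by rewrite dz /dual (dual_proportional _ ec) mulrA.
have dx phi : dual phi x = lam x * dual phi z by rewrite dz.
have rel' : gale_relations (z :: l').
  move=> phi sphi; rewrite -[RHS](gale_perm pl rel sphi) !big_cons addrA; congr (_ + _).
  by rewrite dx dy /= /pt /= /Q scalerDr !scalerA ![dual phi z * _]mulrC.
have spn' : gale_spans (z :: l').
  move=> phi sphi h; apply: (gale_spans_perm pl spn sphi) => i; rewrite !inE.
  have dz0 := h z (mem_head _ _).
  case/or3P => [/eqP ->|/eqP ->|il]; rewrite ?dx ?dy ?dz0 ?mulr0 //.
  by apply: h; rewrite inE il orbT.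
have sz : size (z :: l') = n by rewrite /= sl' prednK.
have nz' i : i \in z :: l' -> i.1.2 != (0, 0).
  rewrite inE => /orP [/eqP ->|il]; first exact: nz xl.
  by apply: nz; rewrite (perm_mem pl) !inE il !orbT.
have lt := gale_spans_size spn'; rewrite sz in lt.
have lx := lam0 _ xl; have ly := lam0 _ yl.
have lyc : lam y * c ^+ rho != 0 by rewrite mulf_neq0 // expf_neq0.
(* The vector of y is recovered from Q and that of x, as its coefficient in Q is not zero. *)
have pyE : pt y = (lam y * c ^+ rho)^-1 *: Q - ((lam y * c ^+ rho)^-1 * lam x) *: pt x.
  by rewrite /Q scalerDr !scalerA mulVf // scale1r addrC addKr.
apply: (reduce _ pl).
case: (boolP (has (fun i => pt i != 0) (z :: l'))) => [/hasP ex|/hasPn all0]; last first.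
  split=> //; have Q0 : Q = 0 by apply/eqP; have := all0 z (mem_head _ _); rewrite negbK.
  rewrite Q0 scaler0 sub0r -scaleNr in pyE.
  have px : pt x != 0.
    apply: contraNneq pi0 => px; move: i0l; rewrite (perm_mem pl) !inE => /or3P [/eqP ->|/eqP ->|il].
    - by rewrite px.
    - by rewrite pyE px scaler0.
    - by have := all0 i0; rewrite inE il orbT negbK => /(_ isT).
  have [C1 hC1 C1x] := point_curve px; exists C1; first by apply: curve_weaken hC1.
  have [zC1 _ _] := hC1.
  move=> i; rewrite !inE => /or3P [/eqP -> //|/eqP -> py|il]; last first.
    by have := all0 i; rewrite inE il orbT negbK => /(_ isT) /eqP ->; rewrite eqxx.
  rewrite pyE in py *; apply: zclosed_scale => //.
  by apply: contraNneq py => ->; rewrite scale0r.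
have [lt' [C' hC' CP]] := IH _ sz rel' spn' nz' ex; rewrite sz in hC' lt'.
split; first exact: leqW.
have [zC' _ _] := hC'.
have CP' i : i \in l' -> pt i != 0 -> C' (pt i) by move=> il; apply: CP; rewrite inE il orbT.
have CQ : Q != 0 -> C' Q by move=> Q0; apply: (CP z) => //; rewrite mem_head.
case: (eqVneq (pt x) 0) => px.
  exists C'; first exact: next.
  move=> i; rewrite !inE => /or3P [/eqP ->|/eqP -> py|/CP'//]; first by rewrite px eqxx.
  rewrite px scaler0 subr0 in pyE; rewrite pyE in py *.
  apply: zclosed_scale => //; first by rewrite invr_neq0.
  by apply: CQ; apply: contraNneq py => ->; rewrite scaler0.
case: (eqVneq Q 0) => Q0.
  have [C1 hC1 C1x] := point_curve px; have [zC1 _ _] := hC1.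
  have [C hC CC] := curve_bridge hC' hC1.
  exists C; first by apply: curve_weaken hC; lia.
  move=> i; rewrite !inE => /or3P [/eqP -> _|/eqP -> py|il pi]; apply: CC; [by right| |by left; apply: CP'].
  right; rewrite Q0 scaler0 sub0r -scaleNr in pyE; rewrite pyE in py *; apply: zclosed_scale => //.
  by apply: contraNneq py => ->; rewrite scale0r.
have [L hL LP] := line_curve Q px.
have LQ : L Q by have := LP 0 1; rewrite scale0r scale1r add0r; apply.
exists (fun v => C' v \/ L v).
  by apply: curve_weaken (curve_join hC' hL (CQ Q0) LQ); lia.
move=> i; rewrite !inE => /or3P [/eqP -> _|/eqP -> py|il pi]; [right|right|left; exact: CP'].
  by have := LP 1 0; rewrite scale0r scale1r addr0; apply.
by rewrite pyE addrC -scaleNr in py *; apply: LP.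
Qed.
End Gale.

(** * Rational normal curves *)

Section Chain.
Variables (k : closedFieldType) (n : nat).

Lemma poly_eq0 (q : {poly k}) : (forall a, q.[a] = 0) -> q = 0.
Proof.
move=> h; apply/eqP; apply: contraT => /poly_nonroot [a]; by rewrite h eqxx.
Qed.

(** The differential of F at x, applied to v. *)
Definition dir_deriv (F : {mpoly k[n]}) (x v : 'I_n -> k) : k := \sum_i F^`M(i).@[x] * v i.

Lemma chain_rule (F : {mpoly k[n]}) (p : 'I_n -> {poly k}) : exists q : {poly k},
  (forall a, q.[a] = F.@[fun i => (p i).[a]]) /\
  forall a, q^`().[a] = dir_deriv F (fun i => (p i).[a]) (fun i => (p i)^`().[a]).
Proof.
pose chain G := exists q : {poly k},
  (forall a, q.[a] = G.@[fun i => (p i).[a]]) /\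
  forall a, q^`().[a] = dir_deriv G (fun i => (p i).[a]) (fun i => (p i)^`().[a]).
have cM G H : chain G -> chain H -> chain (G * H).
  case=> q [hq dq] [q' [hq' dq']]; exists (q * q'); split=> a.
    by rewrite hornerM hq hq' mevalM.
  rewrite derivM hornerD !hornerM hq hq' dq dq' /dir_deriv mulr_suml mulr_sumr -big_split.
  by apply: eq_bigr => i _; rewrite mderivM mevalD !mevalM /=; ring.
have cD G H : chain G -> chain H -> chain (G + H).
  case=> q [hq dq] [q' [hq' dq']]; exists (q + q'); split=> a.
    by rewrite hornerD hq hq' mevalD.
  rewrite derivD hornerD dq dq' /dir_deriv -big_split.
  by apply: eq_bigr => i _; rewrite mderivD mevalD /=; ring.
have cC c : chain c%:MP.
  exists c%:P; split=> a; rewrite ?hornerC ?mevalC // derivC hornerC /dir_deriv big1 // => i _.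
  by rewrite mderivC meval0 mul0r.
have cX i : chain 'X_i.
  exists (p i); split=> a; first by rewrite mevalXU.
  rewrite /dir_deriv (bigD1 i) //= big1 => [|j ji]; rewrite mderivX mevalZ mnm1E.
    rewrite eqxx mul1r addr0 (_ : (U_(i) - U_(i) = 0)%MM) ?mpolyX0 ?meval1 ?mul1r //.
    by apply/mnmP => j; rewrite mnmBE subnn mnm0E.
  by rewrite eq_sym (negbTE ji) !mul0r.
have cXm m : chain 'X_[m].
  rewrite mpolyXE_id; apply: big_ind => [||i _]; [by rewrite -mpolyC1; apply: cC|exact: cM|].
  elim: (m i) => [|e IH]; first by rewrite expr0 -mpolyC1; apply: cC.
  by rewrite exprS; apply: cM IH; apply: cX.
apply: (@mpolyind _ _ chain) => [|c m G _ _ hG]; first by rewrite -mpolyC0; apply: cC.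
by apply: cD hG; rewrite -mul_mpolyC; apply: cM.
Qed.

(** The velocity of a polynomial path in the zeros of F is tangent to them. *)
Lemma tangent_path (F : {mpoly k[n]}) (p : 'I_n -> {poly k}) a :
  (forall b, F.@[fun i => (p i).[b]] = 0) ->
  dir_deriv F (fun i => (p i).[a]) (fun i => (p i)^`().[a]) = 0.
Proof.
move=> h; have [q [hq <-]] := chain_rule F p.
have -> : q = 0 by apply: poly_eq0 => b; rewrite hq.
by rewrite deriv0 horner0.
Qed.

Definition linmp (l : 'cV[k]_n) : {mpoly k[n]} := \sum_i l i 0 *: 'X_i.

Lemma linmp_homog l : linmp l \is 1.-homog.
Proof. by apply: rpred_sum => i _; apply: dhomogZ; rewrite dhomogX /= mdeg1. Qed.

Lemma linmpE l (x : 'rV[k]_n) : (linmp l).@[x 0] = (x *m l) 0 0.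
Proof.
rewrite /linmp (big_morph _ (mevalD _) (meval0 _)) mxE; apply: eq_bigr => i _.
by rewrite mevalZ mevalXU mulrC.
Qed.

Lemma linmp_deriv l (x v : 'rV[k]_n) : dir_deriv (linmp l) (x 0) (v 0) = (v *m l) 0 0.
Proof.
rewrite /dir_deriv mxE; apply: eq_bigr => i _; rewrite mulrC; congr (_ * _).
rewrite /linmp (big_morph _ (mderivD _) (mderiv0 _ _)) (big_morph _ (mevalD _) (meval0 _)) (bigD1 i) //= big1 => [|j ji].
  rewrite addr0 mderivZ mevalZ mderivX mevalZ mnm1E eqxx mul1r.
  rewrite (_ : (U_(i) - U_(i) = 0)%MM) ?mpolyX0 ?meval1 ?mulr1 //.
  by apply/mnmP => j; rewrite mnmBE subnn mnm0E.
by rewrite mderivZ mevalZ mderivX mevalZ mnm1E (negbTE ji) mul0r mulr0.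
Qed.

Lemma dir_derivM F G x v : dir_deriv (F * G) x v = dir_deriv F x v * G.@[x] + F.@[x] * dir_deriv G x v.
Proof.
rewrite /dir_deriv mulr_suml mulr_sumr -big_split; apply: eq_bigr => i _.
by rewrite mderivM mevalD !mevalM /=; ring.
Qed.

Lemma dir_derivB F G x v : dir_deriv (F - G) x v = dir_deriv F x v - dir_deriv G x v.
Proof.
rewrite /dir_deriv -sumrB; apply: eq_bigr => i _.
by rewrite mderivB mevalB /=; ring.
Qed.

End Chain.

Section RNC.
Variables (k : closedFieldType) (d' : nat).
Local Notation d := d'.+1.
Variable psi : 'I_d.+1 -> {poly k}.
Hypothesis spsi : forall j, (size (psi j) <= d.+1)%N.
Let C := rcurve d psi.
Hypothesis nC : ~ in_hyperplane C.

Let A : 'M[k]_d.+1 := \matrix_(l, j) (psi j)`_l.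
(** The standard rational normal curve, of which A is a change of coordinates. *)
Definition moment (s t : k) : 'rV[k]_d.+1 := \row_l (s ^+ (d - l) * t ^+ l).

Lemma rpointE s t : rpoint d psi s t = moment s t *m A.
Proof.
apply/rowP => j; rewrite !mxE; apply: eq_bigr => l _; by rewrite !mxE mulrC.
Qed.

(** A linear dependence between the rows of coefficients would be a hyperplane containing the
    curve. *)
Lemma rnc_unit : A \in unitmx.
Proof.
rewrite -unitmx_tr -row_free_unit -kermx_eq0; apply: contraT => /rowV0Pn [v /sub_kermxP vA v0].
case: nC; exists v^T; first by apply: contraNneq v0 => /(congr1 trmx); rewrite trmxK trmx0 => ->.
have Av : A *m v^T = 0 by rewrite -[A]trmxK -trmx_mul vA trmx0.
move=> x [_ hx]; apply/matrixP => a b; rewrite !ord1 [RHS]mxE.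
apply: (hx 1%N (fun x => (x *m v^T) 0 0)); first exact: isform_lin.
by move=> y [s [t ->]]; rewrite rpointE -mulmxA Av mulmx0 mxE.
Qed.

Let W := invmx A.
Let AW : A *m W = 1%:M. Proof. exact: mulmxV rnc_unit. Qed.
Let WA : W *m A = 1%:M. Proof. exact: mulVmx rnc_unit. Qed.

Lemma rpoint_inv s t : rpoint d psi s t *m W = moment s t.
Proof. by rewrite rpointE -mulmxA AW mulmx1. Qed.

Let i0 : 'I_d.+1 := ord0.
Let i1 : 'I_d.+1 := lift ord0 ord0.

Lemma moment_neq0 s t : (s, t) != (0, 0) -> moment s t != 0.
Proof.
move=> st; apply/rV0Pn; case: (eqVneq s 0) => [s0|s0].
  exists ord_max; rewrite mxE s0 subnn expr0 mul1r expf_neq0 //.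
  by move: st; rewrite s0 xpair_eqE eqxx.
by exists i0; rewrite mxE expr0 mulr1 subn0 expf_neq0.
Qed.

Lemma rpoint_neq0 s t : (s, t) != (0, 0) -> rpoint d psi s t != 0.
Proof.
move=> /moment_neq0; apply: contraNneq => e.
by rewrite -rpoint_inv e mul0mx.
Qed.

Lemma rpoint_in s t : (s, t) != (0, 0) -> C (rpoint d psi s t).
Proof. by move=> st; apply: sub_zclosure; [exists s, t|apply: rpoint_neq0]. Qed.

(** The parametrization is injective: the first two coordinates of the standard curve
    determine (s : t). *)
Lemma rpoint_det c s t s' t' : c != 0 ->
  rpoint d psi s' t' = c *: rpoint d psi s t -> s * t' = t * s'.
Proof.
move=> c0 /(congr1 (mulmx^~ W)); rewrite -scalemxAl !rpoint_inv => /rowP E.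
move: (E i0) (E i1); rewrite !mxE /= !subn0 !expr0 !mulr1 /bump /= addn0 subSS subn0 !expr1 => E0 E1.
have [s0|s0] := eqVneq s 0.
  move: E0; rewrite s0 expr0n /= mulr0 => /eqP; rewrite expf_eq0 /= => /eqP ->.
  by rewrite mul0r mulr0.
have s'0 : s' != 0.
  have : s' ^+ d'.+1 != 0 by rewrite E0 mulf_neq0 ?expf_neq0.
  by rewrite expf_eq0.
have : (s' ^+ d' * c * s ^+ d') * (s * t' - t * s') = 0.
  have -> : (s' ^+ d' * c * s ^+ d') * (s * t' - t * s') =
     (c * s ^+ d'.+1) * (s' ^+ d' * t') - (c * (s ^+ d' * t)) * s' ^+ d'.+1.
    by rewrite !exprS; ring.
  by rewrite -E0 -E1 mulrC subrr.
move/eqP; rewrite !mulf_eq0 !expf_eq0 (negbTE c0) (negbTE s0) (negbTE s'0) !andbF /=.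
by rewrite subr_eq0 => /eqP.
Qed.

(** The 2 by 2 minors of the matrix with rows y_0, ..., y_(d-1) and y_1, ..., y_d, for y the
    standard coordinates. *)
Definition quadric (i j : 'I_d) : {mpoly k[d.+1]} :=
  linmp (col (widen_ord (leqnSn _) i) W) * linmp (col (lift ord0 j) W)
  - linmp (col (lift ord0 i) W) * linmp (col (widen_ord (leqnSn _) j) W).

Lemma quadric_homog i j : quadric i j \is 2.-homog.
Proof. by apply: rpredB; apply: (dhomogM (linmp_homog _) (linmp_homog _)). Qed.

Lemma colWE (x : 'rV[k]_d.+1) i : (x *m col i W) 0 0 = (x *m W) 0 i.
Proof. by rewrite !mxE; apply: eq_bigr => j _; rewrite mxE. Qed.

Lemma quadricE i j (x : 'rV[k]_d.+1) : (quadric i j).@[x 0] =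
  (x *m W) 0 (widen_ord (leqnSn _) i) * (x *m W) 0 (lift ord0 j)
  - (x *m W) 0 (lift ord0 i) * (x *m W) 0 (widen_ord (leqnSn _) j).
Proof. by rewrite /quadric mevalB !mevalM !linmpE !colWE. Qed.

Lemma quadric_deriv i j (x v : 'rV[k]_d.+1) : dir_deriv (quadric i j) (x 0) (v 0) =
  (v *m W) 0 (widen_ord (leqnSn _) i) * (x *m W) 0 (lift ord0 j)
  + (x *m W) 0 (widen_ord (leqnSn _) i) * (v *m W) 0 (lift ord0 j)
  - ((v *m W) 0 (lift ord0 i) * (x *m W) 0 (widen_ord (leqnSn _) j)
  + (x *m W) 0 (lift ord0 i) * (v *m W) 0 (widen_ord (leqnSn _) j)).
Proof. by rewrite /quadric dir_derivB !dir_derivM !linmp_deriv !linmpE !colWE. Qed.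

Lemma quadric_vanishes i j : vanishes_on (quadric i j) C.
Proof.
move=> x [_ hx]; apply: (hx 2 (fun x => (quadric i j).@[x 0])).
  by exists (quadric i j) => //; apply: quadric_homog.
move=> y [s [t ->]]; rewrite quadricE rpoint_inv !mxE /= /bump /=.
rewrite !add1n !exprS; have := ltn_ord i; have := ltn_ord j => lj li.
have -> : (d - i = (d - i.+1).+1)%N by lia.
have -> : (d - j = (d - j.+1).+1)%N by lia.
rewrite !exprS; ring.
Qed.

(** The minors force y to be a geometric progression, or zero but for its last entry. So the
    image of the parametrization is closed. *)
Lemma rnc_points x : C x -> exists c s t, [/\ c != 0, (s, t) != (0, 0), s = 1 \/ (s, t) = (0, 1) &
   x = c *: rpoint d psi s t].
Proof.
move=> Cx; set y := x *m W.
have xy : x = y *m A by rewrite /y -mulmxA WA mulmx1.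
have y0 : y != 0.
  have := zclosed_neq0 (zclosure_closed _) Cx; apply: contraNneq => e.
  by rewrite xy e mul0mx.
have rel i j : y 0 (widen_ord (leqnSn _) i) * y 0 (lift ord0 j) = y 0 (lift ord0 i) * y 0 (widen_ord (leqnSn _) j).
  by apply/eqP; rewrite -subr_eq0 -quadricE (quadric_vanishes _ _ Cx).
clearbody y.
have yE c s t : y = c *: moment s t -> x = c *: rpoint d psi s t.
  by move=> e; rewrite xy e rpointE scalemxAl.
have w0 : widen_ord (leqnSn d) (ord0 : 'I_d) = i0 by apply: val_inj.
case: (eqVneq (y 0 i0) 0) => y00.
  have z (j : nat) : (j < d)%N -> forall lt : (j < d.+1)%N, y 0 (Ordinal lt) = 0.
    elim: j => [|j IH] jd lt; first by rewrite -[RHS]y00; congr (y 0 _); apply: val_inj.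
    have jd' : (j < d)%N by apply: ltnW.
    have := rel (Ordinal jd') (Ordinal jd).
    have -> : widen_ord (leqnSn d) (Ordinal jd') = Ordinal (leqW jd') by apply: val_inj.
    rewrite IH // mul0r => /esym/eqP; rewrite mulf_eq0.
    have -> : lift ord0 (Ordinal jd') = Ordinal lt :> 'I_d.+1 by apply: val_inj.
    have -> : widen_ord (leqnSn d) (Ordinal jd) = Ordinal lt by apply: val_inj.
    by rewrite orbb => /eqP.
  have ymax : y = y 0 ord_max *: moment 0 1.
    apply/rowP => j; rewrite !mxE expr1n mulr1 expr0n subn_eq0.
    case: (ltnP j d) => jd; first by rewrite mulr0 -[RHS](z j jd (ltn_ord j)); congr (y 0 _); apply: val_inj.
    by rewrite mulr1; congr (y 0 _); apply: val_inj => /=; apply/eqP; rewrite eqn_leq jd -ltnS ltn_ord.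
  exists (y 0 ord_max), 0, 1; split; [| |by right|exact: yE].
    by apply: contraNneq y0 => e; rewrite ymax e scale0r.
  by rewrite xpair_eqE oner_eq0 andbF.
pose tau := y 0 i1 / y 0 i0.
have z (j : nat) : forall lt : (j < d.+1)%N, y 0 (Ordinal lt) = y 0 i0 * tau ^+ j.
  elim: j => [|j IH] lt; first by rewrite expr0 mulr1; congr (y 0 _); apply: val_inj.
  have jd : (j < d)%N by [].
  have := rel ord0 (Ordinal jd); rewrite w0.
  have -> : lift ord0 (Ordinal jd) = Ordinal lt :> 'I_d.+1 by apply: val_inj.
  have -> : widen_ord (leqnSn d) (Ordinal jd) = Ordinal (leqW jd) by apply: val_inj.
  rewrite IH => e; apply: (mulfI y00); rewrite e -/i1 exprS /tau; field.
  exact: y00.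
exists (y 0 i0), 1, tau; split=> //; [by rewrite xpair_eqE oner_eq0|by left|].
apply: yE; apply/rowP => j; rewrite !mxE expr1n mul1r -(z j (ltn_ord j)).
by congr (y 0 _); apply: val_inj.
Qed.

Lemma vanishing_scale m (F : {mpoly k[d.+1]}) (c s t : k) : F \is m.-homog -> vanishes_on F C -> c != 0 -> (s, t) != (0, 0) ->
  F.@[(c *: rpoint d psi s t) 0] = 0.
Proof.
move=> hF FC c0 st; apply: FC; apply: zclosed_scale c0 (rpoint_in st); exact: zclosure_closed.
Qed.

Lemma dir_deriv_comb (F : {mpoly k[d.+1]}) x (v w : 'rV[k]_d.+1) a b :
  dir_deriv F x ((a *: v + b *: w) 0) = a * dir_deriv F x (v 0) + b * dir_deriv F x (w 0).
Proof.
rewrite /dir_deriv !mulr_sumr -big_split; apply: eq_bigr => i _ /=.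
by rewrite !mxE; ring.
Qed.

Lemma dir_deriv_ext n (F : {mpoly k[n]}) x x' v v' : x =1 x' -> v =1 v' -> dir_deriv F x v = dir_deriv F x' v'.
Proof. by move=> ex ev; apply: eq_bigr => i _; rewrite ev (meval_eq _ ex). Qed.

Lemma dir_deriv_self m (F : {mpoly k[d.+1]}) (x : 'rV[k]_d.+1) : F \is m.-homog -> F.@[x 0] = 0 -> dir_deriv F (x 0) (x 0) = 0.
Proof.
move=> hF Fx; pose p i : {poly k} := (x 0 i) *: ('X + 1).
rewrite -[RHS](@tangent_path k _ F p 0) => [|b].
  by apply: dir_deriv_ext => i; rewrite /p ?derivZ ?derivD ?derivX ?derivC !hornerE // -?polyC1 ?derivC ?hornerC ?addr0 ?mulr1.
have -> : F.@[fun i => (p i).[b]] = F.@[((1 + b) *: x) 0].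
  by apply: meval_eq => i; rewrite mxE /p !hornerE addrC mulrC.
have hf : isform m (fun x : 'rV_d.+1 => F.@[x 0]) by exists F.
by rewrite (isform_scale _ _ hf) Fx mulr0.
Qed.

Lemma deriv_moment (q : {poly k}) t : (size q <= d.+1)%N -> q^`().[t] = \sum_(l < d.+1) q`_l * (t ^+ l.-1 *+ l).
Proof.
move=> sq; have sq' : (size q^`() <= d)%N.
  by case: (eqVneq q 0) => [->|q0]; [rewrite deriv0 size_poly0|have := lt_size_deriv q0; lia].
rewrite (horner_coef_wide _ sq') [RHS]big_ord_recl /= mulr0n mulr0 add0r; apply: eq_bigr => l _.
by rewrite coef_deriv /bump /= add1n /= mulrnAl mulrnAr.
Qed.

(** It is enough that two independent directions a and b are tangent, and that the
    differentials of the quadrics leave no other. *)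
Lemma rnc_tangent (x a b : 'rV[k]_d.+1) :
  a != 0 -> (forall e, b != e *: a) ->
  (forall m (F : {mpoly k[d.+1]}), F \is m.-homog -> vanishes_on F C ->
     dir_deriv F (x 0) (a 0) = 0 /\ dir_deriv F (x 0) (b 0) = 0) ->
  (forall v : 'rV[k]_d.+1, (forall i j, dir_deriv (quadric i j) (x 0) (v 0) = 0) ->
      exists e f, v = e *: a + f *: b) ->
  exists2 U : {vspace 'rV[k]_d.+1}, \dim U = 2%N &
    forall v : 'rV[k]_d.+1, v \in U <->
      forall (m : nat) (F : {mpoly k[d.+1]}), F \is m.-homog -> vanishes_on F C ->
        \sum_(i < d.+1) (F^`M(i)).@[x 0] * v 0 i = 0.
Proof.
move=> a0 nb hD hQ; exists <<[:: b; a]>>%VS.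
  have /eqP -> // : free [:: b; a].
  rewrite free_cons seq1_free a0 andbT span_seq1; apply/negP => /vlineP [e eb].
  by have := nb e; rewrite eb eqxx.
move=> v; rewrite span_cons span_seq1; split.
  move=> /memv_addP [_ /vlineP [f ->] [_ /vlineP [e ->] ->]] m F hF FC.
  have [Da Db] := hD m F hF FC.
  by have := dir_deriv_comb F (x 0) b a f e; rewrite Da Db !mulr0 addr0.
move=> h; have [|e [f ->]] := hQ v.
  by move=> i j; apply: (h 2 _ (quadric_homog i j) (@quadric_vanishes i j)).
by rewrite addrC; apply: memv_add; apply: memvZ; apply: memv_line.
Qed.

Lemma mulWA (v : 'rV[k]_d.+1) : v = v *m W *m A.
Proof. by rewrite -mulmxA WA mulmx1. Qed.

Lemma mulA_inj (u v : 'rV[k]_d.+1) : u *m A = v *m A -> u = v.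
Proof. by move=> e; rewrite -[u]mulmx1 -[v]mulmx1 -AW !mulmxA e. Qed.

(** At the parameter (1 : t), the tangent directions are the point and the derivative of the
    parametrization; at (0 : 1), the point and the last but one unit vector. The
    differentials of the minors give a recursion for the coordinates of a tangent vector,
    which leaves no other direction in any characteristic. *)
Lemma rnc_smooth : smooth1 C.
Proof.
move=> x Cx; have [c [s [t [c0 st [s1|[s0 t1]] ex]]]] := rnc_points Cx.
  subst s; pose b : 'rV[k]_d.+1 := \row_l (t ^+ l.-1 *+ l).
  have aE l : moment 1 t 0 l = t ^+ l by rewrite mxE expr1n mul1r.
  apply: (@rnc_tangent x (moment 1 t *m A) (b *m A)).
  - by rewrite -rpointE rpoint_neq0.
  - move=> e; apply/eqP; rewrite scalemxAl => /mulA_inj eb.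
    have /rowP /(_ i1) := eb; have /rowP /(_ i0) := eb.
    rewrite !mxE /= mulr0n !expr0 !expr1n !mul1r mulr1 => <-.
    by rewrite mul0r mulr1n => /eqP; rewrite oner_eq0.
  - move=> m F hF FC; split.
      have := dir_deriv_self hF (FC x Cx); rewrite {2}ex rpointE.
      have -> : c *: (moment 1 t *m A) = c *: (moment 1 t *m A) + 0 *: (b *m A) by rewrite scale0r addr0.
      by rewrite dir_deriv_comb mul0r addr0 => /eqP; rewrite mulf_eq0 (negbTE c0) => /eqP.
    have h := @tangent_path k _ F (fun i => c *: psi i) t.
    have : c * dir_deriv F (x 0) ((b *m A) 0) + 0 * dir_deriv F (x 0) ((b *m A) 0) = 0.
      rewrite -dir_deriv_comb -[RHS]h => [|u].
        apply: dir_deriv_ext => i; rewrite ?ex ?scale0r ?addr0 ?derivZ ?hornerZ !mxE.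
          by rewrite bform_horner.
        rewrite deriv_moment //; congr (_ * _); apply: eq_bigr => l _; by rewrite !mxE mulrC.
      have -> : F.@[fun i => (c *: psi i).[u]] = F.@[(c *: rpoint d psi 1 u) 0].
        by apply: meval_eq => i; rewrite !mxE hornerZ bform_horner.
      by rewrite (vanishing_scale hF FC c0) // xpair_eqE oner_eq0.
    by rewrite mul0r addr0 => /eqP; rewrite mulf_eq0 (negbTE c0) => /eqP.
  move=> v hv; pose u := v *m W.
  have xWE l : (x *m W) 0 l = c * t ^+ l by rewrite ex -scalemxAl rpoint_inv mxE aE.
  have z (j : nat) : forall lt : (j < d.+1)%N,
      u 0 (Ordinal lt) = u 0 i0 * t ^+ j + (u 0 i1 - t * u 0 i0) * (t ^+ j.-1 *+ j).
    elim: j => [|j IH] lt.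
      by rewrite mulr0n mulr0 addr0 expr0 mulr1; congr (u 0 _); apply: val_inj.
    have jd : (j < d)%N by [].
    have := hv ord0 (Ordinal jd); rewrite quadric_deriv !xWE -/u.
    have -> : lift ord0 (Ordinal jd) = Ordinal lt :> 'I_d.+1 by apply: val_inj.
    have -> : widen_ord (leqnSn d) (Ordinal jd) = Ordinal (leqW jd) by apply: val_inj.
    have -> : widen_ord (leqnSn d) (ord0 : 'I_d) = i0 by apply: val_inj.
    rewrite IH -/i1 /= expr0 expr1 mulr1 => /eqP e.
    move: (u 0 (Ordinal lt)) e => U e.
    have {e} : c * (U - (u 0 i0 * t ^+ j.+1 + (u 0 i1 - t * u 0 i0) * (t ^+ j *+ j.+1))) = 0.
      rewrite -[RHS](eqP e); case: (j) => [|j'] /=; first by rewrite mulr0n mulr1n expr1 !expr0; ring.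
      rewrite [t ^+ j'.+1 *+ j'.+2]mulrS [t ^+ j'.+2]exprS [t ^+ j'.+1]exprS -mulrnAr.
      by move: (t ^+ j' *+ j'.+1) (t ^+ j') => B E; ring.
    by move/eqP; rewrite mulf_eq0 (negbTE c0) subr_eq0 => /eqP.
  exists (u 0 i0), (u 0 i1 - t * u 0 i0).
  rewrite (mulWA v) -/u !scalemxAl -mulmxDl; congr (_ *m A); apply/rowP => j.
  have -> : (u 0 i0 *: moment 1 t + (u 0 i1 - t * u 0 i0) *: b) 0 j =
      u 0 i0 * moment 1 t 0 j + (u 0 i1 - t * u 0 i0) * b 0 j by rewrite !mxE.
  rewrite aE [b _ _]mxE -(z j (ltn_ord j)).
  by congr (u 0 _); apply: val_inj.
subst s t; pose im : 'I_d.+1 := widen_ord (leqnSn _) ord_max.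
have mE : moment 0 1 = delta_mx 0 ord_max.
  apply/rowP => l; rewrite !mxE eqxx /= expr1n mulr1 expr0n subn_eq0; congr (_%:R).
  by rewrite -val_eqE /= eqn_leq (leq_ord l).
apply: (@rnc_tangent x (moment 0 1 *m A) ((delta_mx 0 im : 'rV[k]_d.+1) *m A)).
- by rewrite -rpointE rpoint_neq0 // xpair_eqE oner_eq0 andbF.
- move=> e; apply/eqP; rewrite scalemxAl => /mulA_inj; rewrite mE => /rowP /(_ im).
  rewrite !mxE !eqxx /= -val_eqE /= (ltn_eqF (ltnSn _)) mulr0 => /eqP; by rewrite oner_eq0.
- move=> m F hF FC; split.
    have := dir_deriv_self hF (FC x Cx); rewrite {2}ex rpointE.
    have -> : c *: (moment 0 1 *m A) = c *: (moment 0 1 *m A) + 0 *: (moment 0 1 *m A) by rewrite scale0r addr0.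
    by rewrite dir_deriv_comb mul0r addr0 => /eqP; rewrite mulf_eq0 (negbTE c0) => /eqP.
  pose p i : {poly k} := c *: \sum_(l < d.+1) (psi i)`_l *: 'X^(d - l).
  have pE i u : (p i).[u] = (c *: rpoint d psi u 1) 0 i.
    rewrite !mxE hornerZ horner_sum; congr (_ * _); apply: eq_bigr => l _.
    by rewrite hornerZ hornerXn expr1n mulr1.
  have h := @tangent_path k _ F p 0.
  have : c * dir_deriv F (x 0) (((delta_mx 0 im : 'rV[k]_d.+1) *m A) 0) + 0 * dir_deriv F (x 0) (((delta_mx 0 im : 'rV[k]_d.+1) *m A) 0) = 0.
    rewrite -dir_deriv_comb -[RHS]h => [|u].
      apply: dir_deriv_ext => i; first by rewrite pE ex.
      rewrite scale0r addr0 derivZ hornerZ -rowE !mxE; congr (_ * _).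
      rewrite (big_morph _ (@derivD _) (@deriv0 _)) horner_sum (bigD1 im) //= big1 ?addr0 => [|l nl]; rewrite derivZ hornerZ derivXn.
        by rewrite subSnn /= mulr1n hornerXn expr0 mulr1.
      rewrite hornerMn hornerXn; case: (ltnP l d) => ld; last first.
        have -> : (d - l = 0)%N by lia.
        by rewrite mulr0n mulr0.
      have : (l : nat) != d' by move: nl; rewrite -val_eqE.
      case e: (d - l)%N => [|[|r]]; [by lia|by lia|].
      by rewrite /= exprS mul0r mul0rn mulr0.
    have -> : F.@[fun i => (p i).[u]] = F.@[(c *: rpoint d psi u 1) 0].
      by apply: meval_eq => i; rewrite pE.
    by rewrite (vanishing_scale hF FC c0) // xpair_eqE oner_eq0 andbF.
  by rewrite mul0r addr0 => /eqP; rewrite mulf_eq0 (negbTE c0) => /eqP.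
move=> v hv; pose u := v *m W.
have xWE l : (x *m W) 0 l = c * (l == ord_max)%:R by rewrite ex -scalemxAl rpoint_inv mE !mxE eqxx.
have z (j : 'I_d.+1) : j != ord_max -> j != im -> u 0 j = 0.
  rewrite -!val_eqE /= => jd jd1; have lt : (j < d)%N by have := ltn_ord j; move: jd; lia.
  have := hv (Ordinal lt) ord_max; rewrite quadric_deriv !xWE -/u.
  have -> : lift ord0 (ord_max : 'I_d) = ord_max :> 'I_d.+1 by apply: val_inj.
  have -> : widen_ord (leqnSn d) (Ordinal lt) = j by apply: val_inj.
  have nj : (j == ord_max) = false by apply: negbTE; rewrite -val_eqE.
  have nm : (im == ord_max) = false by rewrite -val_eqE /= (ltn_eqF (ltnSn _)).
  have nl : (lift ord0 (Ordinal lt) == ord_max :> 'I_d.+1) = false.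
    by rewrite -val_eqE /= /bump /= add1n eqSS (negbTE jd1).
  rewrite -/im !eqxx nj nm nl /= !mulr0 !mul0r !addr0 subr0 mulr1.
  by move/eqP; rewrite mulf_eq0 (negbTE c0) orbF => /eqP.
exists (u 0 ord_max), (u 0 im).
rewrite (mulWA v) -/u mE !scalemxAl -mulmxDl; congr (_ *m A); apply/rowP => j.
have -> : (u 0 ord_max *: (delta_mx 0 ord_max : 'rV[k]_d.+1) + u 0 im *: (delta_mx 0 im : 'rV[k]_d.+1)) 0 j =
   u 0 ord_max * (j == ord_max)%:R + u 0 im * (j == im)%:R by rewrite !mxE !eqxx.
case: (eqVneq j ord_max) => [->|jm].
  by rewrite mulr1 eq_sym -val_eqE /= (ltn_eqF (ltnSn _)) mulr0 addr0.
case: (eqVneq j im) => [->|ji]; first by rewrite mulr0 mulr1 add0r.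
by rewrite !mulr0 addr0 z.
Qed.

(** The inverse of the parametrization is (y_0 : y_1). *)
Lemma rnc_rational : rational C.
Proof.
pose j0 : 'I_2 := ord0; pose j1 : 'I_2 := ord_max.
pose f (j : 'I_d.+1) : {mpoly k[2]} := \sum_(l < d.+1) A l j *: ('X_j0 ^+ (d - l) * 'X_j1 ^+ l).
pose g (j : 'I_2) : {mpoly k[d.+1]} := linmp (col (if j == j0 then i0 else i1) W).
have fE sg : rmap f sg = rpoint d psi (sg 0 j0) (sg 0 j1).
  apply/rowP => j; rewrite !mxE (big_morph _ (mevalD _) (meval0 _)); apply: eq_bigr => l _.
  by rewrite mevalZ mevalM !rmorphXn /= !mevalXU mxE.
have gE x : rmap g x = \row_j (x *m W) 0 (if j == j0 then i0 else i1).
  apply/rowP => j; rewrite [LHS]mxE linmpE [RHS]mxE; apply: colWE.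
have sgE (sg : 'rV[k]_2) : sg != 0 -> (sg 0 j0, sg 0 j1) != (0, 0).
  move=> sg0; apply/eqP => -[s0 s1]; case/eqP: sg0; apply/rowP => -[[|[|//]] lt]; rewrite mxE; [rewrite -[RHS]s0|rewrite -[RHS]s1]; congr (sg 0 _); exact: val_inj.
have gr s t c : rmap g (c *: rpoint d psi s t) = (c * s ^+ d') *: \row_j (if j == j0 then s else t).
  rewrite gE -scalemxAl rpoint_inv; apply/rowP => j; rewrite !mxE.
  case: ifP => _ /=; first by rewrite subn0 exprSr expr0 mulr1 mulrA.
  by rewrite /bump /= subSS subn0 expr1 mulrA.
have rowE (sg : 'rV[k]_2) : \row_j (if j == j0 then sg 0 j0 else sg 0 j1) = sg.
  apply/rowP => j; rewrite mxE; case: j => [[|[|//]] lt] /=; congr (sg 0 _); exact: val_inj.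
pose e0 : 'rV[k]_2 := \row_j (if j == j0 then 1 else 0).
have e00 : e0 0 j0 = 1 by rewrite mxE.
have e01 : e0 0 j1 = 0 by rewrite mxE.
have ge0 : rmap g (rpoint d psi 1 0) = e0.
  by have := gr 1 0 1; rewrite scale1r expr1n mulr1 scale1r.
have e0n : e0 != 0 by apply/rV0Pn; exists j0; rewrite e00 oner_neq0.
have st10 : (1, 0) != (0, 0) :> k * k by rewrite xpair_eqE oner_eq0.
exists f, g; split.
- exists d => j; apply: rpred_sum => l _; apply: dhomogZ.
  suff: ('X_j0 ^+ (d - l) * 'X_j1 ^+ l : {mpoly k[2]}) \is (1 * (d - l) + 1 * l).-homog for mdeg by rewrite !mul1n subnK // -ltnS.
  by apply: dhomogM; apply: dhomogMn; rewrite dhomogX /= mdeg1.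
- by exists 1%N => j; apply: linmp_homog.
- split=> [sg sg0 _|| sg sg0 fs].
  + by rewrite fE; apply: rpoint_in; apply: sgE.
  + by exists e0; rewrite fE e00 e01 ge0; split=> //; apply: rpoint_neq0.
  rewrite fE; have := gr (sg 0 j0) (sg 0 j1) 1; rewrite scale1r mul1r rowE => -> gs.
  exists (sg 0 j0 ^+ d') => //; by apply: contraNneq gs => ->; rewrite scale0r.
split=> [x Cx //|| x Cx gx fx].
  exists (rpoint d psi 1 0); rewrite ge0; split=> //; first exact: rpoint_in.
  by rewrite fE e00 e01; apply: rpoint_neq0.
have [c [s [t [c0 st _ ex]]]] := rnc_points Cx.
move: gx fx; rewrite ex gr => gx.
have cs : c * s ^+ d' != 0 by apply: contraNneq gx => ->; rewrite scale0r.
set w := (c * s ^+ d') *: _.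
have w0 : w 0 j0 = c * s ^+ d' * s by rewrite !mxE.
have w1 : w 0 j1 = c * s ^+ d' * t by rewrite !mxE.
rewrite fE w0 w1 => _ {w w0 w1}.
exists ((c * s ^+ d') ^+ d / c); first by rewrite mulf_neq0 ?invr_neq0 ?expf_neq0.
rewrite scalerA divfK //; move: (c * s ^+ d') => K; apply/rowP => j.
rewrite !mxE /bform mulr_sumr; apply: eq_bigr => l _; rewrite !exprMn.
have -> : K ^+ d = K ^+ (d - l) * K ^+ l by rewrite -exprD subnK // -ltnS.
by ring.
Qed.

Theorem rcurve_rational_normal : rational_normal_curve C.
Proof.
have [j pj] : exists j, psi j != 0.
  apply: NNPP => nE; have st : (1, 0) != (0, 0) :> k * k by rewrite xpair_eqE oner_eq0.
  have /eqP := rpoint_neq0 st; apply; apply/rowP => j; rewrite !mxE.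
  have -> : psi j = 0 by apply/eqP; apply: contraT => pj; case: nE; exists j.
  by rewrite /bform big1 // => l _; rewrite coef0 mul0r.
have irr : irreducible_set C by apply: rcurve_irreducible => //; exists j.
have zC : zclosed C by apply: zclosure_closed.
split=> //; [|exact: rnc_smooth|exact: rnc_rational].
apply: curve_dim1 => //; first exact: irreducible_connected.
exact: rcurve_hle.
Qed.
End RNC.

(** * The conic through the Gale dual *)

Section Configurations.
Variables (k : closedFieldType) (D : nat).
Implicit Types (B : 'M[k]_D) (G : 'M[k]_(3, D)) (w g : 'I_3 -> k).

(** The points of a basis B and three more points, given by their coordinates in B up to
    sign; G is the Gale dual of B, and that of the three other points are the unit
    vectors. *)
Definition conf B G : 'M[k]_(D + 3, D) := col_mx B (- G *m B).
Definition gale G : 'M[k]_(3, D + 3) := row_mx G 1%:M.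

Lemma gale_conf B G : gale G *m conf B G = 0.
Proof. by rewrite mul_row_col mul1mx mulNmx subrr. Qed.

Lemma gale_relation B G (c : 'rV[k]_3) :
  \sum_s (c *m gale G) 0 s *: row s (conf B G) = 0.
Proof. by rewrite -mulmx_sum_row -mulmxA gale_conf mulmx0. Qed.

(** As B is a basis, a relation is determined by its last three coefficients. *)
Lemma relation_gale B G (u : 'rV[k]_(D + 3)) : B \in unitmx ->
  \sum_s u 0 s *: row s (conf B G) = 0 -> u = rsubmx u *m gale G.
Proof.
move=> uB; rewrite -mulmx_sum_row -{1}[u]hsubmxK mul_row_col mulNmx mulmxN mulmxA => /eqP.
rewrite -mulmxBl => /eqP /(congr1 (mulmx^~ (invmx B))); rewrite mulmxK // mul0mx => /eqP.
rewrite subr_eq0 => /eqP e.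
by rewrite mul_mx_row mulmx1 -e hsubmxK.
Qed.

(** The monomials yz, xz, xy of the conics through the three unit points, written as products
    over the other indices so that the symmetry under permutations of the coordinates is
    visible. *)
Definition coprod g (m : 'I_3) := \prod_(m' | m' != m) g m'.
Definition conic w g := \sum_m w m * coprod g m.
Definition on_conic w G := forall j, conic w (fun m => G m j) = 0.

Lemma ord3E (m : 'I_3) : [\/ m = 0, m = 1 | m = 2%:R].
Proof.
by case: m => -[|[|[|//]]] lt; [constructor 1|constructor 2|constructor 3]; apply: val_inj.
Qed.

Lemma coprodE g : (coprod g 0 = g 1 * g 2%:R) * (coprod g 1 = g 0 * g 2%:R) * (coprod g 2%:R = g 0 * g 1).
Proof.
have e1 : lift ord0 ord0 = 1 :> 'I_3 by apply: val_inj.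
have e2 : lift ord0 (lift ord0 ord0) = 2%:R :> 'I_3 by apply: val_inj.
have pE m : coprod g m =
    (if m != 0 then g 0 else 1) * ((if m != 1 then g 1 else 1) * (if m != 2%:R then g 2%:R else 1)).
  by rewrite /coprod big_mkcond !big_ord_recl big_ord0 /= e1 e2 mulr1 ![_ == m]eq_sym.
by rewrite !pE /= !mul1r !mulr1.
Qed.

Lemma sum3E (f : 'I_3 -> k) : \sum_m f m = f 0 + f 1 + f 2%:R.
Proof.
rewrite !big_ord_recl big_ord0 addr0 addrA.
by congr (f _ + f _ + f _); apply: val_inj.
Qed.

Lemma conicE w g : conic w g = w 0 * (g 1 * g 2%:R) + w 1 * (g 0 * g 2%:R) + w 2%:R * (g 0 * g 1).
Proof. by rewrite /conic sum3E !coprodE. Qed.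

Lemma gale_conic w G s : on_conic w G -> conic w (fun m => gale G m s) = 0.
Proof.
move=> wG; case: (split_ordP s) => j ->.
  by rewrite -[RHS](wG j) !conicE !row_mxEl.
rewrite conicE !row_mxEr ![1%:M _ _]mxE.
by case: (ord3E j) => -> /=; rewrite ?mulr0n ?mulr0 ?mul0r ?mulr0 ?addr0.
Qed.

(** A spanning set contains a basis, and three points remain. *)
Lemma configuration n (P : 'I_n -> 'rV[k]_D) : n = (D + 3)%N ->
  ~ in_hyperplane (fun x => exists i, x = P i) ->
  exists B G (e : 'I_(D + 3) -> 'I_n),
    [/\ B \in unitmx, injective e & forall s, P (e s) = row s (conf B G)].
Proof.
move=> en nH; have [B rB uB] := spanning_points nH.
have [f fE] := fin_all_exists rB.
have fi : injective f.
  move=> i j eij; have : row i B = row j B by rewrite !fE eij.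
  rewrite !rowE => /(congr1 (mulmx^~ (invmx B))); rewrite !mulmxK // => /rowP /(_ i).
  by rewrite !mxE !eqxx; case: eqP => // _ /eqP; rewrite oner_eq0.
pose T := ~: [set f i | i in 'I_D].
have cT : #|T| = 3%N.
  by have := cardsC [set f i | i in 'I_D]; rewrite card_imset // !card_ord -/T; lia.
pose h (m : 'I_3) := enum_val (cast_ord (esym cT) m).
have hT m : h m \in T by apply: enum_valP.
pose e (s : 'I_(D + 3)) := match split s with inl j => f j | inr m => h m end.
have el j : e (lshift 3 j) = f j by rewrite /e (unsplitK (inl j)).
have er m : e (rshift D m) = h m by rewrite /e (unsplitK (inr m)).
exists B, (\matrix_m (- (P (h m) *m invmx B))), e; split=> // [s t|s].
  case: (split_ordP s) => [i|m] ->; case: (split_ordP t) => [j|l] ->; rewrite ?el ?er.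
  - by move=> /fi ->.
  - by move=> E; have := hT l; rewrite -E inE imset_f.
  - by move=> E; have := hT m; rewrite E inE imset_f.
  - by move=> /enum_val_inj /cast_ord_inj ->.
case: (split_ordP s) => [i|m] ->; rewrite ?el ?er /conf.
  by rewrite rowKu.
by rewrite rowKd mulNmx raddfN /= row_mul rowK mulNmx opprK -mulmxA mulVmx // mulmx1.
Qed.
End Configurations.

Section GrassmannCayleyConic.
Variables (k : closedFieldType) (r : nat).
Local Notation D := (3 + r)%N.

Definition gc_condition n (P : 'I_n -> 'rV[k]_D) : Prop :=
  forall (I : {set 'I_n}) (i1 i2 i3 i4 i5 i6 : 'I_n),
    I = [set i1; i2; i3; i4; i5; i6] ->
    (i1 < i2)%N -> (i2 < i3)%N -> (i3 < i4)%N -> (i4 < i5)%N -> (i5 < i6)%N ->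
    let J := [seq P j | j <- enum (~: I)] in
    join (join (join
      (meet [:: P i1; P i2] (P i4 :: P i5 :: J))
      (meet [:: P i2; P i3] (P i5 :: P i6 :: J)))
      (meet [:: P i3; P i4] (P i6 :: P i1 :: J)))
      (extensor J) = 0.

(** By [gc_pascal] and the theorem of Pascal, with the elements of I in increasing order. *)
Lemma conic_through n (P : 'I_n -> 'rV[k]_D) (I : {set 'I_n}) (M : 'M[k]_(D, 3)) :
  gc_condition P -> n = (D + 3)%N -> #|I| = 6%N -> \rank M = 3%N ->
  (forall j, j \notin I -> P j *m M = 0) ->
  row_free (\matrix_(i < r) [seq P j | j <- enum (~: I)]`_i) ->
  exists2 c : 'cV[k]_6, c != 0 & forall i, i \in I -> veronese (P i *m M) *m c = 0.
Proof.
move=> gcP en cI rM IM fJ.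
have sI : size (enum I) = 6%N by rewrite -cardE.
have sJ : size [seq P j | j <- enum (~: I)] = r.
  rewrite size_map -cardE; have := cardsC I; rewrite card_ord cI => cC; apply: (@addnI 6); rewrite cC [LHS]en; lia.
have soI : sorted ltn [seq val i | i <- enum I].
  rewrite (@subseq_sorted _ ltn ltn_trans _ [seq val i | i <- enum 'I_n]) //.
    by rewrite enumT /enum_mem; apply: map_subseq; apply: filter_subseq.
  by rewrite val_enum_ord iota_ltn_sorted.
have IE : I = [set i in enum I] by apply/setP => i; rewrite inE mem_enum.
case eI: (enum I) sI soI IE => [|i1 [|i2 [|i3 [|i4 [|i5 [|i6 [|//]]]]]]] //= _.
move=> /and5P [l1 l2 l3 l4 /andP [l5 _]] IE.
have JM : \matrix_(i < r) [seq P j | j <- enum (~: I)]`_i *m M = 0.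
  apply/row_matrixP => a; rewrite row_mul rowK row0.
  have /mapP [j jI ->] : [seq P j | j <- enum (~: I)]`_a \in [seq P j | j <- enum (~: I)].
    by rewrite mem_nth // sJ.
  by apply: IM; move: jI; rewrite mem_enum inE.
have E0 := gcP I i1 i2 i3 i4 i5 i6 _ l1 l2 l3 l4 l5.
have [|c c0 hc] := (pascal0P _ _ _ _ _ _).1 ((gc_pascal sJ _ _ _ _ _ _ fJ JM rM).1 (E0 _)).
  by rewrite IE; apply/setP => i; rewrite !inE !orbA.
exists c => // i; rewrite IE inE => iI; apply: hc.
exact: (map_f (fun i => P i *m M) iI).
Qed.

Lemma det3mxE (A : 'M[k]_3) : \det A = d3 (A 0 0) (A 0 1) (A 0 2%:R)
  (A 1 0) (A 1 1) (A 1 2%:R) (A 2%:R 0) (A 2%:R 1) (A 2%:R 2%:R).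
Proof.
have -> : A = \matrix_(i < 3, j < 3) A (inord i) (inord j).
  by apply/matrixP => i j; rewrite mxE !inord_val.
rewrite (ndetE 3 (fun i j => A (inord i) (inord j))) !mxE !inord_val /=.
have -> : inord 0 = 0 :> 'I_3 by apply: val_inj; rewrite /= inordK.
have -> : inord 1 = 1 :> 'I_3 by apply: val_inj; rewrite /= inordK.
have -> : inord 2 = 2%:R :> 'I_3 by apply: val_inj; rewrite /= inordK.
by rewrite /d3; ring.
Qed.

Lemma det_right_kernel h (A : 'M[k]_h) (c : 'cV_h) : c != 0 -> A *m c = 0 -> \det A = 0.
Proof.
move=> c0 Ac; apply/eqP; rewrite -det_tr; apply/det0P; exists c^T; first by rewrite trmx_eq0.
by rewrite -trmx_mul Ac trmx0.
Qed.

Section Triple.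
Variables (n : nat) (P : 'I_n -> 'rV[k]_D) (B : 'M[k]_D) (G : 'M[k]_(3, D)) (e : 'I_(D + 3) -> 'I_n).
Hypotheses (gcP : gc_condition P) (en : n = (D + 3)%N) (uB : B \in unitmx) (ie : injective e).
Hypothesis Pe : forall s, P (e s) = row s (conf B G).

(** Take I to be the three points off the basis together with three points of the basis, with
    indices h0, h1, h2. The projection from the other points of the basis keeps the
    coordinates with these indices: three of the six points of the plane are the unit points,
    the others are, up to sign, the rows of G in the columns h0, h1, h2. A conic through the
    former is a combination of the three products of two coordinates, so the matrix of the
    products in the rows of G is singular; and its determinant is equal, as a polynomial, to
    that of the products in the columns. *)
Lemma triple_singular (h : 'I_3 -> 'I_D) : injective h ->
  \det (\matrix_(b, m) coprod (fun m => G m (h b)) m) = 0.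
Proof.
move=> ih; pose S : 'M[k]_(D, 3) := \matrix_(a, b) (a == h b)%:R.
have SS : S^T *m S = 1%:M.
  apply/matrixP => b b'; rewrite !mxE (bigD1 (h b)) //= big1 => [|a ab]; rewrite !mxE.
    by rewrite eqxx mul1r addr0 (inj_eq ih).
  by rewrite (negbTE ab) mul0r.
pose M := invmx B *m S.
have cM : conf B G *m M = col_mx S (- G *m S).
  by rewrite mul_col_mx -!mulmxA !mulKVmx.
have rM : \rank M = 3%N.
  apply/eqP; rewrite eqn_leq rank_leq_col /=; have := mxrankM_maxr (S^T *m B) M.
  by rewrite -mulmxA mulKVmx // SS mxrank1.
pose I := [set e (lshift 3 (h b)) | b in 'I_3] :|: [set e (rshift D m) | m in 'I_3].
have cI : #|I| = 6%N.
  rewrite cardsU !card_imset ?card_ord; [|by move=> a b /ie /rshift_inj|by move=> a b /ie /lshift_inj /ih].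
  rewrite (_ : _ :&: _ = set0) ?cards0 //; apply/setP => i; rewrite !inE; apply/negP => /andP [].
  by case/imsetP => b _ -> /imsetP [m _] /ie /eqP; rewrite eq_lrshift.
have IE j : j \notin I -> exists2 a, j = e (lshift 3 a) & forall b, a != h b.
  have [e' _ eK] : bijective e by apply: inj_card_bij => //; rewrite !card_ord en.
  rewrite -(eK j); case: (split_ordP (e' j)) => a -> nI; last first.
    by case/negP: nI; rewrite inE orbC imset_f.
  exists a => // b; apply: contra nI => /eqP ->; by rewrite inE imset_f.
have PM a : P (e (lshift 3 a)) *m M = row a S.
  by rewrite Pe -row_mul cM rowKu.
have sI : size (enum (~: I)) = r.
  rewrite -cardE; have := cardsC I; rewrite card_ord cI => cC; apply: (@addnI 6); rewrite cC [LHS]en; lia.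
have [j nj||c c0 hc] := conic_through gcP en cI rM.
- by have [a -> ha] := IE j nj; rewrite PM; apply/rowP => b; rewrite !mxE (negbTE (ha b)).
- pose x0 := e (lshift 3 0).
  have E (i : 'I_r) : exists a, nth x0 (enum (~: I)) i = e (lshift 3 a).
    have : nth x0 (enum (~: I)) i \in enum (~: I) by rewrite mem_nth ?sI.
    by rewrite mem_enum inE => /IE [a -> _]; exists a.
  have [f fE] := fin_all_exists E.
  have fi : injective f.
    move=> i j ij; apply/val_inj/eqP; rewrite -(nth_uniq x0 _ _ (enum_uniq (~: I))) ?sI //=.
    by rewrite !fE ij.
  apply/row_freeP; exists (invmx B *m (\matrix_(a, i) (a == f i)%:R)).
  have -> : \matrix_(i < r) [seq P j | j <- enum (~: I)]`_i = (\matrix_(i, a) (a == f i)%:R) *m B.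
    apply/row_matrixP => i; rewrite rowK (nth_map x0) ?sI // fE Pe rowKu row_mul [LHS]rowE; congr (_ *m _).
    by apply/rowP => a; rewrite !mxE eqxx.
  rewrite -mulmxA mulKVmx //; apply/matrixP => i j; rewrite !mxE (bigD1 (f i)) //= big1 => [|a ai]; rewrite !mxE.
    by rewrite eqxx mul1r addr0 (inj_eq fi).
  by rewrite (negbTE ai) mul0r.
have z0 b : veronese (row (h b) S) *m c = 0.
  by rewrite -PM; apply: hc; rewrite inE imset_f.
have zm m : veronese (- row m G *m S) *m c = 0.
  have := hc (e (rshift D m)); rewrite Pe -row_mul cM rowKd mulNmx raddfN /= row_mul -mulNmx; apply.
  by rewrite inE orbC imset_f.
pose c' : 'cV[k]_3 := \col_m (nth 0 [:: c 4%:R 0; c 2%:R 0; c 1 0] m).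
have vE (y : 'rV[k]_3) : (veronese y *m c) 0 0 = y 0 0 * y 0 0 * c 0 0 + y 0 0 * y 0 1 * c 1 0
   + y 0 0 * y 0 2%:R * c 2%:R 0 + y 0 1 * y 0 1 * c 3%:R 0 + y 0 1 * y 0 2%:R * c 4%:R 0 + y 0 2%:R * y 0 2%:R * c 5%:R 0.
  rewrite mxE !big_ord_recl big_ord0 !mxE /= addr0 !addrA.
  by congr (_ * c _ 0 + _ * c _ 0 + _ * c _ 0 + _ * c _ 0 + _ * c _ 0 + _ * c _ 0); apply: val_inj.
have c_diag : [/\ c 0 0 = 0, c 3%:R 0 = 0 & c 5%:R 0 = 0].
  have h0 b : (veronese (row (h b) S) *m c) 0 0 = 0 by rewrite z0 mxE.
  have SE b b' : row (h b) S 0 b' = (b == b')%:R by rewrite !mxE (inj_eq ih).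
  move: (h0 0) (h0 1) (h0 2%:R); rewrite !vE !SE /= !(mulr0, mul0r, mulr1, addr0, add0r).
  by rewrite !mul1r.
have [c00 c30 c50] := c_diag.
have c'0 : c' != 0.
  apply: contraNneq c0 => c'0; apply/eqP/colP => i; rewrite [RHS]mxE.
  have c'E m : c' m 0 = 0 by rewrite c'0 mxE.
  move: (c'E 0) (c'E 1) (c'E 2%:R); rewrite !mxE /= => c40 c20 c10.
  have -> : c i 0 = nth 0 [:: c 0 0; c 1 0; c 2%:R 0; c 3%:R 0; c 4%:R 0; c 5%:R 0] i.
    by case: i => [[|[|[|[|[|[|//]]]]]] lt] /=; congr (c _ 0); apply: val_inj.
  rewrite c00 c10 c20 c30 c40 c50.
  by case: i => [[|[|[|[|[|[|//]]]]]] lt].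
have detA : \det (\matrix_(m, b) coprod (fun b => G m (h b)) b) = 0.
  apply: (det_right_kernel c'0); apply/colP => m; rewrite [RHS]mxE mxE.
  have GS b : (- row m G *m S) 0 b = - G m (h b).
    rewrite mulNmx !mxE; congr (- _); rewrite (bigD1 (h b)) //= !mxE eqxx mulr1 big1 ?addr0 // => a ab.
    by rewrite !mxE (negbTE ab) mulr0.
  have := vE (- row m G *m S); rewrite zm !GS c00 c30 c50 [LHS]mxE => E.
  rewrite sum3E !mxE !coprodE /= [RHS]E; ring.
move: detA; rewrite !det3mxE !mxE !coprodE /d3 => E; rewrite -[RHS]E; ring.
Qed.

(** All 3 by 3 minors of the matrix of products vanish by [triple_singular], so its rank is
    at most 2. *)
Lemma gc_conic : exists2 w : 'I_3 -> k, exists m, w m != 0 & on_conic w G.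
Proof.
pose Q : 'M[k]_(D, 3) := \matrix_(j, m) coprod (fun m => G m j) m.
have nQ : ~~ row_full Q.
  apply/negP => fQ; have := fullrowsub_unit fQ; rewrite unitmxE unitfE => /negP; apply.
  rewrite -(triple_singular (@fullrankfun_inj _ _ _ _ fQ)); apply/eqP; congr (\det _).
  by apply/matrixP => b m; rewrite !mxE.
have : kermx Q^T != 0 by rewrite kermx_eq0 /row_free mxrank_tr.
move=> /rowV0Pn [v /sub_kermxP vQ /rV0Pn [m vm]]; exists (v 0); first by exists m.
move=> j; have := congr1 (fun M : 'rV_D => M 0 j) vQ; rewrite [LHS]mxE [RHS]mxE => E.
by rewrite -[RHS]E; apply: eq_bigr => m' _; rewrite !mxE.
Qed.
End Triple.
End GrassmannCayleyConic.

(** * Curves from conics *)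

Section Symmetry.
Variables (k : closedFieldType) (D : nat).
Implicit Types (B : 'M[k]_D) (G : 'M[k]_(3, D)) (w g : 'I_3 -> k) (p : 'S_3).

(** The effect on the configuration of a permutation of the coordinates of k^3. *)
Definition perm_index p (s : 'I_(D + 3)) : 'I_(D + 3) :=
  match split s with inl j => lshift 3 j | inr m => rshift D (p m) end.

Lemma perm_indexK p : cancel (perm_index p) (perm_index p^-1).
Proof.
move=> s; case: (split_ordP s) => [j|m] ->.
  by rewrite /perm_index (unsplitK (inl j)) (unsplitK (inl j)).
by rewrite /perm_index (unsplitK (inr m)) (unsplitK (inr _)) permK.
Qed.

Lemma perm_indexKV p : cancel (perm_index p^-1) (perm_index p).
Proof. by move=> s; have := perm_indexK p^-1 s; rewrite invgK. Qed.

Lemma row_conf_perm p B G s : row s (conf B (row_perm p G)) = row (perm_index p s) (conf B G).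
Proof.
case: (split_ordP s) => [j|m] ->; rewrite /perm_index.
  by rewrite (unsplitK (inl j)) /conf !rowKu.
rewrite (unsplitK (inr m)) /conf !rowKd !row_mul; congr (_ *m _).
by apply/rowP => j; rewrite !mxE.
Qed.

Lemma conic_perm p w g : conic (fun m => w (p m)) (fun m => g (p m)) = conic w g.
Proof.
rewrite /conic [RHS](reindex_inj (@perm_inj _ p)); apply: eq_bigr => m _; congr (_ * _).
rewrite /coprod [RHS](reindex_inj (@perm_inj _ p)); apply: eq_bigl => m'.
by rewrite (inj_eq perm_inj).
Qed.

Lemma on_conic_perm p w G : on_conic w G -> on_conic (fun m => w (p m)) (row_perm p G).
Proof.
move=> wG j; rewrite -[RHS](wG j) -[RHS](conic_perm p).
by apply: eq_bigr => m _; congr (_ * _); apply: eq_bigr => m' _; rewrite mxE.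
Qed.

(** Up to a permutation of the coordinates, the conic is smooth, or it contains the line z =
    0 and its coefficient at xz is not zero. *)
Lemma conic_normal_form w : (exists m, w m != 0) ->
  (forall m, w m != 0) \/ exists p : 'S_3, w (p 2%:R) = 0 /\ w (p 1) != 0.
Proof.
move=> [b wb]; case: (boolP [forall m, w m != 0]) => [/forallP|]; first by left.
rewrite negb_forall => /existsP [a]; rewrite negbK => /eqP wa; right.
have ab : a != b by apply: contraNneq wb => <-; rewrite wa.
pose c := tperm 2%:R a 1; have ca : c != a.
  by rewrite -[X in _ != X](tpermL 2%:R a) (inj_eq perm_inj).
exists (tperm 2%:R a * tperm c b)%g; rewrite !permM tpermL -/c tpermL; split=> //.
by rewrite tpermD // eq_sym.
Qed.
End Symmetry.

Section ConicParametrization.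
Variables (k : closedFieldType) (w : 'I_3 -> k).
Hypothesis w0 : forall m, w m != 0.

(** The points of the conic with parameter (u : v), for x, y, z = g 0, g 1, g 2 and t = - (u
    + v), are (x : y : z) = (w0 v t : w1 u t : w2 u v); inversely, (u : v) = (w0 / x : w1 /
    y). *)
Definition param_of (g : 'I_3 -> k) (i : k * (k * k)) := [/\ i.2 != (0, 0),
  g 0 = - (i.1 * w 0 * i.2.2 * (i.2.1 + i.2.2)),
  g 1 = - (i.1 * w 1 * i.2.1 * (i.2.1 + i.2.2)) & g 2%:R = i.1 * w 2%:R * i.2.1 * i.2.2].

(** The linear form on k^3 that restricts to the binary quadratic form phi on the
    parametrized conic. *)
Definition conic_form (phi : {poly k}) : 'rV[k]_3 := \row_m nth 0
  [:: - (phi`_2 / w 0); - (phi`_0 / w 1); (phi`_1 - phi`_0 - phi`_2) / w 2%:R] m.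

Lemma conic_dual D (G : 'M[k]_(3, D)) phi s i (p : 'rV[k]_D) :
  param_of (fun m => gale G m s) i -> dual 2 phi (i, p) = (conic_form phi *m gale G) 0 s.
Proof.
move=> [_ e0 e1 e2]; rewrite mxE sum3E e0 e1 e2 !mxE /= /dual /bform /lam /=.
rewrite !big_ord_recl big_ord0 /=; field; by rewrite !w0.
Qed.

Lemma conic_param g : conic w g = 0 -> exists i, param_of g i.
Proof.
rewrite conicE /param_of; move: (w0 0) (w0 1) (w0 2%:R) (g 0) (g 1) (g 2%:R).
move: (w 0) (w 1) (w 2%:R) => a b c a0 b0 c0 x y z E.
have n1 (t : k) : (1, t) != (0, 0) :> k * k by rewrite xpair_eqE oner_eq0.
case: (eqVneq x 0) E => [->|x0] E.
  move: E; rewrite !(mul0r, mulr0, addr0) => /eqP; rewrite !mulf_eq0 (negbTE a0) /= => /orP [] /eqP ->.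
    by exists (- (z / c), (1, -1)); rewrite n1 /=; split=> //; field; rewrite ?c0.
  by exists (- (y / b), (1, 0)); rewrite n1 /=; split=> //; field; rewrite ?b0.
case: (eqVneq y 0) E => [->|y0] E.
  move: E; rewrite !(mul0r, mulr0, addr0, add0r) => /eqP.
  rewrite !mulf_eq0 (negbTE b0) (negbTE x0) /= => /eqP ->.
  by exists (- (x / a), (0, 1)); rewrite xpair_eqE oner_eq0 andbF /=; split=> //; field; rewrite ?a0.
have z0 : z != 0.
  apply/eqP => z0; move/eqP: E; rewrite z0 !(mulr0, add0r) !mulf_eq0.
  by rewrite (negbTE c0) (negbTE x0) (negbTE y0).
have uv : a / x + b / y = - (c / z).
  apply/eqP; rewrite -subr_eq0 opprK; apply/eqP.
  have -> : a / x + b / y + c / z = (a * (y * z) + b * (x * z) + c * (x * y)) / (x * y * z).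
    by field; rewrite x0 y0 z0.
  by rewrite E mul0r.
exists (x * y * z / (a * b * c), (a / x, b / y)) => /=; rewrite uv.
split; first by rewrite xpair_eqE negb_and mulf_eq0 invr_eq0 (negbTE a0) (negbTE x0).
- by field; rewrite ?a0 ?b0 ?c0 ?x0 ?y0 ?z0.
- by field; rewrite ?a0 ?b0 ?c0 ?x0 ?y0 ?z0.
by field; rewrite ?a0 ?b0 ?c0 ?x0 ?y0 ?z0.
Qed.
End ConicParametrization.

Section ConicCurve.
Variables (k : closedFieldType) (d : nat) (B : 'M[k]_d.+1) (G : 'M[k]_(3, d.+1)) (w : 'I_3 -> k).
Hypotheses (uB : B \in unitmx) (wG : on_conic w G).
Hypothesis p0 : forall s, row s (conf B G) != 0.
Local Notation P s := (row s (conf B G)).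

Lemma gale_unit (c : 'rV[k]_3) : (forall s, (c *m gale G) 0 s = 0) -> c = 0.
Proof.
move=> h; apply/rowP => m; rewrite [RHS]mxE -[RHS](h (rshift d.+1 m)).
by rewrite mul_mx_row row_mxEr mulmx1.
Qed.

(** The parametrization makes the Gale dual a configuration on a rational normal curve of
    degree 2. *)
Lemma smooth_conic_curve : (forall m, w m != 0) -> exists2 C, curve_le d C & forall s, C (P s).
Proof.
move=> w0; have [i iE] := fin_all_exists (fun s => conic_param w0 (gale_conic s wG)).
pose it s : item k d.+1 := (i s, P s); pose l := [seq it s | s <- enum 'I_(d.+1 + 3)].
have [||_ /mapP [s _ ->]||_ [C hC CP]] := @gale_curve k d.+1 2 l.
- move=> phi _; rewrite big_map big_enum /= -[RHS](gale_relation B G (conic_form w phi)).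
  by apply: eq_bigr => s _; rewrite (conic_dual w0 _ _ (iE s)).
- move=> phi sphi h; have c0 : conic_form w phi = 0.
    by apply: gale_unit => s; rewrite -(conic_dual w0 _ (P s) (iE s)) h // (map_f it) ?mem_enum.
  have cE m : conic_form w phi 0 m = 0 by rewrite c0 mxE.
  move: (cE 0) (cE 1) (cE 2%:R); rewrite !mxE /= => /eqP.
  rewrite oppr_eq0 mulf_eq0 invr_eq0 (negbTE (w0 _)) orbF => /eqP p2 /eqP.
  rewrite oppr_eq0 mulf_eq0 invr_eq0 (negbTE (w0 _)) orbF => /eqP p0' /eqP.
  rewrite mulf_eq0 invr_eq0 (negbTE (w0 _)) orbF p2 p0' !subr0 => /eqP p1.
  apply/polyP => a; rewrite coef0; case: a => [|[|[|a]]] //.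
  by apply: nth_default; apply: leq_trans sphi _.
- by have [] := iE s.
- by exists (it ord0); rewrite ?map_f ?mem_enum //; apply: p0.
exists C; last by move=> s; apply: (CP (it s)); rewrite ?map_f ?mem_enum //; apply: p0.
move: hC; rewrite size_map size_enum_ord (_ : (d.+1 + 3 - 4)%N = d) //; lia.
Qed.

(** An item with dual vector (a, b); a zero dual vector needs an arbitrary nonzero
    parameter. *)
Definition line_item (a b : k) (p : 'rV[k]_d.+1) : item k d.+1 :=
  if (a, b) == (0, 0) then (0, (1, 0), p) else (1, (a, b), p).

Lemma line_item_dual phi a b p : dual 1 phi (line_item a b p) = phi`_0 * a + phi`_1 * b.
Proof.
rewrite /line_item; case: eqP => [[-> ->]|_]; first by rewrite /dual /lam /= mul0r !mulr0 addr0.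
by rewrite /dual /bform /lam /= !big_ord_recl big_ord0 /=; ring.
Qed.

Lemma line_item_pt a b p : pt (line_item a b p) = p. Proof. by rewrite /line_item; case: ifP. Qed.

Lemma line_item_neq0 a b p : (line_item a b p).1.2 != (0, 0).
Proof. by rewrite /line_item; case: ifP => [_|/= ->] //=; rewrite xpair_eqE oner_eq0. Qed.

Lemma linear_poly_eq0 (phi : {poly k}) : (size phi <= 2)%N -> phi`_0 = 0 -> phi`_1 = 0 -> phi = 0.
Proof.
move=> sphi p0' p1; apply/polyP => a; rewrite coef0; case: a => [|[|a]] //.
by apply: nth_default; apply: leq_trans sphi _.
Qed.

Hypotheses (w2 : w 2%:R = 0) (w1 : w 1 != 0).
Local Notation x s := (gale G 0 s).
Local Notation y s := (gale G 1 s).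
Local Notation z s := (gale G 2%:R s).
Let t s := w 0 * y s + w 1 * x s.
Local Notation N1 := [pred s | z s == 0].
Local Notation N2 := [pred s | z s != 0].

Let t_N2 s : z s != 0 -> t s = 0.
Proof.
move=> zs; have := gale_conic s wG; rewrite conicE w2 mul0r addr0 => E.
have : z s * t s = 0 by rewrite -[RHS]E /t; ring.
by move/eqP; rewrite mulf_eq0 (negbTE zs) => /eqP.
Qed.

Let gale_r (m m' : 'I_3) : gale G m (rshift d.+1 m') = (m == m')%:R.
Proof. by rewrite row_mxEr mxE. Qed.

Let rel m : \sum_s gale G m s *: P s = 0.
Proof.
rewrite -[RHS](gale_relation B G (delta_mx 0 m)); apply: eq_bigr => s _.
by rewrite -rowE [in RHS]mxE.
Qed.

Let rel_t : \sum_(s | N1 s) t s *: P s = 0.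
Proof.
transitivity (\sum_s t s *: P s).
  rewrite [RHS](bigID N1) /= [X in _ + X]big1 ?addr0 // => s zs.
  by rewrite t_N2 ?scale0r.
under eq_bigr => s _ do rewrite /t scalerDl -!scalerA.
by rewrite big_split /= -!scaler_sumr !rel !scaler0 addr0.
Qed.

Let rel_z : \sum_(s | N2 s) z s *: P s = 0.
Proof.
rewrite -[RHS](rel 2%:R) [RHS](bigID N1) /= [X in _ = X + _]big1 ?add0r // => s /eqP ->.
by rewrite scale0r.
Qed.

Let R := \sum_(s | N1 s) y s *: P s.

Let rel_y : \sum_(s | N2 s) y s *: P s = - R.
Proof. by apply/eqP; rewrite -addr_eq0 addrC; have := rel 1; rewrite (bigID N1) /= => /eqP. Qed.

Let size_N : (size (enum N1) + size (enum N2) = d + 4)%N.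
Proof.
have E : (#|N1| + #|N2| = #|'I_(d.+1 + 3)|)%N := cardC N1.
by rewrite -!cardE E card_ord; lia.
Qed.

(** The Gale vectors lie on the lines z = 0 and t = 0, which have the coordinates (t, y) and
    (z, y). The sum R of the y-multiples of the points of the first line is minus that for
    the other points. Add R to both parts, with dual vectors (0, -1) and (0, 1): then both
    satisfy the relations given by their line, and both curves contain R. The degrees add up
    to (|N1| - 2) + (|N2| - 2) = d. *)
Lemma connected_lines_curve : R != 0 -> exists2 C, curve_le d C & forall s, C (P s).
Proof.
move=> R0; pose i1 s := line_item (t s) (y s) (P s); pose i2 s := line_item (z s) (y s) (P s).
pose l1 := line_item 0 (-1) R :: [seq i1 s | s <- enum N1].
pose l2 := line_item 0 1 R :: [seq i2 s | s <- enum N2].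
have [||i||l1s [C1 hC1 C1P]] := @gale_curve k d.+1 1 l1.
- move=> phi _; rewrite big_cons big_map big_enum /= line_item_dual line_item_pt mulr0 add0r.
  under eq_bigr => s _ do rewrite line_item_dual line_item_pt scalerDl -!scalerA.
  by rewrite big_split /= -!scaler_sumr rel_t -/R scaler0 add0r mulrN1 scaleNr addNr.
- move=> phi sphi h.
  have := h _ (mem_head _ _); rewrite line_item_dual mulr0 add0r mulrN1 => /eqP; rewrite oppr_eq0 => /eqP p1.
  apply: linear_poly_eq0 => //; have := h (i1 (rshift _ 0)).
  rewrite line_item_dual p1 mul0r addr0 /t !gale_r mulr0 add0r mulr1 => /(_ _) /eqP.
  rewrite mulf_eq0 (negbTE w1) orbF => E; apply/eqP/E; rewrite inE orbC map_f // mem_enum.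
  by rewrite !inE gale_r.
- by rewrite inE => /orP [/eqP -> |/mapP [s _ ->]]; apply: line_item_neq0.
- by exists (line_item 0 (-1) R); rewrite ?mem_head ?line_item_pt.
have [||i||l2s [C2 hC2 C2P]] := @gale_curve k d.+1 1 l2.
- move=> phi _; rewrite big_cons big_map big_enum /= line_item_dual line_item_pt mulr0 add0r mulr1.
  under eq_bigr => s _ do rewrite line_item_dual line_item_pt scalerDl -!scalerA.
  by rewrite big_split /= -!scaler_sumr rel_z rel_y scaler0 add0r scalerN subrr.
- move=> phi sphi h.
  have := h _ (mem_head _ _); rewrite line_item_dual mulr0 add0r mulr1 => p1.
  apply: linear_poly_eq0 => //; have := h (i2 (rshift _ 2%:R)).
  rewrite line_item_dual p1 mul0r addr0 !gale_r mulr1; apply; rewrite inE orbC map_f // mem_enum.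
  by rewrite !inE gale_r oner_eq0.
- by rewrite inE => /orP [/eqP -> |/mapP [s _ ->]]; apply: line_item_neq0.
- by exists (line_item 0 1 R); rewrite ?mem_head ?line_item_pt.
have C1R : C1 R by have := C1P _ (mem_head _ _); rewrite line_item_pt; apply.
have C2R : C2 R by have := C2P _ (mem_head _ _); rewrite line_item_pt; apply.
exists (fun p => C1 p \/ C2 p) => [|s].
  have := curve_join hC1 hC2 C1R C2R; move: l1s l2s size_N; rewrite /= !size_map => l1s l2s sN.
  rewrite (_ : (_ + _)%N = d) //; lia.
case: (boolP (z s == 0)) => zs; [left; have := C1P (i1 s)|right; have := C2P (i2 s)];
  by rewrite line_item_pt; apply; rewrite ?p0 // inE orbC map_f // mem_enum !inE zs.
Qed.

(** If R = 0, the y-multiples over the first part are a relation by themselves. This relation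
    is determined by its last three coefficients, so it is y itself, and y vanishes on the
    second part. There the dual vectors are multiples of a single one: the parts lie on
    curves of degrees |N1| - 3 and |N2| - 2, and a line between them gives degree d. *)
Lemma bridged_lines_curve : R = 0 -> exists2 C, curve_le d C & forall s, C (P s).
Proof.
move=> R0; have yN2 s : z s != 0 -> y s = 0.
  pose u : 'rV[k]_(d.+1 + 3) := \row_s (if z s == 0 then y s else 0).
  have uE : u = rsubmx u *m gale G.
    apply: relation_gale uB _; rewrite -[RHS]R0 /R [RHS]big_mkcond; apply: eq_bigr => s' _.
    by rewrite mxE /=; case: ifP => _; rewrite ?scale0r.
  have : rsubmx u *m gale G = delta_mx 0 1 *m gale G.
    congr (_ *m _); apply/rowP => m; rewrite [RHS]mxE [LHS]mxE [LHS]mxE !gale_r.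
    by case: (ord3E m) => -> //=; rewrite ?eqxx ?oner_eq0.
  rewrite -uE -rowE => /rowP /(_ s); rewrite [LHS]mxE [RHS]mxE => E zs.
  by rewrite -[y s]E (negbTE zs).
pose i1 s := line_item (t s) (y s) (P s); pose i2 s : item k d.+1 := (z s, (1, 0), P s).
pose l1 := [seq i1 s | s <- enum N1].
pose l2 := [seq i2 s | s <- enum N2].
have [||i||l1s [C1 hC1 C1P]] := @gale_curve k d.+1 1 l1.
- move=> phi _; rewrite big_map big_enum /=.
  under eq_bigr => s _ do rewrite line_item_dual line_item_pt scalerDl -!scalerA.
  by rewrite big_split /= -!scaler_sumr rel_t -/R R0 !scaler0 addr0.
- move=> phi sphi h.
  have h' m : m != 2%:R -> phi`_0 * t (rshift _ m) + phi`_1 * y (rshift _ m) = 0.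
    move=> m2; rewrite -(line_item_dual _ _ _ (P (rshift _ m))); apply: h.
    apply: (map_f i1); rewrite mem_enum inE gale_r.
    by rewrite [2%:R == m]eq_sym (negbTE m2).
  have := h' 0 isT; have := h' 1 isT; rewrite /t !gale_r /= !mulr0 !mulr1 add0r !addr0.
  move=> E1 /eqP; rewrite mulf_eq0 (negbTE w1) orbF => /eqP p00; apply: linear_poly_eq0 => //.
  by move: E1; rewrite p00 mul0r add0r.
- by move=> /mapP [s _ ->]; apply: line_item_neq0.
- exists (i1 (rshift _ 0)); last by rewrite line_item_pt.
  by rewrite map_f // mem_enum inE gale_r.
have d0 phi s : dual 0 phi (i2 s) = phi`_0 * z s.
  by rewrite /dual /bform big_ord1 /lam /= mulr1 mulr1 mulrC.
have c2 : i2 (rshift _ 2%:R) \in l2 by rewrite map_f // mem_enum inE gale_r oner_eq0.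
have [||i||l2s [C2 hC2 C2P]] := @gale_curve k d.+1 0 l2.
- move=> phi _; rewrite big_map big_enum /=.
  under eq_bigr => s _ do rewrite d0 -scalerA.
  by rewrite -scaler_sumr rel_z scaler0.
- move=> phi sphi /(_ _ c2); rewrite d0 gale_r mulr1 => p00.
  by apply: linear_poly_eq0 => //; [apply: leq_trans sphi _|apply: nth_default].
- by move=> /mapP [s _ ->]; rewrite /= xpair_eqE oner_eq0.
- by exists (i2 (rshift _ 2%:R)); last exact: p0.
have [C hC CP] := curve_bridge hC1 hC2; exists C => [|s].
  move: size_N hC l1s l2s; rewrite /l1 /l2 !size_map.
  set n1 := size (enum N1); set n2 := size (enum N2) => sN hC l1s l2s.
  have dE : ((n1 - 3 + (n2 - 2)).+1 = d)%N by clear -l1s l2s sN; lia.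
  by rewrite dE in hC.
apply: CP; case: (boolP (z s == 0)) => zs; [left; have := C1P (i1 s)|right; have := C2P (i2 s)];
  by rewrite ?line_item_pt; apply; rewrite ?p0 // map_f // mem_enum !inE zs.
Qed.
End ConicCurve.

Theorem conic_curve (k : closedFieldType) d (B : 'M[k]_d.+1) (G : 'M[k]_(3, d.+1)) (w : 'I_3 -> k) :
  B \in unitmx -> (exists m, w m != 0) -> on_conic w G -> (forall s, row s (conf B G) != 0) ->
  exists2 C, curve_le d C & forall s, C (row s (conf B G)).
Proof.
move=> uB /conic_normal_form [w0|[p [w2 w1]]] wG p0; first exact: smooth_conic_curve w0.
have p0' s : row s (conf B (row_perm p G)) != 0 by rewrite row_conf_perm.
suff [C hC CP] : exists2 C, curve_le d C & forall s, C (row s (conf B (row_perm p G))).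
  by exists C => // s; rewrite -(perm_indexKV p s) -row_conf_perm.
have wG' := on_conic_perm p wG.
have [R0|R0] := eqVneq (\sum_(s | gale (row_perm p G) 2%:R s == 0)
   gale (row_perm p G) 1 s *: row s (conf B (row_perm p G))) 0.
  exact: (bridged_lines_curve uB wG' p0' w2 w1 R0).
exact: (connected_lines_curve uB wG' p0' w2 w1 R0).
Qed.

(** * Deformation to rational normal curves *)

Section Generic.
Variable k : closedFieldType.
Implicit Types (f g : k -> k) (Q : k -> Prop).

Definition polyfun f := exists p : {poly k}, forall t, f t = p.[t].

Lemma polyfun_ext f g : f =1 g -> polyfun f -> polyfun g.
Proof. by move=> fg [p fp]; exists p => t; rewrite -fg. Qed.
Lemma polyfun_cst c : polyfun (fun=> c).
Proof. by exists c%:P => t; rewrite hornerC. Qed.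
Lemma polyfun_id : polyfun id.
Proof. by exists 'X => t; rewrite hornerX. Qed.
Lemma polyfunD f g : polyfun f -> polyfun g -> polyfun (fun t => f t + g t).
Proof. by move=> [p fp] [q gq]; exists (p + q) => t; rewrite hornerD fp gq. Qed.
Lemma polyfunM f g : polyfun f -> polyfun g -> polyfun (fun t => f t * g t).
Proof. by move=> [p fp] [q gq]; exists (p * q) => t; rewrite hornerM fp gq. Qed.
Lemma polyfunN f : polyfun f -> polyfun (fun t => - f t).
Proof. by move=> [p fp]; exists (- p) => t; rewrite hornerN fp. Qed.
Lemma polyfun_sum (I : Type) (r : seq I) (f : I -> k -> k) :
  (forall i, polyfun (f i)) -> polyfun (fun t => \sum_(i <- r) f i t).
Proof.
move=> hf; elim: r => [|i r IH]; first by exists 0 => t; rewrite big_nil horner0.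
by apply: polyfun_ext (polyfunD (hf i) IH) => t; rewrite big_cons.
Qed.
Lemma polyfun_prod (I : Type) (r : seq I) (f : I -> k -> k) :
  (forall i, polyfun (f i)) -> polyfun (fun t => \prod_(i <- r) f i t).
Proof.
move=> hf; elim: r => [|i r IH]; first by exists 1 => t; rewrite big_nil hornerC.
by apply: polyfun_ext (polyfunM (hf i) IH) => t; rewrite big_cons.
Qed.
Lemma polyfunX f n : polyfun f -> polyfun (fun t => f t ^+ n).
Proof. by move=> [p fp]; exists (p ^+ n) => t; rewrite horner_exp fp. Qed.

Lemma polyfun_meval n (F : {mpoly k[n]}) (v : k -> 'I_n -> k) :
  (forall i, polyfun (v^~ i)) -> polyfun (fun t => F.@[v t]).
Proof.
move=> hv; apply: polyfun_ext (fun t => esym (mevalE (v t) F)) _.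
apply: polyfun_sum => m; apply: polyfunM; first exact: polyfun_cst.
by apply: polyfun_prod => i; apply: polyfunX.
Qed.

(** The finitely many exceptions are given as zeros of a polynomial, which is convenient for
    conjunctions and for [generic_limit]. *)
Definition generic Q := exists2 p : {poly k}, p != 0 & forall t, p.[t] != 0 -> Q t.

Lemma generic_imp Q Q' : (forall t, Q t -> Q' t) -> generic Q -> generic Q'.
Proof. by move=> QQ' [p p0 pQ]; exists p => // t /pQ /QQ'. Qed.

Lemma generic_true Q : (forall t, Q t) -> generic Q.
Proof. by move=> hQ; exists 1; rewrite ?oner_eq0. Qed.

Lemma generic_neq0 f t : polyfun f -> f t != 0 -> generic (fun t => f t != 0).
Proof.
move=> [p fp] ft; exists p => [|u]; last by rewrite fp.
by apply: contraNneq ft => p0; rewrite fp p0 horner0.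
Qed.

Lemma generic_and Q Q' : generic Q -> generic Q' -> generic (fun t => Q t /\ Q' t).
Proof.
move=> [p p0 pQ] [q q0 qQ]; exists (p * q) => [|t]; first by rewrite mulf_neq0.
by rewrite hornerM mulf_eq0 negb_or => /andP [/pQ ? /qQ ?].
Qed.

Lemma generic_forall (I : finType) (Q : I -> k -> Prop) :
  (forall i, generic (Q i)) -> generic (fun t => forall i, Q i t).
Proof.
move=> hQ; have [p p0 pQ] := fin_all_exists2 hQ.
exists (\prod_i p i) => [|t pt i]; first by apply/prodf_neq0 => i _.
apply: pQ; apply: contraNneq pt => pi0.
by rewrite horner_prod (bigD1 i) //= pi0 mul0r.
Qed.

Lemma generic_limit f t : polyfun f -> generic (fun t => f t = 0) -> f t = 0.
Proof.
move=> [p fp] [q q0 qf]; rewrite fp.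
have [->|p0] := eqVneq p 0; first exact: horner0.
have [u] := poly_nonroot (mulf_neq0 p0 q0).
by rewrite hornerM mulf_eq0 negb_or => /andP [pu /qf]; rewrite fp => /eqP; rewrite (negbTE pu).
Qed.
End Generic.

Section Limits.
Variables (k : closedFieldType) (d' : nat).
Local Notation d := d'.+1.
Variables (B : 'M[k]_d.+1).
Hypothesis uB : B \in unitmx.
Implicit Types (G : 'M[k]_(3, d.+1)) (w : 'I_3 -> k).

(** In this case the points lie on a rational normal curve, see [nice_curve]; the last
    condition says that the Gale vectors are pairwise not proportional. *)
Definition nice w G := [/\ forall m, w m != 0, on_conic w G, forall m j, G m j != 0 &
  forall i j, i != j -> G 0 i * G 1 j != G 0 j * G 1 i].

(** The unit vectors are not proportional to the other Gale vectors either, as these have no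
    zero coordinate. *)
Lemma nice_minor w G s t : nice w G -> s != t ->
  exists m m', gale G m s * gale G m' t != gale G m t * gale G m' s.
Proof.
move=> [_ _ G0 Gd].
have lr j m : exists m', gale G m' (lshift 3 j) * gale G m (rshift d.+1 m)
    != gale G m' (rshift d.+1 m) * gale G m (lshift 3 j).
  have [m' mm] : exists m' : 'I_3, m' != m.
    by have [->|m0] := eqVneq m 0; [exists 1|exists 0; rewrite eq_sym].
  exists m'; rewrite !row_mxEl !row_mxEr !mxE eqxx (negbTE mm) mul0r mulr1; exact: G0.
case: (split_ordP s) => [i|m] ->; case: (split_ordP t) => [j|m'] ->.
- rewrite (inj_eq (@lshift_inj _ _)) => ij; exists 0, 1; rewrite !row_mxEl; exact: Gd.
- by have [a E] := lr i m'; exists a, m'.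
- by have [a E] := lr j m; exists a, m; rewrite eq_sym.
rewrite (inj_eq (@rshift_inj _ _)) => mm; exists m, m'.
by rewrite !row_mxEr !mxE !eqxx (negbTE mm) mul0r mulr1 oner_neq0.
Qed.

(** With distinct parameters, [distinct_curve] gives a parametrization of degree d, for l1
    the basis and l2 the three other points. Its image contains a basis, so it is
    nondegenerate. *)
Lemma nice_curve w G : nice w G ->
  exists2 C, rational_normal_curve C & (forall s, C (row s (conf B G))) /\
    forall s t, s != t -> ~ same_point (row s (conf B G)) (row t (conf B G)).
Proof.
move=> nG; have [w0 wG G0 _] := nG.
have [i iE] := fin_all_exists (fun s => conic_param w0 (gale_conic s wG)).
pose it s : item k d.+1 := (i s, row s (conf B G)).
have nd s t : s != t -> det2 (it s) (it t) != 0.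
  move=> st; have [m [m' /eqP nE]] := nice_minor nG st.
  apply/eqP; rewrite /det2 /= => D0; apply: nE.
  have [[nz s0 s1 s2] [_ t0 t1 t2]] := (iE s, iE t).
  have [c [eu ev]] := parallel (nz : ((i s).2.1, (i s).2.2) != _) D0.
  by case: (ord3E m) => ->; case: (ord3E m') => ->; rewrite ?s0 ?s1 ?s2 ?t0 ?t1 ?t2 ?eu ?ev; ring.
have l0 s : lam (it s) != 0.
  rewrite /lam /=; apply/eqP => l0; have [_ e0 e1 e2] := iE s.
  have z m : gale G m s = 0.
    by case: (ord3E m) => ->; rewrite ?e0 ?e1 ?e2 l0 !mul0r ?oppr0.
  case: (split_ordP s) z => [j|m] -> z.
    by have := G0 0 j; rewrite -(row_mxEl G 1%:M) z eqxx.
  by have /eqP := z m; rewrite row_mxEr mxE eqxx oner_eq0.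
pose l1 := [seq it (lshift 3 j) | j <- enum 'I_d.+1].
pose l2 := [seq it (rshift d.+1 m) | m <- enum 'I_3].
have l12 : l1 ++ l2 = [seq it s | s <- [seq lshift 3 j | j <- enum 'I_d.+1] ++ [seq rshift d.+1 m | m <- enum 'I_3]].
  by rewrite map_cat -[X in _ = X ++ _]map_comp -[X in _ = _ ++ X]map_comp.
have it_inj s t : it s = it t -> s = t.
  by move=> E; apply/eqP; apply: contraT => /nd; rewrite E det2_self eqxx.
have itl s : it s \in l1 ++ l2.
  rewrite l12 map_f // mem_cat; case: (split_ordP s) => j ->.
    by rewrite map_f ?mem_enum.
  by rewrite orbC map_f ?mem_enum.
have lit x : x \in l1 ++ l2 -> exists s, x = it s.
  by rewrite l12 => /mapP [s _ ->]; exists s.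
have [|||||psi spsi hpsi] := @distinct_curve k d.+1 2 l1 l2.
- by rewrite size_map size_enum_ord.
- move=> phi _; rewrite -[RHS](gale_relation B G (conic_form w phi)) big_split_ord big_cat /=.
  by congr (_ + _); rewrite big_map big_enum /=; apply: eq_bigr => j _; rewrite (conic_dual w0 _ _ (iE _)).
- rewrite l12 map_inj_uniq // cat_uniq (map_inj_uniq (@lshift_inj _ _)) (map_inj_uniq (@rshift_inj _ _)) !enum_uniq.
  rewrite andbT; apply/hasPn => _ /mapP [m _ ->]; apply/negP => /mapP [j _ /eqP].
  by rewrite eq_rlshift.
- by move=> _ _ /lit [s ->] /lit [t ->] st; apply: nd; apply: contraNneq st => ->.
- by move=> _ /lit [s ->].
move: spsi hpsi; rewrite size_map size_enum_ord /= => spsi hpsi.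
have {hpsi} Pc s : exists2 c : k, c != 0 & row s (conf B G) = c *: rpoint d psi (i s).2.1 (i s).2.2.
  exact: hpsi (itl s).
have nz s : ((i s).2.1, (i s).2.2) != (0, 0) by have [] := iE s; case: (i s).2.
have zC : zclosed (rcurve d psi) by apply: zclosure_closed.
have CP s : row s (conf B G) != 0 -> rcurve d psi (row s (conf B G)).
  have [c c0 ->] := Pc s => cp; apply: zclosed_scale zC c0 _.
  by apply: sub_zclosure; [exists (i s).2.1, (i s).2.2|apply: contraNneq cp => ->; rewrite scaler0].
have nC : ~ in_hyperplane (rcurve d psi).
  move=> [h h0 hC]; have Bh : B *m h = 0.
    apply/row_matrixP => j; rewrite row_mul row0.
    have -> : row j B = row (lshift 3 j) (conf B G) by rewrite rowKu.
    have [->|p0] := eqVneq (row (lshift 3 j) (conf B G)) 0; first by rewrite mul0mx.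
    by apply: hC; apply: CP.
  by case/eqP: h0; rewrite -[h](mulKmx uB) Bh mulmx0.
exists (rcurve d psi); first exact: rcurve_rational_normal.
have P0 s : row s (conf B G) != 0.
  by have [c c0 ->] := Pc s; rewrite scaler_eq0 negb_or c0 rpoint_neq0.
split=> [s|s t st [c c0]]; first exact: CP.
have [[a a0 ->] [b b0 ->]] := (Pc s, Pc t) => E.
have := @rpoint_det _ _ _ nC (c * a / b) (i s).2.1 (i s).2.2 (i t).2.1 (i t).2.2.
have cab : c * a / b != 0 by rewrite !mulf_neq0 ?invr_neq0.
move=> /(_ cab) e; have := nd s t st; rewrite /det2 /= e ?subrr ?eqxx //.
by rewrite -[LHS](scalerK b0) E !scalerA; congr (_ *: _); ring.
Qed.

Variables (n : nat) (F : {mpoly k[n * d.+1]}).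
Hypothesis hF : forall Q, on_rational_normal_curve Q -> eval_points F Q = 0.

(** The value of F at the configuration, as a function of its Gale dual; tau distributes the
    points of the configuration over the n arguments of F. *)
Definition value (tau : 'I_n -> 'I_(d.+1 + 3)) G :=
  eval_points F (fun i => row (tau i) (conf B G)).

Lemma polyfun_value tau (G : k -> 'M[k]_(3, d.+1)) :
  (forall m j, polyfun (fun t => G t m j)) -> polyfun (fun t => value tau (G t)).
Proof.
move=> hG; apply: polyfun_meval => i; case: (mxvec_indexP i) => a b.
apply: polyfun_ext (fun t => esym (etrans (mxvecE _ _ _) (mxE _ _ _ _))) _.
apply: polyfun_ext (fun t => esym (mxE _ _ _ _)) _.
case: (split_ordP (tau a)) => [j|m] ->.
  by apply: polyfun_ext (polyfun_cst (B j b)) => t; rewrite col_mxEu.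
apply: (@polyfun_ext _ (fun t => \sum_j - G t m j * B j b)) => [t|].
  by rewrite col_mxEd mxE; apply: eq_bigr => j _; rewrite mxE.
by apply: polyfun_sum => j; apply: polyfunM (polyfunN (hG m j)) (polyfun_cst _).
Qed.

Lemma nice_value tau w G : injective tau -> nice w G -> value tau G = 0.
Proof.
move=> it /nice_curve [C hC [CP nC]]; apply: hF; split=> [i|i j ij|].
- have [[[S hS CE] _] _ _ _ _] := hC.
  by have /CE [] := CP (tau i).
- by apply: nC; rewrite (inj_eq it).
by exists C.
Qed.

Definition mx3 (x y z : 'I_d.+1 -> k) : 'M[k]_(3, d.+1) :=
  \matrix_(m, j) nth 0 [:: x j; y j; z j] m.

Lemma mx3E x y z j : (mx3 x y z 0 j = x j) * (mx3 x y z 1 j = y j) * (mx3 x y z 2%:R j = z j).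
Proof. by rewrite !mxE. Qed.

Lemma mx3_eq G x y z : (forall j, [/\ G 0 j = x j, G 1 j = y j & G 2%:R j = z j]) -> mx3 x y z = G.
Proof.
move=> h; apply/matrixP => m j; have [e0 e1 e2] := h j.
by case: (ord3E m) => ->; rewrite mx3E.
Qed.

Lemma conic_mx3 w x y z : on_conic w (mx3 x y z) <->
  forall j, w 0 * (y j * z j) + w 1 * (x j * z j) + w 2%:R * (x j * y j) = 0.
Proof. by split=> h j; have := h j; rewrite conicE !mx3E. Qed.

(** A polynomial in t that vanishes for almost all t vanishes at t0. *)
Lemma family_value tau (x y z : k -> 'I_d.+1 -> k) t0 :
  (forall j, polyfun (x^~ j)) -> (forall j, polyfun (y^~ j)) -> (forall j, polyfun (z^~ j)) ->
  generic (fun t => value tau (mx3 (x t) (y t) (z t)) = 0) ->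
  value tau (mx3 (x t0) (y t0) (z t0)) = 0.
Proof.
move=> hx hy hz; apply: (generic_limit (f := fun t => value tau (mx3 (x t) (y t) (z t)))).
apply: polyfun_value => m j; have [->|->|->] := ord3E m.
- by apply: polyfun_ext (hx j) => t; rewrite mx3E.
- by apply: polyfun_ext (hy j) => t; rewrite mx3E.
by apply: polyfun_ext (hz j) => t; rewrite mx3E.
Qed.

Lemma distinct_scalars : exists tau : 'I_d.+1 -> k, injective tau /\ forall j, tau j != 0 /\ 1 + tau j != 0.
Proof.
have [s [us ss sn]] : exists s : seq k, [/\ uniq s, size s = d.+1 & forall a, a \in s -> a \notin [:: 0; -1]].
  elim: (d.+1) => [|h [s [us ss sn]]]; first by exists [::].
  have [a] := avoid_seq ([:: 0; -1] ++ s); rewrite mem_cat negb_or => /andP [an as'].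
  exists (a :: s); split; rewrite /= ?as' ?ss // => b; rewrite inE => /orP [/eqP ->|/sn] //.
exists (fun j => s`_j); split=> [i j /eqP|j].
  by rewrite nth_uniq ?ss // => /eqP /val_inj.
have := sn _ (mem_nth 0 (_ : (j < size s)%N)); rewrite ss ltn_ord => /(_ isT).
by rewrite !inE negb_or addrC addr_eq0 => /andP [].
Qed.

Ltac poly := repeat first [exact: polyfun_cst|exact: polyfun_id|apply: polyfunD|apply: polyfunM|apply: polyfunN].

(** Move the parameters of the Gale vectors on the conic along lines to distinct ones, none
    of them a parameter of a unit vector. *)
Lemma smooth_value tau w G : injective tau -> (forall m, w m != 0) -> on_conic w G -> value tau G = 0.
Proof.
move=> it w0 wG; have [i iE] := fin_all_exists (fun j => conic_param w0 (wG j)).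
have [u [ui un]] := distinct_scalars.
pose a t j := (1 - t) * (i j).1 + t.
pose b t j := (1 - t) * (i j).2.1 + t * u j.
pose c t j := (1 - t) * (i j).2.2 + t.
pose x t j := - (a t j * w 0 * c t j * (b t j + c t j)).
pose y t j := - (a t j * w 1 * b t j * (b t j + c t j)).
pose z t j := a t j * w 2%:R * b t j * c t j.
have a1 j : a 1 j = 1 by rewrite /a; ring.
have b1 j : b 1 j = u j by rewrite /b; ring.
have c1 j : c 1 j = 1 by rewrite /c; ring.
have px j : polyfun (x^~ j) by rewrite /x /a /b /c; poly.
have py j : polyfun (y^~ j) by rewrite /y /a /b /c; poly.
have pz j : polyfun (z^~ j) by rewrite /z /a /b /c; poly.
have -> : G = mx3 (x 0) (y 0) (z 0).
  symmetry; apply: mx3_eq => j; have [_ -> -> ->] := iE j.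
  by rewrite /x /y /z /a /b /c; split; ring.
apply: family_value => //.
have gx j : generic (fun t => x t j != 0).
  apply: (@generic_neq0 _ _ 1) => //; rewrite /x a1 b1 c1 oppr_eq0 !mulf_eq0 !oner_eq0 (negbTE (w0 _)) /=.
  by rewrite addrC; have [] := un j.
have gy j : generic (fun t => y t j != 0).
  apply: (@generic_neq0 _ _ 1) => //; rewrite /y a1 b1 c1 oppr_eq0 !mulf_eq0 !oner_eq0 (negbTE (w0 _)) /=.
  by rewrite addrC negb_or; have [-> ->] := un j.
have gz j : generic (fun t => z t j != 0).
  apply: (@generic_neq0 _ _ 1) => //; rewrite /z a1 b1 c1 !mulf_eq0 !oner_eq0 (negbTE (w0 _)) /= orbF.
  by have [] := un j.
have gd j l : generic (fun t => j != l -> x t j * y t l - x t l * y t j != 0).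
  have [->|jl] := eqVneq j l; first exact: generic_true.
  suff : generic (fun t => x t j * y t l - x t l * y t j != 0) by apply: generic_imp.
  apply: (@generic_neq0 _ _ 1); first by poly.
  have -> : x 1 j * y 1 l - x 1 l * y 1 j = w 0 * w 1 * (1 + u j) * (1 + u l) * (u l - u j).
    by rewrite /x /y !a1 !b1 !c1; ring.
  rewrite !mulf_neq0 ?w0 // ?(un _).2 // subr_eq0; apply: contra jl => /eqP /ui ->; exact: eqxx.
have := generic_and (generic_forall (fun j => generic_and (gx j) (generic_and (gy j) (gz j))))
  (generic_forall (fun j => generic_forall (gd j))).
apply: generic_imp => t [t0 td]; apply: (nice_value it (w := w)); split=> //.
- by apply/conic_mx3 => j; rewrite /x /y /z; ring.
- move=> m j; have [? [? ?]] := t0 j.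
  by case: (ord3E m) => ->; rewrite mx3E.
by move=> j l jl; rewrite !mx3E -subr_eq0; apply: td.
Qed.

Lemma polyfun_if (b : bool) (f g : k -> k) : polyfun f -> polyfun g -> polyfun (fun t => if b then f t else g t).
Proof. by case: b. Qed.

Section Lines.
Variables (tau : 'I_n -> 'I_(d.+1 + 3)) (N : pred 'I_d.+1).
Hypothesis it : injective tau.
Implicit Types x y z : 'I_d.+1 -> k.

(** The conic z (a y + b x) = 0; N says which line each vector lies on. *)
Definition on_lines a b x y z := forall j, if N j then z j = 0 else a * y j + b * x j = 0.
(** No vector at the node, or proportional to another vector or to a unit vector on the same
    line. *)
Definition general_on_lines a b x y z :=
  (forall j, x j != 0 /\ if N j then y j != 0 /\ a * y j + b * x j != 0 else z j != 0) /\
  (forall i j, i != j -> N i = N j ->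
    if N i then x i * y j - x j * y i != 0 else x i * z j - x j * z i != 0).

(** The conics a y z + b x z + t x y = 0 smooth the pair of lines. For each vector on the
    lines there is a vector on these conics that is affine in t: move z on the line z = 0,
    and move y and z on the other line, which keeps x. *)
Lemma smoothing_value a b x y z : a != 0 -> b != 0 -> on_lines a b x y z ->
  general_on_lines a b x y z -> value tau (mx3 x y z) = 0.
Proof.
move=> a0 b0 xyz [g1 g2].
pose Y t j := if N j then y j else y j + t * (b * (x j / a) ^+ 2 / z j).
pose Z t j := if N j then t * - (x j * y j / (a * y j + b * x j)) else z j - t * (x j / a).
have pY j : polyfun (Y^~ j) by apply: polyfun_if; poly.
have pZ j : polyfun (Z^~ j) by apply: polyfun_if; poly.
have yE j : ~~ N j -> y j = - (b * x j / a).
  move=> nj; have := xyz j; rewrite (negbTE nj) => /eqP; rewrite addr_eq0 => /eqP E.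
  by apply: (mulfI a0); rewrite E; field.
have -> : mx3 x y z = mx3 x (Y 0) (Z 0).
  symmetry; apply: mx3_eq => j; rewrite !mx3E /Y /Z; have := xyz j.
  by case: (N j) => e; split; rewrite ?mul0r ?addr0 ?subr0.
apply: (@family_value tau (fun=> x)) => // [j|]; first exact: polyfun_cst.
have gY j : generic (fun t => Y t j != 0).
  apply: (@generic_neq0 _ _ 0) => //; rewrite /Y; have [xj] := g1 j.
  case: (boolP (N j)) => [_ []|nj _] //; rewrite mul0r addr0 yE // oppr_eq0.
  by rewrite !mulf_neq0 ?invr_neq0.
have gZ j : generic (fun t => Z t j != 0).
  have [xj] := g1 j; case: (boolP (N j)) => [Nj [yj cj]|nj zj].
    apply: (@generic_neq0 _ _ 1) => //; rewrite /Z Nj mul1r oppr_eq0.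
    by rewrite !mulf_neq0 ?invr_neq0.
  by apply: (@generic_neq0 _ _ 0) => //; rewrite /Z (negbTE nj) mul0r subr0.
have gD i j : generic (fun t => i != j -> x i * Y t j - x j * Y t i != 0).
  have [->|ij] := eqVneq i j; first exact: generic_true.
  suff : generic (fun t => x i * Y t j - x j * Y t i != 0) by apply: generic_imp.
  have pD : polyfun (fun t => x i * Y t j - x j * Y t i).
    by apply: polyfunD; [|apply: polyfunN]; apply: polyfunM => //; apply: polyfun_cst.
  have [[xi gi] [xj gj]] := (g1 i, g1 j).
  have gij := g2 i j ij; move: gi gj gij pD; rewrite /Y.
  case: (boolP (N i)) => ni; case: (boolP (N j)) => nj gi gj gij pD.
  - by apply: (@generic_neq0 _ _ 0) => //; apply: gij.
  - apply: (@generic_neq0 _ _ 0) => //; rewrite mul0r addr0 (yE j nj).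
    have -> : x i * - (b * x j / a) - x j * y i = - (x j * (a * y i + b * x i) / a) by field.
    by rewrite oppr_eq0 !mulf_neq0 ?invr_neq0 //; have [] := gi.
  - apply: (@generic_neq0 _ _ 0) => //; rewrite mul0r addr0 (yE i ni).
    have -> : x i * y j - x j * - (b * x i / a) = x i * (a * y j + b * x j) / a by field.
    by rewrite !mulf_neq0 ?invr_neq0 //; have [] := gj.
  apply: (@generic_neq0 _ _ 1) => //; rewrite !mul1r (yE i ni) (yE j nj).
  have -> : x i * (- (b * x j / a) + b * (x j / a) ^+ 2 / z j) - x j * (- (b * x i / a) + b * (x i / a) ^+ 2 / z i) =
     - (b * x i * x j * (x i * z j - x j * z i) / (a ^+ 2 * z i * z j)) by field; rewrite a0 gi gj.
  rewrite oppr_eq0 mulf_neq0 ?invr_neq0 ?mulf_neq0 ?expf_neq0 //.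
  exact: gij.
have gt : generic (fun t : k => t != 0) by apply: (@generic_neq0 _ id 1) (@polyfun_id _) (oner_neq0 _).
have := generic_and gt (generic_and (generic_forall (fun j => generic_and (gY j) (gZ j)))
  (generic_forall (fun i => generic_forall (gD i)))).
apply: generic_imp => t [t0 [tYZ tD]].
apply: (nice_value it (w := fun m => nth 0 [:: a; b; t] m)); split=> //.
- by move=> m; case: (ord3E m) => ->.
- apply/conic_mx3 => j /=; have [xj] := g1 j; rewrite /Y /Z; case: (boolP (N j)) => [Nj [yj cj]|nj zj].
    by field.
  by rewrite yE //; field; rewrite zj a0.
- move=> m j; have [? ?] := tYZ j; have [xj _] := g1 j.
  by case: (ord3E m) => ->; rewrite mx3E.
by move=> i j ij; rewrite !mx3E -subr_eq0; apply: tD.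
Qed.

(** Move the vectors on their lines to general position. *)
Lemma lines_value a b x y z : a != 0 -> b != 0 -> on_lines a b x y z -> value tau (mx3 x y z) = 0.
Proof.
move=> a0 b0 xyz; have [u [ui un]] := distinct_scalars.
pose X t j := (1 - t) * x j + t * (if N j then a * u j else a).
pose Y t j := (1 - t) * y j + t * (if N j then b else - b).
pose Z t j := (1 - t) * z j + t * (if N j then 0 else u j).
have pX j : polyfun (X^~ j) by rewrite /X; poly.
have pY j : polyfun (Y^~ j) by rewrite /Y; poly.
have pZ j : polyfun (Z^~ j) by rewrite /Z; poly.
have E1 (p q : k) : (1 - 1) * p + 1 * q = q by ring.
have -> : mx3 x y z = mx3 (X 0) (Y 0) (Z 0).
  by symmetry; apply: mx3_eq => j; rewrite !mx3E /X /Y /Z; split; ring.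
apply: family_value => //.
have gen (g : k -> k) (c : k) : polyfun g -> g 1 = c -> c != 0 -> generic (fun t => g t != 0).
  by move=> pg gc c0; apply: (@generic_neq0 _ _ 1) => //; rewrite gc.
have X1 j : X 1 j = if N j then a * u j else a by rewrite /X E1.
have Y1 j : Y 1 j = if N j then b else - b by rewrite /Y E1.
have Z1 j : Z 1 j = if N j then 0 else u j by rewrite /Z E1.
have gX j : generic (fun t => X t j != 0).
  by apply: (gen _ _ (pX j) (X1 j)); case: ifP => _ //; rewrite mulf_neq0 // (un j).1.
have gYZ j : generic (fun t => if N j then Y t j != 0 /\ a * Y t j + b * X t j != 0 else Z t j != 0).
  have pE : polyfun (fun t => a * Y t j + b * X t j).
    by apply: polyfunD; apply: polyfunM => //; apply: polyfun_cst.
  case: (boolP (N j)) => nj; last first.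
    by apply: (gen _ _ (pZ j) (Z1 j)); rewrite (negbTE nj) (un j).1.
  apply: generic_and; first by apply: (gen _ _ (pY j) (Y1 j)); rewrite nj.
  apply: (gen _ _ pE erefl); rewrite X1 Y1 nj.
  have -> : a * b + b * (a * u j) = a * b * (1 + u j) by ring.
  by rewrite !mulf_neq0 ?(un j).2.
have gD i j : generic (fun t => i != j -> N i = N j ->
    if N i then X t i * Y t j - X t j * Y t i != 0 else X t i * Z t j - X t j * Z t i != 0).
  have [->|ij] := eqVneq i j; first exact: generic_true.
  have uij : u j - u i != 0 by rewrite subr_eq0; apply: contra ij => /eqP /ui ->.
  have [Nij|Nij] := eqVneq (N i) (N j); last by apply: generic_true => t _ /eqP; rewrite (negbTE Nij).
  case: (boolP (N i)) => ni; have nj := ni; rewrite Nij in nj.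
    suff : generic (fun t => X t i * Y t j - X t j * Y t i != 0) by apply: generic_imp.
    apply: (gen _ (a * b * (u i - u j))).
    - by apply: polyfunD; [|apply: polyfunN]; apply: polyfunM.
    - by rewrite !X1 !Y1 ni nj; ring.
    by rewrite !mulf_neq0 // -opprB oppr_eq0.
  suff : generic (fun t => X t i * Z t j - X t j * Z t i != 0) by apply: generic_imp.
  apply: (gen _ (a * (u j - u i))).
  - by apply: polyfunD; [|apply: polyfunN]; apply: polyfunM.
  - by rewrite !X1 !Z1 (negbTE ni) (negbTE nj); ring.
  by rewrite !mulf_neq0.
have := generic_and (generic_forall (fun j => generic_and (gX j) (gYZ j)))
  (generic_forall (fun i => generic_forall (gD i))).
apply: generic_imp => t [tX tD]; apply: (smoothing_value a0 b0) => [j|].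
  have := xyz j; rewrite /X /Y /Z; case: (N j) => e; first by rewrite e; ring.
  by rewrite -[RHS](mulr0 (1 - t)) -e; ring.
by split.
Qed.

(** For x z = 0, the node is a unit point. Rotate the line x = 0 to t y + b x = 0. *)
Lemma node_value b x y z : b != 0 -> on_lines 0 b x y z -> value tau (mx3 x y z) = 0.
Proof.
move=> b0 xyz; pose X t j := x j + t * (if N j then 0 else - (y j / b)).
have pX j : polyfun (X^~ j) by rewrite /X; poly.
have -> : mx3 x y z = mx3 (X 0) y z.
  by symmetry; apply: mx3_eq => j; rewrite !mx3E /X; split; ring.
apply: (@family_value tau X (fun=> y) (fun=> z)) => // [j|j|]; try exact: polyfun_cst.
have gt : generic (fun t : k => t != 0) by apply: (@generic_neq0 _ id 1) (@polyfun_id _) (oner_neq0 _).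
apply: generic_imp gt => t t0; apply: (lines_value t0 b0) => j.
have := xyz j; rewrite /X; case: (N j) => //; rewrite mul0r add0r => /eqP.
by rewrite mulf_eq0 (negbTE b0) => /eqP ->; field.
Qed.
End Lines.

Lemma value_perm tau p G : value tau (row_perm p G) = value (fun i => perm_index p (tau i)) G.
Proof.
rewrite /value /eval_points; congr (_.@[mxvec _ 0]).
by apply/row_matrixP => i; rewrite !rowK row_conf_perm.
Qed.

(** By symmetry, the conic has the form of [conic_normal_form]. If it is a pair of lines,
    then its node is the unit point (0 : 1 : 0) or no unit point, as its coefficient at yz is
    zero or not. *)
Theorem conic_value tau w G : injective tau -> (exists m, w m != 0) -> on_conic w G -> value tau G = 0.
Proof.
move=> it /conic_normal_form [w0|[p [w2 w1]]] wG; first exact: smooth_value w0 wG.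
have -> : value tau G = value (fun i => perm_index p^-1 (tau i)) (row_perm p G).
  rewrite value_perm /value /eval_points; congr (_.@[mxvec _ 0]).
  by apply/row_matrixP => i; rewrite !rowK perm_indexKV.
move: (on_conic_perm p wG); set H := row_perm p G => wH.
have it' : injective (fun i => perm_index p^-1 (tau i)).
  by move=> i j /(can_inj (perm_indexK _)) /it.
have -> : H = mx3 (H 0) (H 1) (H 2%:R) by symmetry; apply: mx3_eq.
pose N : pred 'I_d.+1 := fun j => H 2%:R j == 0.
have lH : on_lines N (w (p 0)) (w (p 1)) (H 0) (H 1) (H 2%:R).
  move=> j; rewrite /N; case: eqP => // /eqP zj.
  have := wH j; rewrite conicE w2 mul0r addr0 => E.
  have : H 2%:R j * (w (p 0) * H 1 j + w (p 1) * H 0 j) = 0 by rewrite -[RHS]E; ring.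
  by move/eqP; rewrite mulf_eq0 (negbTE zj) => /eqP.
have [a0|a0] := eqVneq (w (p 0)) 0; last exact: lines_value it' _ _ _ _ _ a0 w1 lH.
by apply: (node_value it' w1 (N := N)); rewrite -a0.
Qed.
End Limits.

(** * The three conditions *)

Section Main.
Variables (k : closedFieldType) (r : nat) (P : 'I_(2 + r + 4) -> 'rV[k]_(3 + r)).
Hypotheses (hP : forall i, P i != 0) (hspan : ~ in_hyperplane (fun x => exists i, x = P i)).

Lemma size_complement (I : {set 'I_(2 + r + 4)}) (i1 i2 i3 i4 i5 i6 : 'I_(2 + r + 4)) :
  I = [set i1; i2; i3; i4; i5; i6] ->
  (i1 < i2)%N -> (i2 < i3)%N -> (i3 < i4)%N -> (i4 < i5)%N -> (i5 < i6)%N ->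
  size (enum (~: I)) = r.
Proof.
move=> IE l1 l2 l3 l4 l5; have := cardsC I; rewrite card_ord -cardE.
have ne (i j : 'I_(2 + r + 4)) : (i < j)%N -> (j == i) = false.
  by move=> ij; apply/eqP => ji; rewrite ji ltnn in ij.
have -> : #|I| = 6%N; last by lia.
have l13 := ltn_trans l1 l2; have l24 := ltn_trans l2 l3; have l35 := ltn_trans l3 l4; have l46 := ltn_trans l4 l5.
have l14 := ltn_trans l1 l24; have l25 := ltn_trans l2 l35; have l36 := ltn_trans l3 l46.
have l15 := ltn_trans l1 l25; have l26 := ltn_trans l2 l36; have l16 := ltn_trans l1 l26.
rewrite IE ![_ :|: [set i6]]setUC ![_ :|: [set i5]]setUC ![_ :|: [set i4]]setUC ![_ :|: [set i3]]setUC.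
rewrite ![_ :|: [set i2]]setUC !cardsU1 cards1 !inE.
by rewrite !ne.
Qed.

Lemma curve_gc C : @quasi_Veronese k (2 + r) C -> (forall i, C (P i)) -> gc_condition P.
Proof.
move=> qC CP I i1 i2 i3 i4 i5 i6 IE l1 l2 l3 l4 l5 /=.
apply: (quasi_Veronese_gc qC) => [|x /mapP [j _ ->]//|x].
  by rewrite size_map (size_complement IE l1 l2 l3 l4 l5).
by rewrite !inE => /orP [|/orP [|/orP [|/orP [|/orP []]]]] /eqP ->.
Qed.

Lemma compactification_gc : @Veronese_compactification k (2 + r) _ P -> gc_condition P.
Proof.
move=> VP I i1 i2 i3 i4 i5 i6 IE l1 l2 l3 l4 l5; apply: Veronese_gc VP _.
exact: size_complement IE l1 l2 l3 l4 l5.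
Qed.

Hypothesis gcP : gc_condition P.

Lemma gc_curve : exists C, @quasi_Veronese k (2 + r) C /\ forall i, C (P i).
Proof.
have en : (2 + r + 4 = 3 + r + 3)%N by lia.
have [B [G [e [uB ie Pe]]]] := configuration en hspan.
have [w w0 wG] := gc_conic gcP en uB ie Pe.
have [e' _ eK] : bijective e by apply: inj_card_bij => //; rewrite !card_ord en.
have [|C [zC cC hC] CP] := @conic_curve k (2 + r) B G w uB w0 wG.
  by move=> s; rewrite -Pe.
have CPi i : C (P i) by rewrite -(eK i) Pe.
have nC : ~ in_hyperplane C.
  by move=> [h h0 hh]; apply: hspan; exists h => // _ [i ->]; apply: hh.
by exists C; split=> //; split=> //; apply: curve_dim1.
Qed.

Lemma gc_compactification : @Veronese_compactification k (2 + r) _ P.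
Proof.
have en : (2 + r + 4 = 3 + r + 3)%N by lia.
have [B [G [e [uB ie Pe]]]] := configuration en hspan.
have [w w0 wG] := gc_conic gcP en uB ie Pe.
have [e' eK' eK] : bijective e by apply: inj_card_bij => //; rewrite !card_ord en.
split=> // F _ hF.
rewrite -(@conic_value k (1 + r) B uB _ F hF e' w G (can_inj eK) w0 wG) /value /eval_points.
congr (_.@[mxvec _ 0]); apply/row_matrixP => i; rewrite !rowK.
by rewrite -{1}(eK i) Pe.
Qed.
End Main.

Theorem theorem2 (k : closedFieldType) (d : nat) (hd : (3 <= d)%N)
    (P : 'I_(d + 4) -> 'rV[k]_d.+1) (hP : forall i, P i != 0)
    (hspan : ~ in_hyperplane (fun x => exists i, x = P i)) :
  (Veronese_compactification P <->
     exists C : 'rV[k]_d.+1 -> Prop, quasi_Veronese C /\ forall i, C (P i))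
  /\
  (Veronese_compactification P <->
     forall (I : {set 'I_(d + 4)}) (i1 i2 i3 i4 i5 i6 : 'I_(d + 4)),
       I = [set i1; i2; i3; i4; i5; i6] ->
       (i1 < i2)%N -> (i2 < i3)%N -> (i3 < i4)%N -> (i4 < i5)%N -> (i5 < i6)%N ->
       let J := [seq P j | j <- enum (~: I)] in
       join (join (join
         (meet [:: P i1; P i2] (P i4 :: P i5 :: J))
         (meet [:: P i2; P i3] (P i5 :: P i6 :: J)))
         (meet [:: P i3; P i4] (P i6 :: P i1 :: J)))
         (extensor J) = 0).
Proof.
case: d hd P hP hspan => [|[|r]] // _ P hP hspan.
have gc : @gc_condition k r _ P -> Veronese_compactification P := @gc_compactification k r P hP hspan.
have cg : Veronese_compactification P -> @gc_condition k r _ P := @compactification_gc k r P.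
split; split.
- by move=> VP; apply: (@gc_curve k r P hP hspan (cg VP)).
- by move=> [C [qC CP]]; apply: gc; apply: (@curve_gc k r P C qC CP).
- exact: cg.
exact: gc.
Qed.
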